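(* Fix an integer $\Delta\ge 2$. For every $\eta\in(0,1)$ there are constants $c_1,c_2>0$ (depending only on $\eta$ and $\Delta$) such that for every integer $q\ge 2$ and every real $\lambda>1$: (i) if $q>c_1\lambda^{\Delta-1+\eta}$, then the Glauber dynamics $\mathcal{M}_{\mathrm{GD}}(G,\lambda,q)$ mixes rapidly on the class of connected graphs $G$ of maximum degree $\Delta$; (ii) if $\Delta\ge 3$ and $q<c_2\lambda^{\Delta-1-\frac{1}{\Delta-1}-\eta}$, then the Glauber dynamics mixes slowly for almost all $\Delta$-regular graphs, i.e. there is a constant $b>0$ such that, for $G$ drawn uniformly from $\mathcal{G}_{n,\Delta}$, asymptotically almost surely (as $n\to\infty$) $\tau(\mathcal{M}_{\mathrm{GD}}(G,\lambda,q))\ge 2^{bn}$.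
   Context: Potts model: for a graph $G=(V,E)$ with $n=|V|$, a positive integer $q$, $[q]=\{1,\dots,q\}$ and $\lambda>1$, a configuration is any $\sigma\in\Omega=[q]^V$ (not necessarily proper); $\mu(\sigma)$ is the number of monochromatic edges (edges whose endpoints get the same colour). The Gibbs distribution is $\pi(\sigma)=\lambda^{\mu(\sigma)}/Z$ with partition function $Z=Z(G,\lambda,q)=\sum_{\sigma\in\Omega}\lambda^{\mu(\sigma)}$. The Glauber dynamics $\mathcal{M}_{\mathrm{GD}}(G,\lambda,q)$ is the Markov chain on $\Omega$ which, from state $X_t$, chooses a vertex $v$ uniformly at random, chooses a colour $c\in[q]$ with probability proportional to $\lambda^{n(X_t,v,c)}$ (where $n(X,v,c)$ is the number of neighbours of $v$ coloured $c$ in $X$), and sets $X_{t+1}$ equal to $X_t$ except that $v$ receives colour $c$. For a Markov chain $\mathcal{M}$ with transition matrix $P$ and stationary distribution $\pi$, $\tau_x(\mathcal{M},\varepsilon)=\min\{t:\|P^t(x,\cdot)-\pi\|_{TV}\le\varepsilon\}$, $\tau(\mathcal{M},\varepsilon)=\max_x\tau_x(\mathcal{M},\varepsilon)$, and $\tau(\mathcal{M})=\tau(\mathcal{M},1/(2e))$, where $\|\phi-\phi'\|_{TV}=\frac12\sum_x|\phi(x)-\phi'(x)|$. ''Mixes rapidly on a class of graphs'' means: for every fixed $\varepsilon>0$ there is a polynomial $p$ (possibly depending on $\varepsilon,\Delta,\lambda,q$) with $\tau(\mathcal{M}_{\mathrm{GD}}(G,\lambda,q),\varepsilon)\le p(n)$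 for every $n$-vertex graph $G$ in the class. $\mathcal{G}_{n,\Delta}$ denotes the uniform probability space of $\Delta$-regular simple graphs on vertex set $\{1,\dots,n\}$ ($n$ even if $\Delta$ odd); an event holds asymptotically almost surely (a.a.s.) if its probability tends to $1$ as $n\to\infty$. *)

(* Defs.v *)
From Stdlib Require Import Reals ClassicalEpsilon.
From mathcomp Require Import all_boot.
Set Implicit Arguments. Unset Strict Implicit. Unset Printing Implicit Defensive.

Definition graph (n : nat) := {ffun 'I_n * 'I_n -> bool}.
Definition adj (n : nat) (G : graph n) : rel 'I_n := fun u v => G (u, v).
Definition simpleb (n : nat) (G : graph n) : bool :=
  [forall u, forall v, adj G u v == adj G v u] && [forall u, ~~ adj G u u].
Definition deg (n : nat) (G : graph n) (v : 'I_n) : nat := #|[set w | adj G v w]|.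
Definition max_degree_eq (n D : nat) (G : graph n) : bool :=
  [forall v, deg G v <= D] && [exists v, deg G v == D].
Definition connectedb (n : nat) (G : graph n) : bool :=
  [forall u, forall v, connect (adj G) u v].
Definition regularb (n D : nat) (G : graph n) : bool :=
  simpleb G && [forall v, deg G v == D].

Definition config (n q : nat) := {ffun 'I_n -> 'I_q}.

Open Scope R_scope.

Definition mono (n q : nat) (G : graph n) (s : config n q) : nat :=
  #|[set p : 'I_n * 'I_n | [&& (p.1 < p.2)%N, adj G p.1 p.2 & s p.1 == s p.2]]|.
Definition weight (n q : nat) (G : graph n) (lam : R) (s : config n q) : R :=
  pow lam (mono G s).
Definition partZ (n q : nat) (G : graph n) (lam : R) : R :=
  \big[Rplus/0]_(s : config n q) weight G lam s.
Definition gibbs (n q : nat) (G : graph n) (lam : R) (s : config n q) : R :=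
  weight G lam s / @partZ n q G lam.

Definition nbr (n q : nat) (G : graph n) (s : config n q) (v : 'I_n) (c : 'I_q) : nat :=
  #|[set w | adj G v w && (s w == c)]|.

Definition glauber (n q : nat) (G : graph n) (lam : R) (s t : config n q) : R :=
  \big[Rplus/0]_(v : 'I_n)
    ((if [forall w, (w != v) ==> (s w == t w)]
      then pow lam (nbr G s v (t v)) /
             (\big[Rplus/0]_(c : 'I_q) pow lam (nbr G s v c))
      else 0) / INR n).

Fixpoint dist (n q : nat) (G : graph n) (lam : R) (x : config n q) (t : nat)
  (y : config n q) {struct t} : R :=
  match t with
  | O => if y == x then 1 else 0
  | S t' => \big[Rplus/0]_(z : config n q) (dist G lam x t' z * glauber G lam z y)
  end.

Definition tv (n q : nat) (mu nu : config n q -> R) : R :=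
  / 2 * \big[Rplus/0]_(s : config n q) Rabs (mu s - nu s).

Definition mixing_time_le (n q : nat) (G : graph n) (lam eps T : R) : Prop :=
  forall x : config n q, exists t : nat,
    INR t <= T /\ tv (dist G lam x t) ((@gibbs n q G lam)) <= eps.

(* tau(M, eps) >= T, i.e. some start x has tau_x(M,eps) >= T
   (including the case where the minimum does not exist, tau_x = infinity) *)
Definition mixing_time_ge (n q : nat) (G : graph n) (lam eps T : R) : Prop :=
  exists x : config n q, forall t : nat,
    INR t < T -> eps < tv (dist G lam x t) ((@gibbs n q G lam)).

(* tau(M) = tau(M, 1/(2e)) *)
Definition eps_std : R := / (2 * exp 1).

Definition poly_eval (p : list R) (x : R) : R :=
  List.fold_right (fun a acc => a + x * acc) 0 p.

Definition decP (P : Prop) : bool :=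
  if excluded_middle_informative P then true else false.

Definition prob_reg (n D : nat) (P : graph n -> Prop) : R :=
  INR #|[set G : graph n | regularb D G && decP (P G)]|
  / INR #|[set G : graph n | regularb D G]|.

Definition aas (D : nat) (P : forall n : nat, graph n -> Prop) : Prop :=
  forall e : R, 0 < e -> exists N : nat, forall n : nat,
    (N <= n)%N -> ~~ odd (D * n) -> Rabs (prob_reg D (P n) - 1) < e.

(* Main.v *)
(** Rapid mixing.  Cover the graph by connected blocks of [S >= 1 / eta] vertices.
    For [q] above the threshold, the Gibbs measure of such a block is nearly
    uniform under every boundary condition, so the dynamics that resamples a
    random block contracts the sum of the oscillations of a function.  By
    reversibility this contraction is a Poincare inequality for the block
    dynamics, and comparing the Dirichlet forms inside each block of bounded size
    turns it into a polynomial spectral gap for the single-site dynamics.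

    Slow mixing.  A switching argument shows that in almost every regular graph
    all vertex sets of size [k = n / s] span at most about [k + k / r] edges, with
    [s] and [r] constants.  On such a graph the configurations with exactly [k]
    vertices outside colour [c0] carry exponentially less weight than the
    monochromatic one, so they form a bottleneck around the configurations with
    fewer than [k] such vertices, which have probability at most one half by colour
    symmetry. *)

Require Import Defs.
From Stdlib Require Import Reals ClassicalEpsilon.
From mathcomp Require Import all_boot.
From mathcomp Require Import all_order all_fingroup all_algebra archimedean.
From mathcomp Require Import Rstruct.
From mathcomp Require Import ring lra zify.
Set Implicit Arguments. Unset Strict Implicit. Unset Printing Implicit Defensive.
Import Order.TTheory GRing.Theory Num.Theory.
Local Open Scope ring_scope.

(** * Reversible chains *)

(** The block size answers one colouring. If a block of [S] vertices is wholly coloured like an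
    outer neighbour, up to [(D - 1) * S + 1] edges are monochromatic; against them stand [q ^ S]
    colourings, and with [q] above [c * lam ^ (D - 1 + eta)] these win as soon as [eta * S >= 1]. A
    single vertex with all [D] neighbours of one colour would need [q] of order [lam ^ D].

    The exponent of slow mixing comes from a linear balance. In a set of [k] vertices off colour
    [c0], a vertex with [d] earlier neighbours in the set contributes at most [q + D * lam ^ d]. For
    [q <= lam ^ A] this is at most [(D + 1) * lam ^ (A + y * d)] with [y = (D - A) / D], so the
    product over the set depends only on its number of inner edges, about [k]. Each inner edge is
    also counted once less among the [D * k] edges lost. The set is thus penalised when
    [A + 1 + y < D], and equality holds exactly at [A = D - 1 - 1 / (D - 1)]. The margin [eta] pays
    for the [k / r] extra edges and for the constants to the power [k]. *)

Section ReversibleChains.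
Variables (R : archiRealFieldType) (T : finType) (p : T -> R).
Hypothesis p_ge0 : forall x, 0 <= p x.
Hypothesis p_sum1 : \sum_x p x = 1.

Definition dot (f g : T -> R) := \sum_x p x * (f x * g x).
Definition op (K : T -> T -> R) (f : T -> R) x := \sum_y K x y * f y.
Definition reversible (K : T -> T -> R) := forall x y, p x * K x y = p y * K y x.
Definition stochastic (K : T -> T -> R) := forall x, \sum_y K x y = 1.
(** The Dirichlet form of [1 - K], in operator form; [energyE] gives the sum of squared differences
    on which chains are compared. *)
Definition energy (K : T -> T -> R) f := dot f f - dot f (op K f).

Lemma dot_ge0 f : 0 <= dot f f.
Proof. by apply: sumr_ge0 => x _; rewrite mulr_ge0 // -expr2 sqr_ge0. Qed.

Lemma dot_opC K f g : reversible K -> dot f (op K g) = dot (op K f) g.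
Proof.
move=> Krev; rewrite /dot /op.
under eq_bigr do rewrite !mulr_sumr.
rewrite exchange_big /=; apply: eq_bigr => x _.
rewrite mulr_suml mulr_sumr; apply: eq_bigr => y _.
transitivity (p y * K y x * (f y * g x)); first by ring.
by rewrite Krev; ring.
Qed.

Lemma CauchySchwarz_dot f g : dot f g ^+ 2 <= dot f f * dot g g.
Proof.
(* Lagrange's identity: this double sum is twice the difference of the two sides. *)
have H : 0 <= \sum_x \sum_y p x * p y * (f x * g y - f y * g x) ^+ 2.
  apply: sumr_ge0 => x _; apply: sumr_ge0 => y _.
  by rewrite mulr_ge0 ?sqr_ge0 // mulr_ge0.
suff E : \sum_x \sum_y p x * p y * (f x * g y - f y * g x) ^+ 2 =
         dot f f * dot g g + dot f f * dot g g - dot f g ^+ 2 - dot f g ^+ 2 by lra.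
transitivity (\sum_x \sum_y
   (p x * (f x * f x) * (p y * (g y * g y)) + p y * (f y * f y) * (p x * (g x * g x))
    - p x * (f x * g x) * (p y * (f y * g y)) - p x * (f x * g x) * (p y * (f y * g y)))).
  by apply: eq_bigr => x _; apply: eq_bigr => y _; ring.
have S a b : \sum_x \sum_y (a x : R) * (b y : R) = (\sum_(x : T) a x) * (\sum_(y : T) b y).
  by rewrite mulr_suml; apply: eq_bigr => x _; rewrite mulr_sumr.
have S' (a b : T -> R) : \sum_x \sum_y a y * b x = (\sum_x a x) * (\sum_y b y).
  by rewrite exchange_big S.
under eq_bigr do rewrite !sumrB big_split.
by rewrite !sumrB big_split /= S' !S -!expr2.
Qed.

Lemma sqr_mean_le (f : T -> R) : (\sum_x p x * f x) ^+ 2 <= dot f f.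
Proof.
have := CauchySchwarz_dot f (fun=> 1).
rewrite {3}/dot; under [X in _ * X]eq_bigr do rewrite !mulr1.
rewrite p_sum1 mulr1 /dot; under [X in X ^+ 2]eq_bigr do rewrite mulr1.
by [].
Qed.

Lemma mean_op K f : reversible K -> stochastic K ->
  \sum_x p x * op K f x = \sum_x p x * f x.
Proof.
move=> Krev Ksto; rewrite /op.
under eq_bigr do rewrite mulr_sumr.
rewrite exchange_big /=; apply: eq_bigr => y _.
transitivity (\sum_x p y * f y * K y x).
  by apply: eq_bigr => x _; rewrite mulrA Krev; ring.
by rewrite -mulr_sumr Ksto mulr1.
Qed.

Lemma mean_iter K f t : reversible K -> stochastic K ->
  \sum_x p x * iter t (op K) f x = \sum_x p x * f x.
Proof. by move=> Krev Ksto; elim: t => //= t <-; rewrite mean_op. Qed.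

Lemma op_subr K f c x : stochastic K -> op K (fun y => f y - c) x = op K f x - c.
Proof.
move=> Ksto; rewrite /op; under eq_bigr do rewrite mulrBr.
by rewrite sumrB -mulr_suml Ksto mul1r.
Qed.

Lemma eq_op K f g : f =1 g -> op K f =1 op K g.
Proof. by move=> fg x; apply: eq_bigr => y _; rewrite fg. Qed.

Lemma iter_op_subr K f c t : stochastic K ->
  iter t (op K) (fun y => f y - c) =1 (fun x => iter t (op K) f x - c).
Proof.
move=> Ksto; elim: t => //= t IH x.
by rewrite (eq_op _ IH) op_subr.
Qed.

Lemma energyE K f : reversible K -> stochastic K ->
  energy K f = 2^-1 * \sum_x \sum_y p x * K x y * (f x - f y) ^+ 2.
Proof.
move=> Krev Ksto.
have E : \sum_x \sum_y p x * K x y * (f x - f y) ^+ 2 =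
   \sum_x \sum_y p x * K x y * (f x * f x) + \sum_x \sum_y p y * K y x * (f y * f y) -
   \sum_x \sum_y p x * (f x * (K x y * f y)) *+ 2.
  rewrite -big_split -sumrB; apply: eq_bigr => x _.
  rewrite -big_split -sumrB; apply: eq_bigr => y _ /=.
  by rewrite -(Krev x y); ring.
rewrite {}E [X in _ + X - _]exchange_big /=.
have -> : \sum_x \sum_y p x * K x y * (f x * f x) = dot f f.
  by apply: eq_bigr => x _; rewrite -mulr_suml -mulr_sumr Ksto mulr1.
have -> : \sum_x \sum_y p x * (f x * (K x y * f y)) *+ 2 = dot f (op K f) *+ 2.
  rewrite -sumrMnl; apply: eq_bigr => x _; rewrite sumrMnl; congr (_ *+ 2).
  by rewrite /op !mulr_sumr.
rewrite /energy; lra.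
Qed.

Lemma energy_subr K f c : reversible K -> stochastic K ->
  energy K (fun x => f x - c) = energy K f.
Proof.
move=> Krev Ksto; rewrite !energyE //; congr (_ * _).
by apply: eq_bigr => x _; apply: eq_bigr => y _; congr (_ * _ ^+ 2); ring.
Qed.

Lemma bernoulli (x : R) t : 0 <= x -> 1 + t%:R * x <= (1 + x) ^+ t.
Proof.
move=> x0; elim: t => [|t IH]; first by rewrite mul0r addr0 expr0.
rewrite exprS (le_trans _ (ler_wpM2l _ IH)) //; last lra.
have : 0 <= t%:R :> R by [].
rewrite -natr1; nra.
Qed.

(* The sequence [a t = |A^t f|^2] is log-convex by self-adjointness, so its first ratio is its smallest one. *)
Lemma iter_decay K f C r : reversible K -> 0 < r ->
  (forall t, dot (iter t (op K) f) (iter t (op K) f) <= C * r ^+ t) ->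
  dot (op K f) (op K f) <= r * dot f f.
Proof.
move=> Krev r0 H; set a := fun t => dot (iter t (op K) f) (iter t (op K) f).
have a0 t : 0 <= a t by apply: dot_ge0.
have logcvx t : a t.+1 ^+ 2 <= a t * a t.+2.
  have -> : a t.+1 = dot (iter t (op K) f) (iter t.+2 (op K) f).
    by rewrite /a /= [RHS]dot_opC.
  by apply: CauchySchwarz_dot.
rewrite leNgt; apply/negP => gt.
rewrite -[dot f f]/(a 0%N) -[dot (op K f) _]/(a 1%N) in gt.
have pos t : 0 < a t /\ r * a t < a t.+1 /\ a 1%N * a t <= a 0%N * a t.+1.
  have a1 : 0 < a 1%N by rewrite (le_lt_trans _ gt) // mulr_ge0 // ltW.
  have a00 : 0 < a 0%N.
    rewrite lt_def a0 andbT; apply/eqP => z; have := logcvx 0%N.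
    by rewrite z mul0r leNgt exprn_gt0.
  elim: t => [|t [p1 [p2 p3]]]; first by split => //; split => //; rewrite mulrC.
  have p4 : 0 < a t.+1 by rewrite (le_lt_trans _ p2) // mulr_ge0 // ltW.
  have p5 : a 1%N * a t.+1 <= a 0%N * a t.+2.
    rewrite -(ler_pM2r p1) (_ : a 1%N * a t.+1 * a t = a 1%N * a t * a t.+1); last by ring.
    apply: le_trans (ler_wpM2r (ltW p4) p3) _.
    rewrite -!mulrA -expr2 [a t.+2 * _]mulrC ler_wpM2l //.
  split => //; split => //.
  rewrite -(ltr_pM2l a00) (lt_le_trans _ p5) // mulrCA mulrA ltr_pM2r //.
have [a00 _] := pos 0%N.
(* The excess of the first ratio over [r]. It persists, so [(1 + x) ^ t] would stay bounded by
   [C / a 0], against Bernoulli's inequality. *)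
set x := a 1%N / (r * a 0%N) - 1.
have ra0 : 0 < r * a 0%N by rewrite mulr_gt0.
have x0 : 0 < x by rewrite subr_gt0 ltr_pdivlMr // mul1r.
have lb t : (1 + x) ^+ t * (r ^+ t * a 0%N) <= a t.
  elim: t => [|t IH]; first by rewrite !expr0 !mul1r.
  have -> : (1 + x) ^+ t.+1 * (r ^+ t.+1 * a 0%N) =
            ((1 + x) ^+ t * (r ^+ t * a 0%N)) * ((1 + x) * r) by rewrite !exprS; ring.
  have e1 : (1 + x) * r = a 1%N / a 0%N.
    rewrite /x addrC subrK; field; by rewrite !gt_eqF.
  rewrite e1 mulrA ler_pdivrMr //.
  have [_ [_ p3]] := pos t.
  by rewrite [leRHS]mulrC (le_trans _ p3) // mulrC ler_wpM2l.
have C0 t : t%:R * x * a 0%N <= C.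
  have := le_trans (lb t) (H t); rewrite mulrCA mulrC ler_pM2r ?exprn_gt0 //.
  move=> h; apply: le_trans _ h; rewrite ler_wpM2r //.
  by apply: le_trans _ (bernoulli t (ltW x0)); rewrite lerDr.
have xa : 0 < x * a 0%N by rewrite mulr_gt0.
have C00 : 0 <= C by have := C0 0%N; rewrite !mul0r.
have := C0 (Num.Def.archi_bound (C / (x * a 0%N))).
have := archi_boundP (divr_ge0 C00 (ltW xa)).
by rewrite ltr_pdivrMr // mulrA => h1 /(lt_le_trans h1); rewrite ltxx.
Qed.

(* [hb e] resamples from [p] conditioned on the equivalence class of the current state. *)
Definition hb (e : rel T) x y := if e x y then p y / \sum_(z | e x z) p z else 0.

Section HeatBath.
Variable e : rel T.
Hypothesis p_gt0 : forall x, 0 < p x.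
Hypothesis e_equiv : equivalence_rel e.

Lemma equiv_refl x : e x x. Proof. by have [] := e_equiv x x x. Qed.

Lemma equiv_sym x y : e x y = e y x.
Proof.
apply/idP/idP => h.
  by have [_ /(_ h)] := e_equiv x y x; rewrite equiv_refl => <-.
by have [_ /(_ h)] := e_equiv y x y; rewrite equiv_refl => <-.
Qed.

Lemma equiv_eql x y : e x y -> e x =1 e y.
Proof. by move=> h z; have [_ ->] := e_equiv x y z. Qed.

Lemma class_sum_gt0 x : 0 < \sum_(z | e x z) p z.
Proof.
rewrite (bigD1 x) ?equiv_refl //= ltr_pwDl // sumr_ge0 // => z _; exact: ltW.
Qed.

Lemma hb_ge0 x y : 0 <= hb e x y.
Proof. by rewrite /hb; case: ifP => // _; rewrite divr_ge0 // ltW // class_sum_gt0. Qed.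

Lemma hb_class x y : e x y -> hb e x =1 hb e y.
Proof.
by move=> h z; rewrite /hb (equiv_eql h); case: ifP => // _; rewrite (eq_bigl _ _ (equiv_eql h)).
Qed.

Lemma hb_rev : reversible (hb e).
Proof.
move=> x y; rewrite /hb [e y x]equiv_sym; case: ifP => h; last by rewrite !mulr0.
rewrite (eq_bigl _ _ (equiv_eql h)); ring.
Qed.

Lemma hb_sto : stochastic (hb e).
Proof.
move=> x; rewrite /hb -big_mkcond /= -mulr_suml divff // gt_eqF // class_sum_gt0 //.
Qed.

(** A heat bath is the conditional expectation given the class of the state, hence an orthogonal
    projection. *)
Lemma op_hb_idem f : dot (op (hb e) f) (op (hb e) f) = dot f (op (hb e) f).
Proof.
rewrite -dot_opC; last exact: hb_rev.
apply: eq_bigr => x _; congr (_ * (_ * _)).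
rewrite {1}/op; transitivity (\sum_y hb e x y * op (hb e) f x).
  apply: eq_bigr => y _; have [h|/negbTE h] := boolP (e x y); last by rewrite /hb h !mul0r.
  by congr (_ * _); apply: eq_bigr => z _; rewrite -(hb_class h).
by rewrite -mulr_suml hb_sto mul1r.
Qed.

End HeatBath.

Lemma sqr_sum_le (I : finType) (a : I -> R) : (\sum_i a i) ^+ 2 <= #|I|%:R * \sum_i a i ^+ 2.
Proof.
have H : 0 <= \sum_i \sum_j (a i - a j) ^+ 2.
  by apply: sumr_ge0 => i _; apply: sumr_ge0 => j _; apply: sqr_ge0.
have E : \sum_i \sum_j (a i - a j) ^+ 2 =
   (#|I|%:R * \sum_i a i ^+ 2) *+ 2 - (\sum_i a i) ^+ 2 *+ 2.
  transitivity (\sum_i \sum_j (a i ^+ 2 + a j ^+ 2 - a i * a j *+ 2)).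
    by apply: eq_bigr => i _; apply: eq_bigr => j _; ring.
  have sc (c : R) : \sum_(i : I) c = #|I|%:R * c by rewrite sumr_const mulr_natl.
  under eq_bigr do rewrite sumrB big_split /= sc sumrMnl -mulr_sumr.
  rewrite sumrB big_split /= sc sumrMnl -mulr_suml -mulr_sumr.
  by move: (#|I|%:R : R) => N; ring.
lra.
Qed.

Section Average.
Variables (I : finType) (K : I -> T -> T -> R).
Hypothesis I_gt0 : (0 < #|I|)%N.

Definition avg x y := (\sum_i K i x y) / #|I|%:R.

Let N0 : 0 < #|I|%:R :> R. Proof. by rewrite ltr0n. Qed.

Lemma op_avg f x : op avg f x = (\sum_i op (K i) f x) / #|I|%:R.
Proof.
rewrite /op exchange_big /= mulr_suml; apply: eq_bigr => y _.
by rewrite /avg -[in RHS]mulr_suml; ring.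
Qed.

Lemma dot_avg f g : dot f (op avg g) = (\sum_i dot f (op (K i) g)) / #|I|%:R.
Proof.
rewrite exchange_big mulr_suml; apply: eq_bigr => x _.
by rewrite op_avg -mulr_sumr -mulr_sumr !mulrA.
Qed.

Lemma avg_rev : (forall i, reversible (K i)) -> reversible avg.
Proof.
move=> Krev x y; rewrite /avg !mulrA !mulr_sumr; congr (_ / _).
by apply: eq_bigr => i _; apply: Krev.
Qed.

Lemma avg_sto : (forall i, stochastic (K i)) -> stochastic avg.
Proof.
move=> Ksto x; rewrite /avg -mulr_suml exchange_big /=.
under eq_bigr do rewrite Ksto.
by rewrite sumr_const -mulr_natl mulr1 divff // gt_eqF.
Qed.

Lemma energy_avg f : energy avg f = (\sum_i energy (K i) f) / #|I|%:R.
Proof.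
rewrite /energy dot_avg sumrB mulrBl sumr_const -mulr_natl; congr (_ - _).
by field; rewrite gt_eqF.
Qed.

(** An average of projections dominates its own square, because the square of a mean is at most the
    mean of the squares. No negative eigenvalue is left to control, so the chain need not be made
    lazy. *)
Lemma avg_contraction f : (forall i, reversible (K i)) ->
  (forall i, dot (op (K i) f) (op (K i) f) = dot f (op (K i) f)) ->
  dot (op avg f) (op avg f) <= dot f (op avg f).
Proof.
move=> Krev idem; rewrite [leRHS]dot_avg.
have -> : \sum_i dot f (op (K i) f) = \sum_i dot (op (K i) f) (op (K i) f).
  by apply: eq_bigr => i _; rewrite idem.
rewrite exchange_big mulr_suml; apply: ler_sum => x _ /=.
rewrite -mulr_sumr -mulrA ler_wpM2l // op_avg -expr2 expr_div_n.
rewrite ler_pdivrMr ?exprn_gt0 // (le_trans (sqr_sum_le _)) //.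
have -> : \sum_i op (K i) f x * op (K i) f x = \sum_i op (K i) f x ^+ 2.
  by apply: eq_bigr => i _; rewrite expr2.
rewrite le_eqVlt; apply/orP; left; apply/eqP.
move: N0; move: (#|I|%:R : R) => N N_gt0; field; by rewrite gt_eqF.
Qed.

End Average.

Definition var f := dot (fun x => f x - \sum_y p y * f y) (fun x => f x - \sum_y p y * f y).

Lemma varE f : var f = dot f f - (\sum_y p y * f y) ^+ 2.
Proof.
rewrite /var /dot; set m := \sum_y p y * f y.
transitivity (\sum_x (p x * (f x * f x) - (p x * f x) * (m *+ 2) + p x * m ^+ 2)).
  by apply: eq_bigr => x _; ring.
by rewrite big_split sumrB /= -!mulr_suml p_sum1 -/m; ring.
Qed.

Lemma var_decay K f gam t : reversible K -> stochastic K -> 0 <= gam <= 1 ->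
  (forall g, dot (op K g) (op K g) <= dot g (op K g)) ->
  (forall g, gam * var g <= energy K g) ->
  var (iter t (op K) f) <= (1 - gam) ^+ t * var f.
Proof.
move=> Krev Ksto /andP[g0 g1] Kc gap; elim: t => [|t IH] /=; first by rewrite mul1r.
set g := iter t _ f in IH *.
rewrite exprS -mulrA; apply: le_trans (ler_wpM2l _ IH); last by lra.
rewrite mulrBl mul1r; apply: le_trans (_ : var g - energy K g <= _); last by rewrite lerD2l lerN2.
by rewrite !varE mean_op // /energy; have := Kc g; lra.
Qed.

(** Turns decay at a given rate, with an arbitrary prefactor [C], into a Poincare inequality. Unlike
    a bound on oscillations, this can be transferred from one chain to another. *)
Lemma gap_of_contraction K f kap C : reversible K -> stochastic K -> 0 <= kap < 1 ->
  (forall t, var (iter t (op K) f) <= C * ((1 - kap) ^+ 2) ^+ t) ->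
  kap * var f <= energy K f.
Proof.
move=> Krev Ksto /andP[k0 k1] H.
set m := \sum_y p y * f y; set g := fun x => f x - m.
have gi t : dot (iter t (op K) g) (iter t (op K) g) <= C * ((1 - kap) ^+ 2) ^+ t.
  apply: le_trans _ (H t); rewrite /var mean_iter // -/m le_eqVlt; apply/orP; left; apply/eqP.
  by apply: eq_bigr => x _; rewrite !iter_op_subr.
have r0 : 0 < 1 - kap by lra.
have := iter_decay Krev (exprn_gt0 2 r0) gi => h.
have cs := CauchySchwarz_dot g (op K g).
have gg : dot g (op K g) <= (1 - kap) * dot g g.
  have d0 := dot_ge0 g.
  apply: le_trans (ler_norm _) _.
  rewrite -(@ler_pXn2r _ 2) // ?nnegrE ?mulr_ge0 ?normr_ge0 //; last lra.
  rewrite real_normK ?num_real // (le_trans cs) // exprMn expr2 [dot g g ^+ 2]expr2 mulrA mulrC ler_wpM2r //.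
rewrite -(energy_subr f m Krev Ksto) -/g /energy -[var f]/(dot g g); lra.
Qed.

End ReversibleChains.

(** * Configurations and monochromatic edges *)

Lemma adj_sym n (G : graph n) u v : simpleb G -> adj G u v = adj G v u.
Proof. by case/andP => /forallP /(_ u) /forallP /(_ v) /eqP. Qed.

Lemma adj_irr n (G : graph n) u : simpleb G -> adj G u u = false.
Proof. by case/andP => _ /forallP /(_ u) /negbTE. Qed.

Section Configurations.
Variables (n q : nat).
Implicit Types (s t : config n q) (v u : 'I_n) (c : 'I_q) (l : seq 'I_n).

Definition upd s v c : config n q := [ffun w => if w == v then c else s w].
(** Its classes are the colourings of the block [B] under one boundary condition. *)
Definition eqoff (B : {pred 'I_n}) s t := [forall v, (v \in B) || (s v == t v)].

Lemma updE s v c w : upd s v c w = if w == v then c else s w.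
Proof. by rewrite ffunE. Qed.

Lemma upd_same s v c : upd s v c v = c. Proof. by rewrite updE eqxx. Qed.

Lemma upd_id s v : upd s v (s v) = s.
Proof. by apply/ffunP => w; rewrite updE; case: eqP => // ->. Qed.

Lemma upd_upd s v c c' : upd (upd s v c) v c' = upd s v c'.
Proof. by apply/ffunP => w; rewrite !updE; case: eqP. Qed.

Lemma eqoffP B s t : reflect (forall v, v \notin B -> s v = t v) (eqoff B s t).
Proof.
apply: (iffP forallP) => h v; first by move=> vB; have := h v; rewrite (negbTE vB) => /eqP.
by case: (boolP (v \in B)) => // /h ->; rewrite eqxx.
Qed.

Lemma eqoff_refl B s : eqoff B s s. Proof. exact/eqoffP. Qed.

Lemma eqoff_sym B s t : eqoff B s t = eqoff B t s.
Proof. by apply/eqoffP/eqoffP => h v vB; rewrite h. Qed.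

Lemma eqoff_equiv B : equivalence_rel (eqoff B).
Proof.
move=> x y z; split; first exact: eqoff_refl.
move=> /eqoffP h; apply/eqoffP/eqoffP => h' v vB; first by rewrite -h // h'.
by rewrite h // h'.
Qed.

Lemma eq_eqoff (B B' : {pred 'I_n}) : B =i B' -> eqoff B =2 eqoff B'.
Proof. by move=> h s t; apply: eq_forallb => v; rewrite h. Qed.

Lemma eqoff_upd s v c : eqoff (pred1 v) s (upd s v c).
Proof. by apply/eqoffP => w; rewrite inE updE => /negbTE ->. Qed.

Lemma eqoff1P s t v : eqoff (pred1 v) s t -> t = upd s v (t v).
Proof.
move/eqoffP => h; apply/ffunP => w; rewrite updE; case: eqVneq => [->//|wv].
by rewrite h // inE.
Qed.

Lemma sum_eqoff_cons (R : nmodType) v l s (F : config n q -> R) : v \notin l ->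
  \sum_(t | eqoff (mem (v :: l)) s t) F t = \sum_c \sum_(t | eqoff (mem l) (upd s v c) t) F t.
Proof.
move=> vl; rewrite (partition_big (fun t => t v) predT) //=.
apply: eq_bigr => c _; apply: eq_bigl => t.
apply/andP/eqoffP => [[/eqoffP h /eqP <-] w wl|h].
  rewrite updE; case: eqP => [->//|/eqP wv]; apply: h.
  by rewrite !inE negb_or wv.
split; last by rewrite -(h v vl) upd_same.
apply/eqoffP => w; rewrite !inE negb_or => /andP[wv wl].
by rewrite -(h w wl) updE (negbTE wv).
Qed.

Lemma sum_eqoff_nil (R : nmodType) s (F : config n q -> R) :
  \sum_(t | eqoff (mem [::]) s t) F t = F s.
Proof.
rewrite (big_pred1 s) // => t; apply/eqoffP/eqP => [h|-> //].
by apply/ffunP => w; rewrite h.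
Qed.

Lemma card_eqoff l s : uniq l -> #|[pred t | eqoff (mem l) s t]| = (q ^ size l)%N.
Proof.
move=> ul; rewrite -sum1_card.
elim: l s ul => [|v l IH] s /=; first by rewrite (sum_eqoff_nil s (fun=> 1%N)).
move=> /andP[vl ul]; rewrite (sum_eqoff_cons s (fun=> 1%N) vl).
under eq_bigr do rewrite IH //.
by rewrite sum_nat_const card_ord expnS.
Qed.

Section ListProducts.
Variable R : archiRealFieldType.

(** The factor of [v] receives the tail of the list, that is, the vertices still uncoloured when [v]
    gets its colour. *)
Fixpoint lprod (g : seq 'I_n -> 'I_n -> R) l : R :=
  if l is v :: l' then g l' v * lprod g l' else 1.

Lemma lprod_ge0 g l : (forall l v, 0 <= g l v) -> 0 <= lprod g l.
Proof. by move=> h; elim: l => //= v l IH; rewrite mulr_ge0. Qed.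

Lemma lprod_ge1 g l : (forall l v, 1 <= g l v) -> 1 <= lprod g l.
Proof.
move=> h; elim: l => //= v l IH; have := h l v; nra.
Qed.

(* Colouring the vertices of [l] from its head on, the factor [g l v] of a vertex only involves vertices that are coloured no later than [v]. *)
Lemma sum_lprod_le (g : seq 'I_n -> 'I_n -> config n q -> R) K l s : uniq l ->
  (forall l v t, 0 <= g l v t) ->
  (forall l v t t', v \notin l -> eqoff (mem l) t t' -> g l v t = g l v t') ->
  (forall l v t, \sum_c g l v (upd t v c) <= K l v) ->
  \sum_(t | eqoff (mem l) s t) lprod (fun l v => g l v t) l <= lprod K l.
Proof.
move=> ul g0 gi gK.
have K0 l' v : 0 <= K l' v by apply: le_trans (gK l' v s); apply: sumr_ge0.
elim: l s ul => [|v l IH] s /=; first by rewrite (sum_eqoff_nil s (fun=> 1)).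
move=> /andP[vl ul]; rewrite (sum_eqoff_cons s _ vl).
apply: le_trans (_ : \sum_c g l v (upd s v c) * lprod K l <= _).
  apply: ler_sum => c _; apply: le_trans (ler_wpM2l (g0 _ _ _) (IH (upd s v c) ul)).
  rewrite mulr_sumr; by apply: ler_sum => t /(gi _ _ _ _ vl) ->.
by rewrite -mulr_suml ler_wpM2r // lprod_ge0.
Qed.

Lemma lprod_const (K : R) l : lprod (fun _ _ => K) l = K ^+ size l.
Proof. by elim: l => //= v l ->; rewrite exprS. Qed.

End ListProducts.

Section Edges.
Variable G : graph n.

Definition mono_off (B : {pred 'I_n}) s : nat :=
  #|[set p : 'I_n * 'I_n | [&& (p.1 < p.2)%N, adj G p.1 p.2, s p.1 == s p.2,
                             p.1 \notin B & p.2 \notin B]]|.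
(** Counts the monochromatic edges with at least one end in [B]: the part of the weight that
    recolouring the block can change. *)
Definition mono_on B s := (mono G s - mono_off B s)%N.
(** The monochromatic edges that [v] closes when [l] is still uncoloured. [S] is [predT] for block
    weights, and the set off colour [c0] in the bottleneck estimate. *)
Definition same_nbr (S : {pred 'I_n}) l v s : nat :=
  #|[set u | [&& adj G v u, u \notin l, u \in S & s u == s v]]|.

Fixpoint lsum (f : seq 'I_n -> 'I_n -> nat) l : nat :=
  if l is v :: l' then (f l' v + lsum f l')%N else 0%N.

Lemma mono_off_le B s : (mono_off B s <= mono G s)%N.
Proof. by apply: subset_leq_card; apply/subsetP => p; rewrite !inE => /and5P[-> -> -> _ _]. Qed.

Lemma mono_on_off B s : mono G s = (mono_on B s + mono_off B s)%N.
Proof. by rewrite subnK // mono_off_le. Qed.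

Lemma mono_off_eqoff (B : {pred 'I_n}) s t : eqoff B s t -> mono_off B s = mono_off B t.
Proof.
move=> /eqoffP h; congr #|pred_of_set _|; apply/setP => p; rewrite !inE.
case: (p.1 < p.2)%N => //; case: adj => //=.
case: (boolP (p.1 \in B)) => h1; first by rewrite !andbF.
case: (boolP (p.2 \in B)) => h2; first by rewrite !andbF.
by rewrite !h.
Qed.

Lemma eq_mono_off (B B' : {pred 'I_n}) s : B =i B' -> mono_off B s = mono_off B' s.
Proof. by move=> h; congr #|pred_of_set _|; apply/setP => p; rewrite !inE !h. Qed.

Lemma eq_mono_on (B B' : {pred 'I_n}) s : B =i B' -> mono_on B s = mono_on B' s.
Proof. by move=> h; rewrite /mono_on (eq_mono_off s h). Qed.

Lemma same_nbr_eqoff S l v s t : v \notin l -> eqoff (mem l) s t ->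
  same_nbr S l v s = same_nbr S l v t.
Proof.
move=> vl /eqoffP h; congr #|pred_of_set _|; apply/setP => u; rewrite !inE.
case: adj => //=; case: (boolP (u \in l)) => //= ul; by rewrite !h.
Qed.

Hypothesis Gs : simpleb G.

Lemma mono_off_cons v l s : v \notin l ->
  mono_off (mem l) s = (same_nbr predT l v s + mono_off (mem (v :: l)) s)%N.
Proof.
(* Edges are counted as increasing pairs; [f] orients the edge between [u] and [v]. *)
move=> vl; pose f u := if (u < v)%N then (u, v) else (v, u).
have finj : injective f.
  by move=> u u'; rewrite /f; case: ifP => _; case: ifP => _ []; congruence.
rewrite /same_nbr -(card_imset _ finj) addnC.
rewrite [LHS]/mono_off -[LHS](cardsID [set p | v \in [:: p.1; p.2]]) addnC.
congr (_ + _)%N; congr #|pred_of_set _|; apply/setP => -[a b]; rewrite !inE /=.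
  rewrite !negb_or; case: (a < b)%N => //; case: adj => //; case: (s a == s b) => //=; rewrite ?andbF //.
  by rewrite ![v == _]eq_sym; case: (a == v); case: (b == v); rewrite ?andbF ?andbT.
apply/idP/imsetP.
  move=> /andP[/and5P[ab aG sab al bl] /orP[/eqP va|/eqP vb]]; subst.
    exists b; last by rewrite /f ltnNge ltnW.
    by rewrite !inE aG bl eq_sym sab.
  exists a; last by rewrite /f ab.
  by rewrite !inE adj_sym // aG al sab.
move=> [u]; rewrite !inE /= => /and3P[vu ul suv].
have nuv : u != v by apply: contraTneq vu => ->; rewrite adj_irr.
rewrite /f; case: ltngtP => [h|h|/val_inj h]; last by rewrite h eqxx in nuv.
  by move=> [-> ->]; rewrite h adj_sym // vu suv ul vl eqxx orbT.
by move=> [-> ->]; rewrite h vu eq_sym suv ul vl eqxx.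
Qed.

Lemma mono_listE l s : uniq l ->
  mono G s = (lsum (fun l v => same_nbr predT l v s) l + mono_off (mem l) s)%N.
Proof.
elim: l => [_|v l IH /= /andP[vl ul]] /=.
  by rewrite add0n; congr #|pred_of_set _|; apply/setP => p; rewrite !inE andbT.
by rewrite IH // (mono_off_cons s vl) addnCA addnA.
Qed.

Lemma mono_on_listE l s : uniq l ->
  mono_on (mem l) s = lsum (fun l v => same_nbr predT l v s) l.
Proof. by move=> ul; rewrite /mono_on (mono_listE s ul) addnK. Qed.

Lemma mono_on1 v s : mono_on (pred1 v) s = nbr G s v (s v).
Proof.
have -> : mono_on (pred1 v) s = mono_on (mem [:: v]) s.
  by apply: eq_mono_on => w; rewrite !inE.
rewrite mono_on_listE //= addn0; congr #|pred_of_set _|; apply/setP => u; by rewrite !inE.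
Qed.

Lemma mono_on_eq_nonadj (B : {set 'I_n}) s t v : eqoff (pred1 v) s t -> v \notin B ->
  (forall w, w \in B -> ~~ adj G v w) -> mono_on (mem B) s = mono_on (mem B) t.
Proof.
move=> st vB nadj.
have E : B =i enum B by move=> w; rewrite mem_enum.
rewrite !(@eq_mono_on _ (mem (enum B)) _ E) !mono_on_listE ?enum_uniq //.
have : all (fun w => w \in B) (enum B) by apply/allP => w; rewrite mem_enum.
elim: (enum B) => //= w l IH /andP[wB lB]; rewrite IH //; congr (_ + _)%N.
have eqs u : u != v -> s u = t u by move=> uv; move/eqoffP: st; apply; rewrite inE.
congr #|pred_of_set _|; apply/setP => u; rewrite !inE.
case: (boolP (adj G w u)) => //= wu; rewrite !eqs //.
  by apply: contraNneq vB => <-.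
by apply: contraTneq wu => ->; rewrite adj_sym // nadj.
Qed.

End Edges.

Section Bounds.
Variables (R : archiRealFieldType) (lam : R) (D : nat) (G : graph n).
Hypotheses (lam1 : 1 <= lam) (degD : forall v, (deg G v <= D)%N).

Lemma sum_pow_le (x : 'I_q -> nat) M : (forall c, x c <= M)%N ->
  (#|[set c | (0 < x c)%N]| <= D)%N ->
  \sum_c lam ^+ x c <= q%:R + D%:R * lam ^+ M.
Proof.
move=> xM xD.
apply: le_trans (_ : \sum_c (1 + (if (0 < x c)%N then lam ^+ M else 0)) <= _).
  apply: ler_sum => c _; case: (posnP (x c)) => [->|h]; first by rewrite expr0 addr0.
  by apply: le_trans (_ : lam ^+ M <= _); rewrite ?ler_weXn2l // lerDr.
rewrite big_split /= sumr_const card_ord lerD2l -big_mkcond /= sumr_const.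
rewrite -[leLHS]mulr_natl ler_wpM2r //; first by rewrite exprn_ge0 // (le_trans ler01).
rewrite ler_nat (leq_trans _ xD) // leq_eqVlt; apply/orP; left; apply/eqP.
by apply: eq_card => c; rewrite !inE.
Qed.

Lemma same_nbr_le S l v s : (same_nbr G S l v s <= deg G v)%N.
Proof. by apply: subset_leq_card; apply/subsetP => u; rewrite !inE => /and4P[]. Qed.

(** Only the colours of the at most [D] neighbours of [v] can have a positive exponent. [h] will be
    the truncation at [D.-1] for blocks and the identity for the bottleneck. *)
Lemma sum_same_nbr_le S l v s M (h : nat -> nat) : simpleb G -> h 0%N = 0%N ->
  (forall c, h (same_nbr G S l v (upd s v c)) <= M)%N ->
  \sum_c lam ^+ h (same_nbr G S l v (upd s v c)) <= q%:R + D%:R * lam ^+ M.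
Proof.
move=> Gs h0 hM; apply: sum_pow_le => //.
apply: leq_trans (_ : #|[set s u | u in [set w | adj G v w]]| <= _)%N; last first.
  by apply: leq_trans (leq_imset_card _ _) (degD v).
apply: subset_leq_card; apply/subsetP => c; rewrite !inE => hc.
have : (0 < same_nbr G S l v (upd s v c))%N by rewrite lt0n; apply: contraTneq hc => ->; rewrite h0.
move=> /card_gt0P[u]; rewrite !inE => /and4P[vu _ _].
have uv : u != v by apply: contraTneq vu => ->; rewrite adj_irr.
rewrite upd_same updE (negbTE uv) => /eqP <-; apply/imsetP; exists u => //; by rewrite inE.
Qed.

End Bounds.
End Configurations.

(** * Connected blocks *)

Section Blocks.
Variables (n : nat) (G : graph n).
Hypothesis Gs : simpleb G.
Implicit Types (B C : {set 'I_n}) (r u v w : 'I_n) (l : seq 'I_n).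

(** Connectivity of the induced subgraph, phrased by cuts: growing a block, or spreading a colour
    through it, then takes one crossing edge and no paths. *)
Definition cut_connected B := forall C, C \subset B -> C != set0 -> C != B ->
  exists u v, [/\ u \in C, v \in B, v \notin C & adj G u v].

Lemma connected_cut : connectedb G -> cut_connected setT.
Proof.
move=> /forallP Gc C _ /set0Pn[u uC] CT.
have /subsetPn[w _ wC] : ~~ (setT \subset C).
  by apply: contraNN CT => h; rewrite eqEsubset subsetT h.
have [/existsP[a /existsP[b /and3P[aC bC ab]]]|no] :=
  boolP [exists a, exists b, [&& a \in C, b \notin C & adj G a b]].
  by exists a, b; rewrite inE.
have cl : closed (adj G) (mem C).
  move=> x y xy; apply/idP/idP => h; apply: contraNT no => h'.
    by apply/existsP; exists x; apply/existsP; exists y; apply/and3P; split.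
  by apply/existsP; exists y; apply/existsP; exists x; apply/and3P; split; rewrite // adj_sym.
have := closed_connect cl (forallP (Gc u) w); rewrite /= => h.
by move: wC; rewrite -[w \in C]h [_ \in _]uC.
Qed.

Lemma cut_connected_grow B v u : cut_connected B -> u \in B -> v \notin B -> adj G u v ->
  cut_connected (v |: B).
Proof.
move=> Bc uB vB uv C CB C0 CvB.
have [CBv|CBv] := boolP (C :&: B == set0).
  have Cv : C = [set v].
    apply/eqP; rewrite eqEsubset sub1set; apply/andP.
    have sub : C \subset [set v].
      apply/subsetP => x xC; have := subsetP CB x xC; rewrite !inE => /orP[//|xB].
      by have := in_set0 x; rewrite -(eqP CBv) inE xC xB.
    split=> //; have /set0Pn[x xC] := C0; have := subsetP sub x xC; by rewrite inE => /eqP <-.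
  exists v, u; rewrite Cv !inE eqxx uB orbT adj_sym // uv; split=> //.
  by apply: contraNneq vB => <-.
have [BC|nBC] := boolP (B \subset C).
  have vC : v \notin C.
    apply: contraNN CvB => vC; rewrite eqEsubset CB; apply/subsetP => x.
    by rewrite !inE => /orP[/eqP ->//|/(subsetP BC)].
  by exists u, v; rewrite (subsetP BC) // !inE eqxx.
have [|||a [b [aC bB bC ab]]] := Bc (C :&: B); rewrite ?subsetIr //.
  by apply: contraNneq nBC => <-; rewrite subsetIl.
move: aC bC; rewrite !inE bB andbT => /andP[aC aB] bC.
by exists a, b; rewrite !inE bB orbT.
Qed.

Lemma exists_cut_connected u s : connectedb G -> (s < n)%N ->
  exists B, [/\ u \in B, #|B| = s.+1 & cut_connected B].
Proof.
move=> Gc; elim: s => [_|s IH sn].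
  exists [set u]; rewrite inE cards1; split=> // C Cu C0 CB.
  case/negP: CB; rewrite eqEsubset Cu sub1set; have /set0Pn[x xC] := C0.
  by have := subsetP Cu x xC; rewrite inE => /eqP <-.
have [B [uB Bs Bc]] := IH (ltnW sn).
have [||a [b [aB _ bB ab]]] := connected_cut Gc (subsetT B).
- by apply/set0Pn; exists u.
- by apply: contraTneq sn => BT; rewrite -leqNgt -Bs BT cardsT card_ord.
exists (b |: B); rewrite inE uB orbT cardsU1 bB Bs; split=> //.
exact: cut_connected_grow Bc aB bB ab.
Qed.

(** A search order read backwards: the root [r] comes last and every other vertex has a neighbour in
    its tail. Coloured from the head on, each vertex but [r] has a neighbour still uncoloured and
    closes at most [D - 1] edges. *)
Fixpoint grown r l : bool :=
  if l is v :: l' then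
    if l' is [::] then v == r else [&& v \notin l', has (adj G v) l' & grown r l']
  else false.

Lemma grown_uniq r l : grown r l -> uniq l.
Proof. by elim: l => // v [|w l] IH // /and3P[vl _ /IH]; rewrite [uniq (v :: _)]cons_uniq vl. Qed.

Lemma exists_grown B r : cut_connected B -> r \in B ->
  exists l, [/\ grown r l, l =i B & size l = #|B|].
Proof.
move=> Bc rB.
have H k : (k < #|B|)%N -> exists l, [/\ grown r l, {subset l <= B}, r \in l & size l = k.+1].
  elim: k => [_|k IH kB].
    by exists [:: r]; split=> //=; rewrite ?inE // => x; rewrite inE => /eqP ->.
  have [l [gl lB rl sl]] := IH (ltnW kB).
  have ul := grown_uniq gl.
  have [|||a [b [al bB bl ab]]] := Bc [set x in l].
  - by apply/subsetP => x; rewrite inE; apply: lB.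
  - by apply/set0Pn; exists r; rewrite inE.
  - apply: contraTneq kB => <-; rewrite -leqNgt cardsE -sl; exact: card_size.
  move: al bl; rewrite !inE => al bl.
  exists (b :: l); split.
  - have -> : grown r (b :: l) = [&& b \notin l, has (adj G b) l & grown r l] by case: (l) sl.
    by rewrite bl gl andbT; apply/hasP; exists a => //; rewrite adj_sym.
  - by move=> x; rewrite inE => /orP[/eqP ->|/lB].
  - by rewrite inE rl orbT.
  - by rewrite /= sl.
have B0 : (0 < #|B|)%N by apply/card_gt0P; exists r.
have [|l [gl lB rl sl]] := H #|B|.-1; first by rewrite prednK.
exists l; rewrite sl prednK //; split=> //.
have ul := grown_uniq gl.
have /subset_leqif_cards /leqifP : [set x in l] \subset B by apply/subsetP => x; rewrite inE; apply: lB.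
case: eqP => [<- _ x|_]; first by rewrite inE.
by rewrite cardsE (card_uniqP ul) sl prednK // ltnn.
Qed.

Section Truncation.
Variables (q D : nat).
Hypothesis degD : forall v, (deg G v <= D)%N.
Implicit Types s t : config n q.

Lemma same_nbr_lt l v t : has (adj G v) l -> (same_nbr G predT l v t < D)%N.
Proof.
move=> /hasP[u ul vu]; apply: leq_trans (degD v).
apply: proper_card; apply/properP; split.
  by apply/subsetP => w; rewrite !inE => /and3P[].
by exists u; rewrite inE // ul andbF.
Qed.

(** Truncation at [D.-1] loses nothing: a vertex before the root has a neighbour in its tail, and
    the root is below [D] by assumption. *)
Lemma grown_lsum r l t : grown r l -> (same_nbr G predT [::] r t < D)%N ->
  lsum (fun l v => same_nbr G predT l v t) l =
  lsum (fun l v => minn (same_nbr G predT l v t) D.-1) l.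
Proof.
move=> + hr; elim: l => // v [|w l] IH.
  move=> /eqP -> /=; rewrite !addn0; apply/esym/minn_idPl; move: hr; case: D => //.
move=> /and3P[_ hv gl].
change ((same_nbr G predT (w :: l) v t +
  lsum (fun l v => same_nbr G predT l v t) (w :: l))%N =
  (minn (same_nbr G predT (w :: l) v t) D.-1 +
  lsum (fun l v => minn (same_nbr G predT l v t) D.-1) (w :: l))%N).
rewrite -IH //; congr (_ + _)%N; apply/esym/minn_idPl.
have := same_nbr_lt t hv; case: D => //.
Qed.

(** The [+ 1] belongs to the root, the only vertex that may close [D] edges. *)
Lemma grown_lsum_le r l t : grown r l ->
  (lsum (fun l v => same_nbr G predT l v t) l <= D.-1 * size l + 1)%N.
Proof.
elim: l => // v [|w l] IH.
  move=> _ /=; rewrite addn0 muln1; apply: leq_trans (same_nbr_le _ _ _ _ _) _.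
  by apply: leq_trans (degD v) _; rewrite addn1 leqSpred.
move=> /and3P[_ hv gl]; have := IH gl; have := same_nbr_lt t hv.
rewrite [size (v :: _)]/= mulnS.
change (lsum (fun l v => same_nbr G predT l v t) (v :: w :: l))
 with (same_nbr G predT (w :: l) v t + lsum (fun l v => same_nbr G predT l v t) (w :: l))%N.
rewrite [size (w :: l)]/=; move: (same_nbr _ _ _ _ _) (lsum _ _) (D.-1 * _)%N => a b c h1 h2.
rewrite -addnA leq_add //; by case: D h1.
Qed.

(** Since degrees are at most [D], each vertex of [B] agrees with all its neighbours; the colour of
    [x] enters at [u] and crosses every cut of [B]. *)
Lemma mono_block B s t x u : (0 < D)%N -> cut_connected B -> x \notin B -> u \in B -> adj G u x ->
  eqoff (mem B) s t -> (forall r, r \in B -> (D <= same_nbr G predT [::] r t)%N) ->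
  t = [ffun w => if w \in B then s x else s w].
Proof.
move=> D0 Bc xB uB ux /eqoffP st full.
have mono r w : r \in B -> adj G r w -> t w = t r.
  move=> rB rw; pose A := [set w | [&& adj G r w, w \notin [::], w \in predT & t w == t r]].
  have sub : A \subset [set w | adj G r w] by apply/subsetP => y; rewrite !inE => /andP[].
  have /eqP E : A == [set w | adj G r w].
    by rewrite eqEcard sub /= (leq_trans (degD r)) //; apply: full.
  have : w \in A by rewrite E inE.
  by rewrite !inE => /andP[_ /eqP].
pose C := [set w in B | t w == s x].
have uC : u \in C by rewrite inE uB -(mono u x uB ux) (st _ xB) eqxx.
have CB : C \subset B by apply/subsetP => w; rewrite inE => /andP[].
have EC : C == B.
  apply/negPn/negP => CneB.
  have [||a [b [aC bB bC ab]]] := Bc C CB; [by apply/set0Pn; exists u | done |].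
  move: aC bC; rewrite !inE bB /= => /andP[aB /eqP ta] /eqP; apply.
  by rewrite (mono a b aB ab).
apply/ffunP => w; rewrite ffunE; case: ifP => wB; last by rewrite st // wB.
by move: wB; rewrite -(eqP EC) inE => /andP[_ /eqP].
Qed.

Lemma mono_on_list B s l : uniq l -> l =i B ->
  mono_on G (mem B) s = lsum (fun l v => same_nbr G predT l v s) l.
Proof.
move=> ul lB; rewrite -mono_on_listE //; apply: eq_mono_on => x; by rewrite -lB.
Qed.

Section Weights.
Variables (R : archiRealFieldType) (lam : R).
Hypothesis lam1 : 1 <= lam.

Lemma lprod_pow (f : seq 'I_n -> 'I_n -> nat) l :
  lprod (fun l v => lam ^+ f l v) l = lam ^+ lsum f l.
Proof. by elim: l => //= v l ->; rewrite exprD. Qed.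

Let wt l t := lprod (fun l v => lam ^+ minn (same_nbr G predT l v t) D.-1) l.

Lemma sum_truncated_le l s : uniq l ->
  \sum_(t | eqoff (mem l) s t) wt l t <= (q%:R + D%:R * lam ^+ D.-1) ^+ size l.
Proof.
move=> ul; rewrite -lprod_const.
apply: (@sum_lprod_le _ _ _ (fun l v t => lam ^+ minn (same_nbr G predT l v t) D.-1)) => //.
- by move=> l' v t; rewrite exprn_ge0 // (le_trans ler01).
- by move=> l' v t t' vl tt'; rewrite (same_nbr_eqoff _ _ vl tt').
- move=> l' v t.
  apply: (@sum_same_nbr_le _ _ _ _ D _ lam1 degD predT l' v t D.-1 (fun x => minn x D.-1)) => //.
    exact: min0n.
  by move=> c; rewrite geq_minr.
Qed.

(* Either some vertex [r] of the block has a bichromatic edge, and colouring the block towards [r] every vertex closes at most [D - 1] monochromatic edges, or the whole block takes the colour of an outer neighbour. *)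
Lemma block_sum_le B s x u : (0 < D)%N -> cut_connected B ->
  x \notin B -> u \in B -> adj G u x ->
  \sum_(t | eqoff (mem B) s t) (lam ^+ mono_on G (mem B) t - 1) <=
  #|B|%:R * ((q%:R + D%:R * lam ^+ D.-1) ^+ #|B| - q%:R ^+ #|B|) +
  lam ^+ (D.-1 * #|B| + 1).
Proof.
move=> D0 Bc xB uB ux.
have [L HL] : exists L : 'I_n -> seq 'I_n, forall r, r \in B ->
    [/\ grown r (L r), L r =i B & size (L r) = #|B|].
  have H r : exists l, r \in B -> [/\ grown r l, l =i B & size l = #|B|].
    case: (boolP (r \in B)) => rB; last by exists [::].
    by have [l hl] := exists_grown Bc rB; exists l.
  have [L HL] := fin_all_exists H; by exists L.
pose t0 : config n q := [ffun w => if w \in B then s x else s w].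
have wt1 r t : 1 <= wt (L r) t by apply: lprod_ge1 => l v; rewrite exprn_ege1.
have lam0 : 0 <= lam ^+ (D.-1 * #|B| + 1) by rewrite exprn_ge0 // (le_trans ler01).
(* A union bound over the possible roots [r]; the colouring [t0], which has no such root in the
   worst case, is charged its full weight. *)
apply: le_trans (_ : \sum_(t | eqoff (mem B) s t)
   (\sum_(r in B) (wt (L r) t - 1) + if t == t0 then lam ^+ (D.-1 * #|B| + 1) else 0) <= _).
  apply: ler_sum => t st.
  have s0 : 0 <= \sum_(r in B) (wt (L r) t - 1) by apply: sumr_ge0 => r _; rewrite subr_ge0.
  have [/existsP[r /andP[rB hr]]|no] :=
     boolP [exists r, (r \in B) && (same_nbr G predT [::] r t < D)%N].
    apply: le_trans (_ : wt (L r) t - 1 <= _).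
      have [gr lB _] := HL r rB.
      rewrite lerD2r (mono_on_list t (grown_uniq gr) lB) (grown_lsum gr hr).
      by rewrite /wt lprod_pow.
    rewrite (bigD1 r) //= -addrA lerDl addr_ge0 //; last by case: ifP.
    by apply: sumr_ge0 => r' _; rewrite subr_ge0.
  have full r : r \in B -> (D <= same_nbr G predT [::] r t)%N.
    by move=> rB; rewrite leqNgt; apply: contraNN no => h; apply/existsP; exists r; rewrite rB.
  have -> : t == t0 by apply/eqP; exact: (mono_block D0 Bc xB uB ux st full).
  have [gr lB szl] := HL u uB.
  apply: le_trans (_ : lam ^+ (D.-1 * #|B| + 1) <= _); last by rewrite lerDr.
  rewrite lerBlDr (le_trans (y := lam ^+ (D.-1 * #|B| + 1))) ?lerDl //.
  rewrite ler_weXn2l // (mono_on_list t (grown_uniq gr) lB) -szl.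
  exact: grown_lsum_le gr.
rewrite big_split /= exchange_big /=; apply: lerD.
  apply: le_trans (_ : \sum_(r in B) ((q%:R + D%:R * lam ^+ D.-1) ^+ #|B| - q%:R ^+ #|B|) <= _).
    apply: ler_sum => r rB; have [gr lB szl] := HL r rB.
    rewrite sumrB; apply: lerB.
      rewrite -szl (eq_bigl (eqoff (mem (L r)) s)).
        exact: sum_truncated_le (grown_uniq gr).
      by move=> t; apply: eq_eqoff => y; apply: esym (lB y).
    rewrite sumr_const -szl -natrX ler_nat -(card_eqoff s (grown_uniq gr)).
    apply: subset_leq_card; apply/subsetP => t; rewrite !inE.
    by rewrite (@eq_eqoff _ _ (mem (L r)) (mem B)) // => y; apply: lB y.
  by rewrite sumr_const [leRHS]mulr_natl.
rewrite -big_mkcondr /=.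
case: (boolP (eqoff (mem B) s t0)) => h.
  rewrite (big_pred1 t0) // => t /=; case: eqP => [->|]; by rewrite ?h // andbF.
rewrite big1 // => t /andP[st /eqP e]; by rewrite -e st in h.
Qed.

End Weights.
End Truncation.
End Blocks.

(** * Block heat baths *)

(** As all weights are at least 1, the error splits into the excess of the weight over 1 and the
    excess of the normalising sum; each part adds up to at most [kap]. *)
Lemma near_uniform (R : archiRealFieldType) (T : finType) (P : pred T) (w : T -> R) kap :
  (0 < #|P|)%N -> (forall x, 1 <= w x) -> \sum_(x | P x) (w x - 1) <= kap * #|P|%:R ->
  \sum_(x | P x) `|w x / \sum_(y | P y) w y - #|P|%:R^-1| <= 2 * kap.
Proof.
move=> P0 w1; set W := \sum_(y | P y) w y; set N := #|P|%:R => H.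
have N0 : 0 < N by rewrite ltr0n.
have sN : \sum_(x | P x) (1 : R) = N by rewrite sumr_const.
have NW : N <= W by rewrite -sN; apply: ler_sum.
have HW : W - N <= kap * N by rewrite -{1}sN -sumrB.
have W0 : 0 < W by apply: lt_le_trans NW.
have VW : W^-1 <= N^-1 by rewrite lef_pV2.
apply: le_trans (_ : \sum_(x | P x) ((w x - 1) / W + (N^-1 - W^-1)) <= _).
  apply: ler_sum => x Px.
  have -> : w x / W - N^-1 = (w x - 1) / W - (N^-1 - W^-1) by field; rewrite !gt_eqF.
  apply: le_trans (ler_normB _ _) _; rewrite !ger0_norm ?subr_ge0 //.
  by rewrite divr_ge0 ?subr_ge0 // ltW.
rewrite big_split /= -mulr_suml sumrB -/W sN sumr_const -[_ *+ _]mulr_natl -/N.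
have -> : (W - N) / W + N * (N^-1 - W^-1) = 2 * (W - N) / W by field; rewrite !gt_eqF.
rewrite ler_pdivrMr //; nra.
Qed.

Section GibbsMeasure.
Variables (R : archiRealFieldType) (n q D : nat) (G : graph n) (lam : R).
Hypotheses (Gs : simpleb G) (lam1 : 1 <= lam) (degD : forall v, (deg G v <= D)%N)
  (q0 : (0 < q)%N).
Implicit Types (B : {set 'I_n}) (v w u : 'I_n) (l : seq 'I_n) (s t : config n q)
  (f : config n q -> R) (d : 'I_n -> R).

Definition Zr : R := \sum_(s : config n q) lam ^+ mono G s.
Definition gm s : R := lam ^+ mono G s / Zr.

Let lam0 : 0 < lam. Proof. exact: lt_le_trans lam1. Qed.

Lemma powlam_gt0 k : 0 < lam ^+ k. Proof. exact: exprn_gt0. Qed.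

Lemma Zr_gt0 : 0 < Zr.
Proof.
rewrite /Zr (bigD1 [ffun=> Ordinal q0]) //= ltr_pwDl ?powlam_gt0 //.
by apply: sumr_ge0 => s _; rewrite ltW ?powlam_gt0.
Qed.

Lemma gm_gt0 s : 0 < gm s. Proof. by rewrite divr_gt0 ?powlam_gt0 ?Zr_gt0. Qed.
Lemma gm_ge0 s : 0 <= gm s. Proof. exact: ltW (gm_gt0 s). Qed.
Lemma gm_sum1 : \sum_s gm s = 1.
Proof. by rewrite -mulr_suml divff // gt_eqF ?Zr_gt0. Qed.

Definition hbB (B : {pred 'I_n}) := hb gm (@eqoff n q B).

Lemma hbB_rev B : reversible gm (hbB (mem B)).
Proof. exact: hb_rev (eqoff_equiv _). Qed.

Lemma hbB_sto B : stochastic (hbB (mem B)).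
Proof. exact: (hb_sto gm_ge0 gm_gt0 (eqoff_equiv (mem B))). Qed.

Lemma hbBE (B : {pred 'I_n}) s t : eqoff B s t ->
  hbB B s t = lam ^+ mono_on G B t / \sum_(z | eqoff B s z) lam ^+ mono_on G B z.
Proof.
move=> st; rewrite /hbB /hb st /gm -mulr_suml.
have E z : eqoff B s z -> lam ^+ mono G z = lam ^+ mono_on G B z * lam ^+ mono_off G B s.
  by move=> sz; rewrite -exprD (mono_on_off G B) (mono_off_eqoff _ sz).
rewrite (eq_bigr _ E) -mulr_suml (E t st).
have Wgt0 : 0 < \sum_(z | eqoff B s z) lam ^+ mono_on G B z.
  rewrite (bigD1 s) ?eqoff_refl //= ltr_pwDl ?powlam_gt0 //.
  by apply: sumr_ge0 => z _; rewrite ltW ?powlam_gt0.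
by field; rewrite !gt_eqF ?powlam_gt0 ?Zr_gt0.
Qed.

(** Single-site oscillations in the manner of Dobrushin: resampling a block acts on the vector
    [d]. *)
Definition osc d f := forall v s t, eqoff (pred1 v) s t -> `|f s - f t| <= d v.

Lemma osc_ge0 d f v : osc d f -> 0 <= d v.
Proof.
move=> h; have := h v [ffun=> Ordinal q0] [ffun=> Ordinal q0] (eqoff_refl _ _).
by rewrite subrr normr0.
Qed.

Lemma osc_list d f l s t : osc d f -> uniq l -> eqoff (mem l) s t ->
  `|f s - f t| <= \sum_(v <- l) d v.
Proof.
move=> h; elim: l s => [|v l IH] s.
  move=> _ /eqoffP e; rewrite big_nil (_ : s = t) ?subrr ?normr0 //.
  by apply/ffunP => w; rewrite e.
move=> /andP[vl ul] /eqoffP e; rewrite big_cons.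
rewrite -(subrK (f (upd s v (t v))) (f s)) -addrA.
apply: le_trans (ler_normD _ _) (lerD _ _); first exact/h/eqoff_upd.
apply: IH => //; apply/eqoffP => w wl; rewrite updE; case: eqVneq => [->//|wv].
by rewrite e // inE negb_or wv.
Qed.

Lemma osc_set d f B s t : osc d f -> eqoff (mem B) s t ->
  `|f s - f t| <= \sum_(v in B) d v.
Proof.
move=> h e; rewrite -big_enum; apply: osc_list h (enum_uniq _) _.
by rewrite (@eq_eqoff _ _ _ (mem B)) // => w; exact: (mem_enum (mem B) w).
Qed.

Lemma card_class B s : #|[pred t | eqoff (mem B) s t]| = (q ^ #|B|)%N.
Proof.
rewrite (cardE B) -(card_eqoff s (enum_uniq (mem B))).
apply: eq_card => t; rewrite !inE; apply: eq_eqoff => w.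
exact: esym (mem_enum (mem B) w).
Qed.

Definition nearly_uniform B (kap : R) := forall s,
  \sum_(t | eqoff (mem B) s t) `|hbB (mem B) s t - (q ^ #|B|)%:R^-1| <= 2 * kap.

Lemma hb_nearly_uniform B kap :
  (forall s, \sum_(t | eqoff (mem B) s t) (lam ^+ mono_on G (mem B) t - 1) <=
     kap * (q ^ #|B|)%:R) -> nearly_uniform B kap.
Proof.
move=> H s; have := H s; rewrite -(card_class B s) => h.
apply: le_trans (near_uniform _ _ h); first last.
- by move=> t; rewrite exprn_ege1.
- by apply/card_gt0P; exists s; exact: eqoff_refl.
by apply: ler_sum => t st; rewrite hbBE.
Qed.

Definition nbB B v := [exists w, (w \in B) && adj G v w].
(** Oscillations after [B] is resampled. A vertex next to [B] also changes the law inside [B]: two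
    laws within [2 * kap] of uniform are within [4 * kap] of each other, and this multiplies the
    oscillation across [B]. *)
Definition dnew B (kap : R) d v : R := if v \in B then 0 else
  d v + (if nbB B v then 4 * kap * \sum_(w in B) d w else 0).

Lemma sum_swap B s s' v (F : config n q -> R) : v \notin B -> eqoff (pred1 v) s s' ->
  \sum_(t | eqoff (mem B) s' t) F t = \sum_(t | eqoff (mem B) s t) F (upd t v (s' v)).
Proof.
move=> vB ss'; have es := eqoff1P ss'.
have es' : s = upd s' v (s v) by apply: eqoff1P; rewrite eqoff_sym.
rewrite (reindex_onto (fun t => upd t v (s' v)) (fun t => upd t v (s v))) /=; last first.
  move=> t /eqoffP e; rewrite upd_upd; have := e v vB => ->; exact: upd_id.
apply: eq_bigl => t; rewrite upd_upd.
apply/andP/eqoffP => [[/eqoffP e /eqP <-] w wB|e].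
  have := e w wB; rewrite updE; case: eqVneq => [->|wv]; first by rewrite upd_same.
  by rewrite es !updE (negbTE wv).
split; last by rewrite (e v vB) upd_id.
apply/eqoffP => w wB; rewrite updE; case: eqVneq => [->//|wv].
by rewrite -(e w wB) [in LHS]es updE (negbTE wv).
Qed.

Lemma osc_hb B kap d f : nearly_uniform B kap -> osc d f ->
  osc (dnew B kap d) (op (hbB (mem B)) f).
Proof.
move=> nu h v s s' ss'; rewrite /dnew; case: ifP => vB.
  have ss'B : eqoff (mem B) s s'.
    apply/eqoffP => w wB; move/eqoffP: ss'; apply.
    by rewrite inE; apply: contraNneq wB => ->.
  rewrite /op (eq_bigr (fun t => hbB (mem B) s' t * f t)) ?subrr ?normr0 //.
  by move=> t _; rewrite /hbB (hb_class _ (eqoff_equiv _) ss'B).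
move/negbT: vB => vB.
have opE r : op (hbB (mem B)) f r = \sum_(t | eqoff (mem B) r t) hbB (mem B) r t * f t.
  rewrite /op (bigID (eqoff (mem B) r)) /= [X in _ + X]big1 ?addr0 // => t /negbTE nt.
  by rewrite /hbB /hb nt mul0r.
rewrite !opE (sum_swap _ vB ss').
set up := fun t => upd t v (s' v).
set m := hbB (mem B) s; set m' := fun t => hbB (mem B) s' (up t).
have m'1 : \sum_(t | eqoff (mem B) s t) m' t = 1.
  rewrite -(sum_swap _ vB ss') -(hbB_sto B s') [RHS](bigID (eqoff (mem B) s')) /=.
  rewrite [X in _ + X]big1 ?addr0 // => t /negbTE nt; by rewrite /hbB /hb nt.
have m1 : \sum_(t | eqoff (mem B) s t) m t = 1.
  rewrite -(hbB_sto B s) [RHS](bigID (eqoff (mem B) s)) /=.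
  rewrite [X in _ + X]big1 ?addr0 // => t /negbTE nt; by rewrite /hbB /hb nt.
(* The first sum keeps the law [m'] and recolours [v] inside [f]. The second changes the law, and
   may be tested on [f - f s] because both laws have mass 1. *)
have -> : \sum_(t | eqoff (mem B) s t) m t * f t -
   \sum_(t | eqoff (mem B) s t) hbB (mem B) s' (up t) * f (up t) =
   \sum_(t | eqoff (mem B) s t) m' t * (f t - f (up t)) +
   \sum_(t | eqoff (mem B) s t) (m t - m' t) * (f t - f s).
  have -> : \sum_(t | eqoff (mem B) s t) (m t - m' t) * (f t - f s) =
    \sum_(t | eqoff (mem B) s t) (m t - m' t) * f t.
    have e0 : \sum_(t | eqoff (mem B) s t) (m t - m' t) * f s = 0.
      by rewrite -mulr_suml sumrB m1 m'1 subrr mul0r.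
    by under eq_bigr do rewrite mulrBr; rewrite sumrB e0 subr0.
  by rewrite -sumrB -big_split; apply: eq_bigr => t _ /=; rewrite /m'; ring.
apply: le_trans (ler_normD _ _) (lerD _ _).
  apply: le_trans (ler_norm_sum _ _ _) _.
  rewrite -[leRHS]mul1r -m'1 mulr_suml; apply: ler_sum => t _.
  have m'0 : 0 <= m' t by apply: (hb_ge0 gm_ge0 gm_gt0 (eqoff_equiv _)).
  rewrite normrM (ger0_norm m'0) ler_wpM2l //.
  by apply: h; apply: eqoff_upd.
case: ifP => nb.
  apply: le_trans (ler_norm_sum _ _ _) _.
  set N := (q ^ #|B|)%:R^-1 : R.
  have t1 : \sum_(t | eqoff (mem B) s t) `|m t - N| <= 2 * kap by apply: nu.
  have t2 : \sum_(t | eqoff (mem B) s t) `|m' t - N| <= 2 * kap.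
    by rewrite -(sum_swap (fun t => `|hbB (mem B) s' t - N|) vB ss'); apply: nu.
  have S0 : 0 <= \sum_(w in B) d w by apply: sumr_ge0 => w _; apply: osc_ge0 h.
  apply: le_trans (_ : \sum_(t | eqoff (mem B) s t)
     (`|m t - N| + `|m' t - N|) * \sum_(w in B) d w <= _).
    apply: ler_sum => t st; rewrite normrM ler_pM //.
      by rewrite (_ : m t - m' t = (m t - N) - (m' t - N)) ?ler_normB //; ring.
    by apply: osc_set h _; rewrite eqoff_sym.
  by rewrite -mulr_suml ler_wpM2r // big_split /=; lra.
(* Without an edge from [v] into [B], both boundary conditions give the same block law. *)
rewrite big1 ?normr0 // => t st.
have nadj w : w \in B -> ~~ adj G v w.
  by move=> wB; move/negbT: nb; apply: contraNN => vw; apply/existsP; exists w; rewrite wB.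
rewrite /m /m' hbBE // hbBE; last first.
  have := st; move: ss' => /eqoffP e /eqoffP st'; apply/eqoffP => w wB.
  rewrite updE; case: eqVneq => [->//|wv]; by rewrite -st' // e // inE.
rewrite (sum_swap _ vB ss').
have Eu z : mono_on G (mem B) (upd z v (s' v)) = mono_on G (mem B) z.
  by apply/esym/(mono_on_eq_nonadj Gs _ vB nadj)/eqoff_upd.
under [X in _ - _ / X]eq_bigr do rewrite Eu.
by rewrite Eu subrr mul0r.
Qed.

Lemma card_nbB B : (#|[set v | nbB B v]| <= D * #|B|)%N.
Proof.
rewrite -sum1_card big_mkcond /=.
apply: leq_trans (_ : \sum_v \sum_(w in B) (adj G w v : nat) <= _)%N.
  apply: leq_sum => v _; rewrite inE; case: ifP => // /existsP[w /andP[wB vw]].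
  by rewrite (bigD1 w) //= adj_sym // vw.
rewrite exchange_big mulnC -sum_nat_const; apply: leq_sum => w _.
apply: leq_trans (degD w); rewrite /deg -sum1_card [leqRHS]big_mkcond /=.
by apply: leq_sum => v _; rewrite inE; case: adj.
Qed.

End GibbsMeasure.

(** * Spectral gap *)

Section SpectralGap.
Variables (R : archiRealFieldType) (n q D : nat) (G : graph n) (lam : R).
Hypotheses (Gs : simpleb G) (lam1 : 1 <= lam) (degD : forall v, (deg G v <= D)%N)
  (q0 : (0 < q)%N) (n0 : (0 < n)%N).
Implicit Types (B : {set 'I_n}) (v w u : 'I_n) (l : seq 'I_n) (s t : config n q)
  (f : config n q -> R) (d : 'I_n -> R).

Let lam0 : 0 < lam. Proof. exact: lt_le_trans lam1. Qed.
Let pg := gm (q:=q) G lam.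
Let pg_gt0 s : 0 < pg s. Proof. exact: gm_gt0. Qed.
Let pg_ge0 s : 0 <= pg s. Proof. exact: ltW. Qed.
Let pg_sum1 : \sum_s pg s = 1. Proof. exact: gm_sum1. Qed.
Let hbn := hbB (q:=q) G lam.

(** The block loses its whole oscillation, and its at most [D * #|B|] neighbours gain at most half
    of it together. *)
Lemma sum_dnew B kap d : (forall v, 0 <= d v) -> 0 <= kap -> 8 * kap * (D * #|B|)%:R <= 1 ->
  \sum_v dnew G B kap d v <= \sum_v d v - 2^-1 * \sum_(v in B) d v.
Proof.
move=> d0 k0 hk; set S := \sum_(v in B) d v.
have S0 : 0 <= S by apply: sumr_ge0.
apply: le_trans (_ : \sum_v ((if v \in B then 0 else d v) +
   (if nbB G B v then 4 * kap * S else 0)) <= _).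
  apply: ler_sum => v _; rewrite /dnew -/S; case: ifP => // _.
  by rewrite add0r; case: ifP => // _; rewrite !mulr_ge0.
rewrite big_split /= -big_mkcond /= sumr_const.
have -> : \sum_v (if v \in B then 0 else d v) = \sum_v d v - S.
  rewrite [X in _ = X - _](bigID (mem B)) /= -/S addrAC subrr add0r [RHS]big_mkcond /=.
  by apply: eq_bigr => v _; case: ifP.
rewrite -[_ *+ _]mulr_natl.
have : (#|[pred v | nbB G B v]|%:R : R) <= (D * #|B|)%:R.
  rewrite ler_nat; apply: leq_trans (card_nbB Gs degD B).
  by apply: subset_leq_card; apply/subsetP => v; rewrite !inE.
have kS : 0 <= kap * S by rewrite mulr_ge0.
have -> : #|[pred v | nbB G B v]| = #|(fun v => nbB G B v)| by [].
set N : R := #|_|%:R; set M := (D * #|B|)%:R in hk *; move=> NM; nra.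
Qed.

Lemma var_osc_le d f : osc d f -> var pg f <= (\sum_v d v) ^+ 2.
Proof.
move=> h; set S := \sum_v d v.
have S0 : 0 <= S by apply: sumr_ge0 => v _; apply: osc_ge0 h.
have ob s t : `|f s - f t| <= S.
  rewrite /S -[leRHS](eq_bigl _ _ (fun v => in_setT v)).
  by apply: osc_set h _; apply/eqoffP => v; rewrite in_setT.
rewrite -[leRHS]mul1r -pg_sum1 mulr_suml; apply: ler_sum => s _.
rewrite ler_wpM2l // -expr2 -[leLHS]real_normK ?num_real // ler_pXn2r ?nnegrE //.
have -> : f s - \sum_t pg t * f t = \sum_t pg t * (f s - f t).
  by under [RHS]eq_bigr do rewrite mulrBr; rewrite sumrB -mulr_suml pg_sum1 mul1r.
apply: le_trans (ler_norm_sum _ _ _) _.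
rewrite -[leRHS]mul1r -pg_sum1 mulr_suml; apply: ler_sum => t _.
by rewrite normrM (ger0_norm (pg_ge0 t)) ler_wpM2l.
Qed.

(** Each vertex [u] lies in its own block, so an averaged step shrinks the total oscillation by the
    factor [1 - 1 / (2n)]. That total dominates the standard deviation, which gives a gap of
    [1 / (2n)]; the factor [1 / n] cancels against the average over blocks. *)
Lemma block_poincare (Bs : 'I_n -> {set 'I_n}) kap f :
  (forall u, u \in Bs u) -> 0 <= kap -> (forall u, 8 * kap * (D * #|Bs u|)%:R <= 1) ->
  (forall u, nearly_uniform q G lam (Bs u) kap) ->
  var pg f <= 2 * \sum_u energy pg (hbn (mem (Bs u))) f.
Proof.
move=> uB k0 hk nu.
have N0 : 0 < n%:R :> R by rewrite ltr0n.
have cI : #|'I_n| = n by rewrite card_ord.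
pose K u := hbn (mem (Bs u)).
have Krev u : reversible pg (K u) by apply: hbB_rev.
have Ksto u : stochastic (K u) by apply: hbB_sto.
have Arev : reversible pg (avg K) by apply: avg_rev.
have Asto : stochastic (avg K) by apply: avg_sto; rewrite ?cI.
pose r : R := 1 - (2 * n%:R)^-1.
have n1 : 1 <= n%:R :> R by rewrite ler1n.
have r0 : (2 * n%:R)^-1 <= 2^-1 :> R by rewrite lef_pV2 ?posrE; lra.
have r1 : 0 < (2 * n%:R)^-1 :> R by rewrite invr_gt0; lra.
(* A crude start suffices, as it only enters the prefactor of [gap_of_contraction]. *)
pose d0 v : R := \sum_s 2 * `|f s|.
have osc0 : osc d0 f.
  move=> v s t _; apply: le_trans (ler_normB _ _) _.
  have single x : `|f x| <= \sum_s `|f s| by rewrite (bigD1 x) //= lerDl; apply: sumr_ge0.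
  by rewrite /d0 -mulr_sumr; have := single s; have := single t; lra.
have osct (t : nat) : exists d, osc d (iter t (op (avg K)) f) /\ \sum_v d v <= r ^+ t * \sum_v d0 v.
  elim: t => [|t [d [od sd]]]; first by exists d0; rewrite mul1r.
  exists (fun v => (\sum_u dnew G (Bs u) kap d v) / n%:R); split.
    move=> v s s' ss' /=; rewrite !op_avg cI -mulrBl normrM.
    have nV : 0 <= n%:R^-1 :> R by rewrite invr_ge0 ltW.
    rewrite (ger0_norm nV) ler_wpM2r //.
    rewrite -sumrB; apply: le_trans (ler_norm_sum _ _ _) _; apply: ler_sum => u _.
    exact: osc_hb.
  have dge0 v : 0 <= d v by apply: osc_ge0 od.
  rewrite -mulr_suml exchange_big /= ler_pdivrMr //.
  apply: le_trans (_ : \sum_u (\sum_v d v - 2^-1 * d u) <= _).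
    apply: ler_sum => u _; apply: le_trans (sum_dnew dge0 k0 (hk u)) _.
    rewrite lerD2l lerN2 ler_pM2l ?invr_gt0 ?ltr0n // (bigD1 u) ?uB //= lerDl.
    by apply: sumr_ge0.
  rewrite sumrB sumr_const cI -mulr_sumr -[_ *+ _]mulr_natl exprS.
  have -> : n%:R * \sum_v d v - 2^-1 * \sum_i d i = n%:R * (r * \sum_v d v).
    by rewrite /r; field; rewrite gt_eqF.
  rewrite [leRHS]mulrC ler_pM2l // -mulrA ler_wpM2l //; first by rewrite /r; lra.
have : (2 * n%:R)^-1 * var pg f <= energy pg (avg K) f.
  apply: (@gap_of_contraction _ _ pg pg_ge0 (avg K) f _ ((\sum_v d0 v) ^+ 2) Arev Asto).
    by rewrite ltW //=; lra.
  move=> t; have [d [od sd]] := osct t.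
  apply: le_trans (var_osc_le od) _; rewrite -/r -exprM mulnC exprM -exprMn mulrC.
  have dge0 v : 0 <= d v by apply: osc_ge0 od.
  have sd0 : 0 <= \sum_v d v by apply: sumr_ge0.
  by rewrite ler_pXn2r ?nnegrE // (le_trans sd0).
rewrite energy_avg ?cI // ler_pdivlMr // => h.
have -> : var pg f = 2 * ((2 * n%:R)^-1 * var pg f * n%:R) by field; rewrite gt_eqF.
by rewrite ler_wpM2l.
Qed.

(** A Dirichlet form without transition probabilities, which cost only a constant factor in a block
    of bounded size. *)
Definition sqdiff (e : rel (config n q)) f : R :=
  \sum_s \sum_(t | e s t) pg s * (f s - f t) ^+ 2.

Lemma sqdiff_ge0 e f : 0 <= sqdiff e f.
Proof. by apply: sumr_ge0 => s _; apply: sumr_ge0 => t _; rewrite mulr_ge0 ?sqr_ge0. Qed.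

Lemma eq_sqdiff e e' f : e =2 e' -> sqdiff e f = sqdiff e' f.
Proof. by move=> h; apply: eq_bigr => s _; apply: eq_bigl => t; rewrite h. Qed.

Lemma sum_eqoff1 s v (F : config n q -> R) :
  \sum_(t | eqoff (pred1 v) s t) F t = \sum_c F (upd s v c).
Proof.
rewrite -(eq_bigr _ (fun c _ => sum_eqoff_nil (upd s v c) F)) -sum_eqoff_cons //.
by apply: eq_bigl => t; apply: eq_eqoff => w; rewrite !inE.
Qed.

Lemma mono_upd_le s v c : (mono G s <= D + mono G (upd s v c))%N.
Proof.
rewrite (mono_on_off G (pred1 v)) [X in (_ <= D + X)%N](mono_on_off G (pred1 v)).
rewrite (mono_off_eqoff G (eqoff_upd s v c)) addnA leq_add2r.
rewrite mono_on1 //; apply: leq_trans (leq_addr _ _).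
apply: leq_trans (degD v); apply: subset_leq_card; apply/subsetP => w.
by rewrite !inE => /andP[].
Qed.

Lemma gm_upd_le s v c : pg s <= lam ^+ D * pg (upd s v c).
Proof.
rewrite /pg /gm mulrA ler_wpM2r ?invr_ge0 ?(ltW (Zr_gt0 _ _ _)) //.
by rewrite -exprD ler_weXn2l // mono_upd_le.
Qed.

Let M (S : nat) : R := 2 * q%:R ^+ S * lam ^+ D.

(** Go from [s] to [t] by recolouring [v] first and then [l], using [(a + b)^2 <= 2 (a^2 + b^2)].
    Moving the measure to the intermediate state costs [lam ^+ D]; the power of [q] in [M] bounds
    how many pairs share a half of the path. *)
Lemma sqdiff_cons v l f S : v \notin l -> uniq l -> (size l < S)%N ->
  sqdiff (eqoff (mem (v :: l))) f <=
  M S * (sqdiff (eqoff (pred1 v)) f + sqdiff (eqoff (mem l)) f).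
Proof.
move=> vl ul lS.
have q1 : 1 <= q%:R :> R by rewrite ler1n.
have lD1 : 1 <= lam ^+ D by rewrite exprn_ege1.
pose H r := pg r * \sum_(t | eqoff (mem l) r t) (f r - f t) ^+ 2.
have H0 r : 0 <= H r by rewrite mulr_ge0 //; apply: sumr_ge0 => t _; apply: sqr_ge0.
have HQ : \sum_r H r = sqdiff (eqoff (mem l)) f.
  by apply: eq_bigr => r _; rewrite /H mulr_sumr.
(* Each [r] is reached from the [q] configurations that agree with it off [v]. *)
have HH : \sum_s \sum_c H (upd s v c) = q%:R * \sum_r H r.
  transitivity (\sum_s \sum_(r | eqoff (pred1 v) s r) H r).
    by apply: eq_bigr => s _; rewrite sum_eqoff1.
  rewrite (exchange_big_dep predT) //= mulr_sumr; apply: eq_bigr => r _.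
  rewrite (eq_bigl (eqoff (pred1 v) r)); last by move=> s; rewrite eqoff_sym.
  by rewrite sum_eqoff1 sumr_const card_ord mulr_natl.
apply: le_trans (_ : \sum_s \sum_c (2 * (q ^ size l)%:R * (pg s * (f s - f (upd s v c)) ^+ 2)
    + 2 * lam ^+ D * H (upd s v c)) <= _).
  apply: ler_sum => s _; rewrite (sum_eqoff_cons s _ vl); apply: ler_sum => c _.
  set r := upd s v c.
  apply: le_trans (_ : \sum_(t | eqoff (mem l) r t)
    (2 * (pg s * (f s - f r) ^+ 2) + 2 * (lam ^+ D * pg r) * (f r - f t) ^+ 2) <= _).
    apply: ler_sum => t _.
    apply: le_trans (_ : 2 * (pg s * (f s - f r) ^+ 2) + 2 * pg s * (f r - f t) ^+ 2 <= _).
      have := sqr_ge0 (f s - f r - (f r - f t)); have := pg_ge0 s.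
      have -> : f s - f t = (f s - f r) + (f r - f t) by ring.
      move: (f s - f r) (f r - f t) (pg s) => a b p p0; rewrite expr2; nra.
    rewrite lerD2l ler_wpM2r ?sqr_ge0 // ler_wpM2l //.
    exact: gm_upd_le.
  rewrite big_split /= sumr_const -mulr_sumr lerD //.
    by rewrite (card_eqoff r ul) -[leLHS]mulr_natl le_eqVlt; apply/orP; left; apply/eqP; ring.
  by rewrite /H !mulrA.
have -> : \sum_s \sum_c (2 * (q ^ size l)%:R * (pg s * (f s - f (upd s v c)) ^+ 2)
    + 2 * lam ^+ D * H (upd s v c)) =
  2 * (q ^ size l)%:R * sqdiff (eqoff (pred1 v)) f + 2 * lam ^+ D * (q%:R * sqdiff (eqoff (mem l)) f).
  under eq_bigr do rewrite big_split /= -!mulr_sumr.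
  rewrite big_split /= -!mulr_sumr HH HQ; congr (_ * _ + _).
  by apply: eq_bigr => s _; rewrite sum_eqoff1 mulr_sumr.
rewrite mulrDr; apply: lerD; [|rewrite mulrA]; apply: ler_wpM2r; rewrite ?sqdiff_ge0 // /M ?natrX.
  rewrite -[leLHS]mulr1 ler_pM ?mulr_ge0 ?exprn_ge0 //.
  by rewrite ler_pM2l // ler_weXn2l // ltnW.
rewrite mulrAC ler_wpM2r ?exprn_ge0 ?(ltW lam0) // ler_pM2l // -[leLHS]expr1.
by rewrite ler_weXn2l // (leq_ltn_trans _ lS).
Qed.

Lemma sqdiff_list l f S : uniq l -> (size l <= S)%N ->
  sqdiff (eqoff (mem l)) f <= (1 + M S) ^+ size l * \sum_(v <- l) sqdiff (eqoff (pred1 v)) f.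
Proof.
have M0 : 0 <= M S by rewrite /M !mulr_ge0 ?exprn_ge0 ?(ltW lam0).
elim: l => [_ _|v l IH /= /andP[vl ul] lS].
  rewrite big_nil mulr0 /sqdiff big1 // => s _.
  by rewrite sum_eqoff_nil subrr expr0n mulr0.
apply: le_trans (sqdiff_cons f vl ul lS) _; rewrite big_cons.
have := IH ul (ltnW lS).
have : 0 <= \sum_(v <- l) sqdiff (eqoff (pred1 v)) f by apply: sumr_ge0 => w _; apply: sqdiff_ge0.
have := sqdiff_ge0 (eqoff (pred1 v)) f.
have : 1 <= (1 + M S) ^+ size l by rewrite exprn_ege1 // lerDl.
rewrite exprS; set K := _ ^+ size l; set a := sqdiff (eqoff (pred1 v)) f.
set c := \sum_(_ <- _) _; set b := sqdiff _ _ => K1 a0 c0 bK.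
move: (M S) M0 @K K1 bK => m m0 K K1 bK.
have : b + a <= K * (a + c) by nra.
have : 0 <= K * (a + c) by rewrite mulr_ge0 //; lra.
rewrite -mulrA; move: (K * (a + c)) => X X0 h; nra.
Qed.

Lemma energy_le_sqdiff B f : energy pg (hbn (mem B)) f <= 2^-1 * sqdiff (eqoff (mem B)) f.
Proof.
rewrite energyE; [|exact: hbB_rev|exact: hbB_sto].
rewrite ler_pM2l ?invr_gt0 //; apply: ler_sum => s _; rewrite [leRHS]big_mkcond /=.
apply: ler_sum => t _; rewrite /hbn /hbB /hb; case: ifP => st; last by rewrite mulr0 mul0r.
rewrite ler_wpM2r ?sqr_ge0 // -[leRHS]mulr1 ler_wpM2l //.
have W0 := class_sum_gt0 pg_ge0 pg_gt0 (eqoff_equiv (mem B)) s.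
by rewrite ler_pdivrMr // mul1r (bigD1 t) //= lerDl sumr_ge0.
Qed.

(** A single-site update chooses every colour with probability at least [1 / (q * lam ^+ D)]. *)
Lemma sqdiff_le_energy v f :
  sqdiff (eqoff (pred1 v)) f <= 2 * (q%:R * lam ^+ D) * energy pg (hbn (pred1 v)) f.
Proof.
rewrite energyE; [|exact: hb_rev (eqoff_equiv _)|exact: (hb_sto pg_ge0 pg_gt0 (eqoff_equiv (pred1 v)))].
have -> (x : R) : 2 * (q%:R * lam ^+ D) * (2^-1 * x) = q%:R * lam ^+ D * x by field.
rewrite mulr_sumr; apply: ler_sum => s _; rewrite mulr_sumr big_mkcond.
apply: ler_sum => t _; have C0 : 0 < q%:R * lam ^+ D by rewrite mulr_gt0 ?ltr0n ?exprn_gt0.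
have hb0 := hb_ge0 pg_ge0 pg_gt0 (eqoff_equiv (pred1 v)) s t.
case: ifP => st; last exact: mulr_ge0 (ltW C0) (mulr_ge0 (mulr_ge0 (pg_ge0 s) hb0) (sqr_ge0 _)).
rewrite [leRHS]mulrA ler_wpM2r ?sqr_ge0 // mulrCA -[leLHS]mulr1 ler_wpM2l //.
rewrite /hbn hbBE // mulrA ler_pdivlMr; last first.
  rewrite (bigD1 s) ?eqoff_refl //= ltr_pwDl ?exprn_gt0 // sumr_ge0 // => z _.
  by rewrite exprn_ge0 // ltW.
rewrite mul1r sum_eqoff1.
apply: le_trans (_ : q%:R * lam ^+ D <= _); last first.
  by rewrite -[leLHS]mulr1 ler_pM2l // exprn_ege1.
have -> : q%:R * lam ^+ D = \sum_(c < q) lam ^+ D by rewrite sumr_const card_ord mulr_natl.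
apply: ler_sum => c _; rewrite mono_on1 // ler_weXn2l //.
apply: leq_trans (degD v); apply: subset_leq_card; apply/subsetP => w.
by rewrite !inE => /andP[].
Qed.

(** Free of [n], which keeps the final bound polynomial. *)
Definition comparison_const (S : nat) : R := (1 + M S) ^+ S * (q%:R * lam ^+ D).

Lemma comparison_const_ge0 S : 0 <= comparison_const S.
Proof. by rewrite !mulr_ge0 ?exprn_ge0 ?(ltW lam0) // addr_ge0 // !mulr_ge0 ?exprn_ge0 ?(ltW lam0). Qed.

Lemma energy1_ge0 v f : 0 <= energy pg (hbn (pred1 v)) f.
Proof.
rewrite energyE; [|exact: hb_rev (eqoff_equiv _)|exact: (hb_sto pg_ge0 pg_gt0 (eqoff_equiv (pred1 v)))].
rewrite mulr_ge0 ?invr_ge0 //; apply: sumr_ge0 => s _; apply: sumr_ge0 => t _.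
exact: mulr_ge0 (mulr_ge0 (pg_ge0 s) (hb_ge0 pg_ge0 pg_gt0 (eqoff_equiv (pred1 v)) s t)) (sqr_ge0 _).
Qed.

Lemma energy_comparison B f S : (#|B| <= S)%N ->
  energy pg (hbn (mem B)) f <= comparison_const S * \sum_v energy pg (hbn (pred1 v)) f.
Proof.
move=> BS; apply: le_trans (energy_le_sqdiff _ _) _.
have M0 : 0 <= M S by rewrite /M !mulr_ge0 ?exprn_ge0 ?(ltW lam0).
rewrite (eq_sqdiff _ (eq_eqoff (fun w => esym (mem_enum (mem B) w)))).
rewrite mulrC ler_pdivrMr //; apply: le_trans (sqdiff_list f (enum_uniq (mem B)) _) _.
  by rewrite -cardE; apply: BS.
rewrite /comparison_const -!mulrA; apply: ler_pM.
- by rewrite exprn_ge0 // addr_ge0.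
- by apply: sumr_ge0 => v _; apply: sqdiff_ge0.
- by rewrite ler_weXn2l ?lerDl // -cardE.
rewrite big_enum /= big_mkcond /=.
apply: le_trans (_ : \sum_v 2 * (q%:R * lam ^+ D) * energy pg (hbn (pred1 v)) f <= _); last first.
  by rewrite -mulr_sumr le_eqVlt; apply/orP; left; apply/eqP; ring.
apply: ler_sum => v _; case: ifP => _; first exact: sqdiff_le_energy.
apply: mulr_ge0 (energy1_ge0 _ _); apply: mulr_ge0 => //.
by apply: mulr_ge0 => //; rewrite exprn_ge0 // ltW.
Qed.

End SpectralGap.

(** * Mixing time of the Glauber dynamics *)

Section Distances.
Variables (R : archiRealFieldType) (T : finType) (p : T -> R) (K : T -> T -> R).
Hypotheses (p_gt0 : forall x, 0 < p x) (p_sum1 : \sum_x p x = 1)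
  (Krev : reversible p K) (Ksto : stochastic K).

Fixpoint evolve (x : T) (t : nat) (y : T) : R :=
  if t is t'.+1 then \sum_z evolve x t' z * K z y else (y == x)%:R.

(** Reversibility lets the law at time [t] be followed through its density with respect to [p], to
    which the decay of variance applies. *)
Lemma evolve_density x t y :
  evolve x t y = p y * iter t (op K) (fun z => (z == x)%:R / p x) y.
Proof.
elim: t y => [|t IH] y /=.
  by case: eqP => [->|_]; rewrite ?mul0r ?mulr0 // mul1r divff // gt_eqF.
rewrite /op mulr_sumr; apply: eq_bigr => z _; rewrite IH.
by rewrite mulrAC Krev -mulrA.
Qed.

Lemma var_density x t :
  (\sum_y `|evolve x t y - p y|) ^+ 2 <= var p (iter t (op K) (fun z => (z == x)%:R / p x)).
Proof.
have p0 y : 0 <= p y by apply: ltW.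
set h := fun z : T => (z == x)%:R / p x; set g := iter t (op K) h.
have m1 : \sum_y p y * g y = 1.
  rewrite mean_iter // (bigD1 x) //= big1 /h => [|y /negbTE ->]; last by rewrite mul0r mulr0.
  by rewrite eqxx addr0 mul1r divff // gt_eqF.
have -> : \sum_y `|evolve x t y - p y| = \sum_y p y * `|g y - 1|.
  apply: eq_bigr => y _; rewrite evolve_density -/h -/g.
  by rewrite -{2}[p y]mulr1 -mulrBr normrM (ger0_norm (p0 y)).
apply: le_trans (sqr_mean_le p0 p_sum1 _) _.
rewrite /var m1; apply: ler_sum => y _.
by rewrite -expr2 real_normK ?num_real // expr2.
Qed.

Lemma var_point x : var p (fun z => (z == x)%:R / p x) <= (p x)^-1.
Proof.
rewrite varE // (le_trans (y := dot p (fun z => (z == x)%:R / p x) (fun z => (z == x)%:R / p x))) //.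
  by rewrite gerBl sqr_ge0.
rewrite /dot (bigD1 x) //= big1 => [|y /negbTE ->]; last by rewrite mul0r !mulr0.
by rewrite eqxx addr0 mul1r mulrA divff ?mul1r // gt_eqF.
Qed.

End Distances.

Section GlauberMixing.
Variables (R : archiRealFieldType) (n q D : nat) (G : graph n) (lam : R).
Hypotheses (Gs : simpleb G) (lam1 : 1 <= lam) (degD : forall v, (deg G v <= D)%N)
  (q0 : (0 < q)%N) (n0 : (0 < n)%N).
Implicit Types (B : {set 'I_n}) (v w u : 'I_n) (s t : config n q) (f : config n q -> R).

Let lam0 : 0 < lam. Proof. exact: lt_le_trans lam1. Qed.
Let pg := gm (q:=q) G lam.
Let pg_gt0 s : 0 < pg s. Proof. exact: gm_gt0. Qed.
Let pg_ge0 s : 0 <= pg s. Proof. exact: ltW. Qed.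
Let pg_sum1 : \sum_s pg s = 1. Proof. exact: gm_sum1. Qed.

Definition gd := avg (fun v => hbB (q:=q) G lam (pred1 v)).

Lemma gd_rev : reversible pg gd.
Proof. by apply: avg_rev => v; apply: hb_rev (eqoff_equiv _). Qed.

Lemma gd_sto : stochastic gd.
Proof.
apply: avg_sto; first by rewrite card_ord.
by move=> v; apply: (hb_sto pg_ge0 pg_gt0 (eqoff_equiv (pred1 v))).
Qed.

Lemma nbr_eqoff s t v c : eqoff (pred1 v) s t -> nbr G s v c = nbr G t v c.
Proof.
move/eqoffP => h; congr #|pred_of_set _|; apply/setP => w; rewrite !inE.
case: (boolP (adj G v w)) => //= vw; rewrite h // inE.
by apply: contraTneq vw => ->; rewrite adj_irr.
Qed.

Lemma gdE s t : gd s t = \sum_v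
    ((if [forall w, (w != v) ==> (s w == t w)]
      then lam ^+ nbr G s v (t v) / (\sum_(c : 'I_q) lam ^+ nbr G s v c) else 0) / n%:R).
Proof.
rewrite /gd /avg card_ord mulr_suml; apply: eq_bigr => v _; congr (_ / _).
have -> : [forall w, (w != v) ==> (s w == t w)] = eqoff (pred1 v) s t.
  by apply: eq_forallb => w; rewrite inE implyNb.
case: ifP => st; last by rewrite /hbB /hb st.
rewrite hbBE // mono_on1 // -(nbr_eqoff _ st) sum_eqoff1; congr (_ / _).
apply: eq_bigr => c _; rewrite mono_on1 // upd_same.
by rewrite -(nbr_eqoff _ (eqoff_upd s v c)).
Qed.

Lemma glauber_poincare S kap f : (0 < S)%N -> (0 < D)%N -> connectedb G ->
  0 <= kap -> 8 * kap * (D * S)%:R <= 1 ->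
  S%:R * ((q%:R + D%:R * lam ^+ D.-1) ^+ S - q%:R ^+ S) + lam ^+ (D.-1 * S + 1)
    <= kap * q%:R ^+ S ->
  var pg f <= 2 * comparison_const q D lam S * n%:R ^+ 2 * energy pg gd f.
Proof.
move=> S0 D0 Gc k0 hk near.
have N0 : 0 < n%:R :> R by rewrite ltr0n.
pose E := \sum_v energy pg (hbB G lam (pred1 v)) f.
have E0 : 0 <= E by apply: sumr_ge0 => v _; apply: energy1_ge0.
have C0 := comparison_const_ge0 q D lam1 S.
have -> : energy pg gd f = E / n%:R by rewrite energy_avg card_ord.
have -> : 2 * comparison_const q D lam S * n%:R ^+ 2 * (E / n%:R) =
          2 * n%:R * (comparison_const q D lam S * E) by field; rewrite gt_eqF.
have CE0 : 0 <= comparison_const q D lam S * E by rewrite mulr_ge0.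
have n1 : 1 <= n%:R :> R by rewrite ler1n.
(* A graph on at most [S] vertices is a single block: resampling all of it yields the mean, so the
   energy of that heat bath is the variance. *)
have [nS|Sn] := leqP n S.
  have -> : var pg f = energy pg (hbB G lam (mem [set: 'I_n])) f.
    rewrite varE // /energy; congr (_ - _).
    have opT s : op (hbB G lam (mem [set: 'I_n])) f s = \sum_t pg t * f t.
      apply: eq_bigr => t _; congr (_ * _); rewrite /hbB /hb.
      have all1 t' : eqoff (mem [set: 'I_n]) s t' by apply/eqoffP => w; rewrite in_setT.
      by rewrite all1 (eq_bigl predT) // pg_sum1 divr1.
    rewrite /dot; under [RHS]eq_bigr do rewrite opT mulrA.
    by rewrite -mulr_suml expr2.
  have hS : (#|[set: 'I_n]| <= S)%N by rewrite cardsT card_ord.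
  have := energy_comparison Gs lam1 degD q0 f hS; rewrite -/E => /le_trans; apply.
  by move: (_ * E) CE0 => X; nra.
have [Bs HB] : exists Bs : 'I_n -> {set 'I_n}, forall u,
    [/\ u \in Bs u, #|Bs u| = S & cut_connected G (Bs u)].
  apply: (@fin_all_exists _ _ (fun u B => [/\ u \in B, #|B| = S & cut_connected G B])) => u.
  rewrite -(prednK S0).
  by apply: exists_cut_connected => //; rewrite (leq_trans _ Sn) // ltnS leq_pred.
have uB u : u \in Bs u by have [] := HB u.
have cB u : #|Bs u| = S by have [] := HB u.
apply: le_trans (block_poincare Gs lam1 degD q0 n0 (Bs := Bs) (kap := kap) f uB k0 _ _) _.
- by move=> u; rewrite cB.
- move=> u; apply: hb_nearly_uniform => // s; rewrite cB natrX.
  have [_ _ Bc] := HB u.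
  (* Since [S < n], connectivity supplies the outer neighbour that [block_sum_le] asks for. *)
  have [||a [b [aB _ bB ab]]] := connected_cut Gs Gc (subsetT (Bs u)).
  + by apply/set0Pn; exists u.
  + by apply: contraTneq Sn => BT; rewrite -leqNgt -(cB u) BT cardsT card_ord.
  by apply: le_trans (block_sum_le Gs degD lam1 s D0 Bc bB aB ab) _; rewrite cB.
rewrite -mulrA ler_wpM2l // mulrC.
apply: le_trans (_ : \sum_(u < n) comparison_const q D lam S * E <= _).
  by apply: ler_sum => u _; apply: energy_comparison => //; rewrite cB.
by rewrite sumr_const card_ord mulr_natr.
Qed.

Lemma mono_le s : (mono G s <= D * n)%N.
Proof.
have ue : uniq (enum 'I_n) by apply: enum_uniq.
rewrite (mono_listE Gs s ue).
have -> : mono_off G (mem (enum 'I_n)) s = 0%N.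
  by apply: eq_card0 => p; rewrite !inE !mem_enum !andbF.
rewrite addn0 -[X in (_ <= D * X)%N](size_enum_ord n).
elim: (enum 'I_n) => //= v l IH; rewrite mulnS leq_add //.
exact: leq_trans (same_nbr_le _ _ _ _ _) (degD v).
Qed.

Lemma gm_inv_le s : (pg s)^-1 <= (q%:R * lam ^+ D) ^+ n.
Proof.
rewrite /pg /gm invf_div ler_pdivrMr ?exprn_gt0 //.
apply: le_trans (_ : (q%:R * lam ^+ D) ^+ n <= _); last first.
  by rewrite -[leLHS]mulr1 ler_pM2l ?exprn_ege1 // exprn_gt0 // mulr_gt0 ?ltr0n ?exprn_gt0.
rewrite exprMn -exprM -natrX.
apply: le_trans (_ : \sum_(t : config n q) lam ^+ (D * n) <= _).
  by apply: ler_sum => t _; rewrite ler_weXn2l // mono_le.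
by rewrite sumr_const card_ffun !card_ord mulr_natl.
Qed.

(** By Bernoulli [(1 + 1/m)^m >= 2], while the product with [(1 - 1/m)^m] is at most 1. *)
Lemma half_pow (m : nat) : (0 < m)%N -> (1 - m%:R^-1) ^+ m <= 2^-1 :> R.
Proof.
move=> m0; have M0 : 0 < m%:R :> R by rewrite ltr0n.
have m1 : m%:R^-1 <= 1 :> R by rewrite invf_le1 // ler1n.
have g0 : 0 < m%:R^-1 :> R by rewrite invr_gt0.
have H : (1 - m%:R^-1) ^+ m * (1 + m%:R^-1) ^+ m <= 1 :> R.
  rewrite -exprMn exprn_ile1 //; [rewrite mulr_ge0 //; lra|nra].
have := bernoulli m (ltW g0); rewrite divff ?gt_eqF // => B.
have : 0 <= (1 - m%:R^-1) ^+ m :> R by rewrite exprn_ge0 //; lra.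
rewrite -[2^-1]mul1r ler_pdivlMr //; nra.
Qed.

(** The variance of the density halves every [k * n ^ 2] steps. The initial value is at most
    [2 ^ (j * n)], which [n * j] halvings absorb; [i] more bring it below [(2 * eps)^2]. *)
Lemma glauber_mixing (k i j : nat) (eps : R) (x : config n q) :
  (0 < k)%N -> 0 < eps -> (2 * eps) ^- 2 <= 2 ^+ i -> q%:R * lam ^+ D <= 2 ^+ j ->
  (forall f, var pg f <= k%:R * n%:R ^+ 2 * energy pg gd f) ->
  2^-1 * \sum_y `|evolve gd x (k * n ^ 2 * (n * j + i)) y - pg y| <= eps.
Proof.
move=> k0 e0 hi hj gap.
set m := (k * n ^ 2)%N; have m0 : (0 < m)%N by rewrite muln_gt0 k0 expn_gt0 n0.
have M0 : 0 < m%:R :> R by rewrite ltr0n.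
have m1 : m%:R^-1 <= 1 :> R by rewrite invf_le1 // ler1n.
rewrite mulrC ler_pdivrMr // mulrC.
set X := \sum_y _.
have X0 : 0 <= X by apply: sumr_ge0.
rewrite -(@ler_pXn2r _ 2) ?nnegrE //; last by rewrite mulr_ge0 // ltW.
apply: le_trans (var_density pg_gt0 pg_sum1 gd_rev gd_sto x _) _.
apply: le_trans (@var_decay _ _ pg pg_sum1 gd _ m%:R^-1 _ gd_rev gd_sto _ _ _) _.
- by rewrite invr_ge0 (ltW M0).
- move=> g; apply: avg_contraction => //; first by rewrite card_ord.
    by move=> v; apply: hb_rev (eqoff_equiv _).
  by move=> v; apply: (op_hb_idem pg_ge0 pg_gt0 (eqoff_equiv (pred1 v))).
- move=> g; rewrite mulrC ler_pdivrMr // mulrC; have := gap g.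
  by rewrite /m natrM natrX.
rewrite exprM; set v0 := var _ _.
have v00 : 0 <= v0 by apply: dot_ge0.
apply: le_trans (_ : 2^-1 ^+ (n * j + i) * 2 ^+ (j * n) <= _).
  apply: ler_pM => //; first by rewrite exprn_ge0 // exprn_ge0 // subr_ge0.
    by rewrite lerXn2r ?nnegrE ?half_pow ?invr_ge0 // exprn_ge0 // subr_ge0.
  apply: le_trans (var_point pg_gt0 pg_sum1 x) _.
  apply: le_trans (gm_inv_le x) _; rewrite exprM lerXn2r // ?nnegrE ?exprn_ge0 //.
  by rewrite mulr_ge0 // exprn_ge0 // ltW.
rewrite exprD [(n * j)%N]mulnC mulrAC -exprMn mulVf ?pnatr_eq0 // expr1n mul1r exprVn.
by rewrite -[leRHS]invrK lef_pV2 // posrE ?exprn_gt0 // invr_gt0 exprn_gt0 // mulr_gt0.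
Qed.

End GlauberMixing.

(** * Switchings in regular graphs *)

Lemma card_pairs (X Y : finType) (P : pred X) (Q : X -> pred Y) :
  #|[set z : X * Y | P z.1 && Q z.1 z.2]| = \sum_(x | P x) #|[set y | Q x y]|.
Proof.
rewrite -sum1_card; under [RHS]eq_bigr do rewrite -sum1_card.
rewrite pair_big_dep /=; apply: eq_bigl => z; by rewrite !inE.
Qed.

Lemma card_xor2 (T : finType) (A : {set T}) a b : a \in A -> b \notin A ->
  #|[set z | (z \in A) (+) (z \in [:: a; b])]| = #|A|.
Proof.
move=> aA bA; have ab : a != b by apply: contraTneq aA => ->.
have -> : [set z | (z \in A) (+) (z \in [:: a; b])] = b |: (A :\ a).
  apply/setP => z; rewrite !inE; case: (eqVneq z b) => [->|zb].
    by rewrite (negbTE bA) orbT.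
  by case: (eqVneq z a) => [->|za]; rewrite ?aA //= addbF.
by rewrite cardsU1 (cardsD1 a A) aA !inE (negbTE bA) andbF.
Qed.

Section Switching.
Variables (n D : nat).
Implicit Types (G : graph n) (u v x y w z : 'I_n) (M : seq ('I_n * 'I_n)).

(** Both orientations of the edges [uv], [xy] to be removed and [ux], [vy] to be added. Toggling
    these pairs is an involution on all graphs. *)
Definition switch_pairs u v x y : seq ('I_n * 'I_n) :=
  [:: (u, v); (v, u); (x, y); (y, x); (u, x); (x, u); (v, y); (y, v)].
Definition switch u v x y G : graph n :=
  [ffun p => G p (+) (p \in switch_pairs u v x y)].

Lemma switchK u v x y : involutive (switch u v x y).
Proof. by move=> G; apply/ffunP => p; rewrite !ffunE addbK. Qed.

Lemma switch_regular u v x y G : regularb D G -> u != v -> adj G u v -> adj G x y ->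
  x != u -> ~~ adj G u x -> y != v -> ~~ adj G v y -> regularb D (switch u v x y G).
Proof.
move=> /andP[Gs /forallP Gr] uv Auv Axy xu ux yv vy.
have xy : x != y by apply: contraTneq Axy => ->; rewrite adj_irr.
have xv : x != v by apply: contraNneq ux => ->.
have yu : y != u by apply: contraNneq vy => ->; rewrite adj_sym.
have sym a b := adj_sym a b Gs.
have Avu : adj G v u by rewrite sym.
have Ayx : adj G y x by rewrite sym.
have xu' : ~~ adj G x u by rewrite sym.
have yv' : ~~ adj G y v by rewrite sym.
have pairE (a b c d : 'I_n) : ((a, b) == (c, d)) = (a == c) && (b == d) by [].
apply/andP; split; first apply/andP; first split.
- apply/forallP => a; apply/forallP => b; apply/eqP; rewrite /adj !ffunE.
  rewrite -![G _]/(adj G _ _) sym; congr (_ (+) _); rewrite !inE !pairE.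
  by do 8!(rewrite [(a == _) && (b == _)]andbC);
     do ![case: (_ && _) => //=]; rewrite ?orbT.
- apply/forallP => a; rewrite /adj ffunE -[G _]/(adj G _ _) adj_irr // addFb !inE !pairE.
  have d b c : b != c -> (a == b) && (a == c) = false.
    by move=> h; case: eqVneq => // ->; rewrite (negbTE h).
  by rewrite !d // eq_sym.
apply/forallP => w; rewrite -(eqP (Gr w)); apply/eqP; rewrite /deg.
have row (a b : 'I_n) : a != b -> adj G w a -> ~~ adj G w b ->
    (forall z, ((w, z) \in switch_pairs u v x y) = (z \in [:: a; b])) ->
    #|[set z | adj (switch u v x y G) w z]| = #|[set z | adj G w z]|.
  move=> ab wa wb h; rewrite -(@card_xor2 _ [set z | adj G w z] a b) ?inE //.
  by congr #|pred_of_set _|; apply/setP => z; rewrite !inE /adj ffunE h !inE.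
have [wu|wu] := eqVneq w u.
  subst w; apply: (row v x) => //; first by rewrite eq_sym.
  move=> z; rewrite !inE !pairE eqxx (negbTE uv) [u == x]eq_sym [u == y]eq_sym (negbTE xu) (negbTE yu).
  by rewrite /= ?orbF.
have [wv|wv] := eqVneq w v.
  subst w; apply: (row u y) => //; first by rewrite eq_sym.
  move=> z; rewrite !inE !pairE eqxx (negbTE wu) [v == x]eq_sym [v == y]eq_sym (negbTE xv) (negbTE yv).
  by rewrite /= ?orbF.
have [wx|wx] := eqVneq w x.
  subst w; apply: (row y u) => //.
  move=> z; rewrite !inE !pairE eqxx (negbTE wu) (negbTE wv) (negbTE xy).
  by rewrite /= ?orbF.
have [wy|wy] := eqVneq w y.
  subst w; apply: (row x v) => //.
  move=> z; rewrite !inE !pairE eqxx (negbTE wu) (negbTE wv) (negbTE wx).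
  by rewrite /= ?orbF.
congr #|pred_of_set _|; apply/setP => z; rewrite !inE /adj ffunE !inE !pairE.
by rewrite (negbTE wu) (negbTE wv) (negbTE wx) (negbTE wy) /= addbF.
Qed.

Definition containing M := [set G : graph n | regularb D G && all (fun p => adj G p.1 p.2) M].

Definition switchable u v M G (p : 'I_n * 'I_n) :=
  [&& adj G p.1 p.2, p.1 != u, ~~ adj G u p.1, p.2 != v, ~~ adj G v p.2,
      p \notin M & (p.2, p.1) \notin M].

(** Of the [D * n] oriented edges, [M] excludes at most two for each of its members, and the closed
    neighbourhoods of [u] and [v] exclude at most [D * D.+1] each. *)
Lemma card_switchable u v M G : regularb D G ->
  (D * n <= #|[set p | switchable u v M G p]| + (2 * size M + 2 * (D * D.+1)))%N.
Proof.
move=> /andP[Gs /forallP Gr].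
have dg w : deg G w = D by apply/eqP; apply: Gr.
have rowcard (A : {set 'I_n}) : #|[set p : 'I_n * 'I_n | (p.1 \in A) && adj G p.1 p.2]| = (#|A| * D)%N.
  rewrite (card_pairs (mem A) (adj G)) -sum_nat_const; apply: eq_bigr => x _; exact: dg.
have colcard (A : {set 'I_n}) : #|[set p : 'I_n * 'I_n | (p.2 \in A) && adj G p.1 p.2]| = (#|A| * D)%N.
  rewrite -rowcard -(card_imset _ (can_inj (@swap_pairK _ _))).
  congr #|pred_of_set _|; apply/setP => -[a b]; rewrite !inE /=.
  apply/imsetP/idP => [[[c d]]|h]; first by rewrite inE /= => h [-> ->]; rewrite adj_sym.
  by exists (b, a) => //; rewrite inE /= adj_sym.
have -> : (D * n)%N = #|[set p : 'I_n * 'I_n | (p.1 \in [set: 'I_n]) && adj G p.1 p.2]|.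
  by rewrite rowcard cardsT card_ord mulnC.
set bu := u |: [set w | adj G u w]; set bv := v |: [set w | adj G v w].
have cb w : #|w |: [set w' | adj G w w']| = D.+1.
  by rewrite cardsU1 inE adj_irr // -/(deg G w) dg.
apply: leq_trans (_ : #|[set p | switchable u v M G p] :|:
   (([set p in M] :|: [set p | (p.2, p.1) \in M]) :|:
   ([set p | (p.1 \in bu) && adj G p.1 p.2] :|: [set p | (p.2 \in bv) && adj G p.1 p.2]))| <= _)%N.
  apply: subset_leq_card; apply/subsetP => p; rewrite !inE /switchable => /= -> /=.
  case: (p.1 == u) => //=; rewrite ?orbT //; case: (adj G u p.1) => //=; rewrite ?orbT //.
  case: (p.2 == v) => //=; rewrite ?orbT //; case: (adj G v p.2) => //=; rewrite ?orbT //.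
  by case: (p \in M); case: ((p.2, p.1) \in M).
apply: leq_trans (leq_card_setU _ _) _; rewrite leq_add2l.
apply: leq_trans (leq_card_setU _ _) _; apply: leq_add.
  apply: leq_trans (leq_card_setU _ _) _; rewrite mul2n -addnn; apply: leq_add.
    by rewrite cardsE card_size.
  rewrite -(card_imset _ (can_inj (@swap_pairK _ _))).
  apply: leq_trans (card_size M); apply: subset_leq_card.
  by apply/subsetP => q /imsetP[[a b]]; rewrite inE /= => h ->.
apply: leq_trans (leq_card_setU _ _) _.
by rewrite rowcard colcard !cb mul2n -addnn mulnC.
Qed.

(** Double counting: switching [uv] away is injective when [(x, y)] is recorded, and in the new
    graph [x] is one of the [D] neighbours of [u] and [y] one of the [D] neighbours of [v]. *)
Lemma switching_bound u v M : (u < v)%N -> (u, v) \notin M ->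
  all (fun p : 'I_n * 'I_n => (p.1 < p.2)%N) M ->
  (#|containing ((u, v) :: M)| * (D * n - (2 * size M + 2 * (D * D.+1))) <=
   #|containing M| * (D * D))%N.
Proof.
move=> uv uvM Mlt.
have nuv : u != v by rewrite neq_ltn uv.
pose A := [set z : graph n * ('I_n * 'I_n) |
  (z.1 \in containing ((u, v) :: M)) && switchable u v M z.1 z.2].
pose B := [set z : graph n * ('I_n * 'I_n) |
  (z.1 \in containing M) && (adj z.1 u z.2.1 && adj z.1 v z.2.2)].
apply: leq_trans (_ : #|A| <= _)%N.
  rewrite /A (card_pairs (mem (containing ((u, v) :: M))) (switchable u v M)) -sum_nat_const.
  apply: leq_sum => G GM; have : G \in containing ((u, v) :: M) by [].
  rewrite inE => /andP[Gr _].
  by rewrite leq_subLR addnC card_switchable.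
apply: leq_trans (_ : #|B| <= _)%N; last first.
  rewrite /B (card_pairs (mem (containing M)) (fun G p => adj G u p.1 && adj G v p.2)) -sum_nat_const.
  apply: leq_sum => G GM; have : G \in containing M by [].
  rewrite inE => /andP[/andP[_ /forallP Gr] _].
  rewrite (card_pairs (adj G u) (fun _ => adj G v)).
  rewrite -{1}(eqP (Gr u)) -(eqP (Gr v)) /deg -sum_nat_const; apply/eq_leq/eq_bigl => x.
  by rewrite inE.
pose f (z : graph n * ('I_n * 'I_n)) := (switch u v z.2.1 z.2.2 z.1, z.2).
have finj : injective f.
  move=> [G p] [G' p'] [] /[swap] -> /(can_inj (switchK _ _ _ _)) ->; by [].
rewrite -(card_imset _ finj); apply: subset_leq_card; apply/subsetP => _ /imsetP[[G [x y]] + ->].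
rewrite !inE /= => /andP[/andP[Gr /andP[Auv GM]]].
rewrite /switchable /= => /and5P[Axy xu ux yv /and3P[vy xyM yxM]].
rewrite switch_regular //=; have [Gs _] := andP Gr.
apply/and3P; split.
- apply/allP => -[a b] abM; have /= := allP GM _ abM; have /= := allP Mlt _ abM.
  rewrite /adj ffunE => lt -> /=; rewrite !inE !negb_or.
  have neq c d : (c, d) \notin M -> (a, b) != (c, d) by move=> h; apply: contraNneq h => <-.
  have nadj c d : ~~ adj G c d -> (a, b) != (c, d).
    by move=> h; apply: contraNneq h => -[<- <-]; have /= := allP GM _ abM.
  have ne : (a, b) != (v, u) by apply: contraTneq lt => -[-> ->]; rewrite -leqNgt ltnW.
  rewrite ne (neq u v) // (neq x y) // (neq y x) // (nadj u x) // (nadj v y) //.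
  by rewrite (nadj x u) ?(nadj y v) // adj_sym.
- by rewrite /adj ffunE -[G _]/(adj G _ _) (negbTE ux) !inE eqxx !orbT.
- by rewrite /adj ffunE -[G _]/(adj G _ _) (negbTE vy) !inE eqxx !orbT.
Qed.

(** Each prescribed edge costs a factor [2 * D / n], since the size condition leaves at least half
    of the oriented edges switchable. *)
Lemma card_containing M : (0 < D)%N -> uniq M -> all (fun p : 'I_n * 'I_n => (p.1 < p.2)%N) M ->
  (4 * size M + 4 * (D * D.+1) <= D * n)%N ->
  (#|containing M| * n ^ size M <= (2 * D) ^ size M * #|containing [::]|)%N.
Proof.
move=> D0; elim: M => [|[u v] M IH] /=; first by rewrite muln1 mul1n.
move=> /andP[uvM uM] /andP[uv Mlt] h.
have := switching_bound uv uvM Mlt.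
have : (D * n <= 2 * (D * n - (2 * size M + 2 * (D * D.+1))))%N by lia.
set Q := (D * n - _)%N => hQ sb.
have sb' : (#|containing ((u, v) :: M)| * n <= 2 * D * #|containing M|)%N.
  rewrite -(leq_pmul2l D0); move: sb hQ.
  move: #|containing ((u, v) :: M)| #|containing M| Q => a b Q sb hQ.
  have h1 : (a * (D * n) <= a * (2 * Q))%N by rewrite leq_mul2l hQ orbT.
  have h2 : (2 * (a * Q) <= 2 * (b * (D * D)))%N by rewrite leq_mul2l sb orbT.
  lia.
have H : (#|containing M| * n ^ size M <= (2 * D) ^ size M * #|containing [::]|)%N.
  by apply: IH => //; lia.
rewrite !expnS.
rewrite mulnA; apply: leq_trans (leq_mul sb' (leqnn _)) _.
by rewrite -!mulnA !leq_mul2l /= H !orbT.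
Qed.

Definition inner_edges G (S : {set 'I_n}) :=
  [set p : 'I_n * 'I_n | [&& (p.1 < p.2)%N, adj G p.1 p.2, p.1 \in S & p.2 \in S]].

Definition dense k m := [set G : graph n | regularb D G &&
  [exists S : {set 'I_n}, (#|S| == k) && (m <= #|inner_edges G S|)%N]].

(** A union bound over the set [S] and over [m] edges inside it, with [k * k] bounding the number of
    vertex pairs in [S]. *)
Lemma card_dense k m : (0 < D)%N -> (4 * m + 4 * (D * D.+1) <= D * n)%N ->
  (#|dense k m| * n ^ m <= 'C(n, k) * 'C(k * k, m) * (2 * D) ^ m * #|containing [::]|)%N.
Proof.
move=> D0 h.
pose P (S : {set 'I_n}) := [set p : 'I_n * 'I_n | [&& (p.1 < p.2)%N, p.1 \in S & p.2 \in S]].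
pose Ks := [set S : {set 'I_n} | #|S| == k].
pose Ms S := [set M : {set 'I_n * 'I_n} | M \subset P S & #|M| == m].
have cover : (#|dense k m| <= \sum_(S in Ks) \sum_(M in Ms S) #|containing (enum M)|)%N.
  apply: leq_trans (_ : #|\bigcup_(S in Ks) \bigcup_(M in Ms S) containing (enum M)| <= _)%N.
    apply: subset_leq_card; apply/subsetP => G; rewrite inE => /andP[Gr /existsP[S /andP[Sk Sm]]].
    apply/bigcupP; exists S; first by rewrite inE.
    have : (0 < #|[set M : {set 'I_n * 'I_n} | M \subset inner_edges G S & #|M| == m]|)%N.
      by rewrite cards_draws bin_gt0.
    move=> /card_gt0P[M]; rewrite inE => /andP[Msub Mm].
    apply/bigcupP; exists M.
      rewrite inE Mm andbT; apply/subsetP => p /(subsetP Msub); rewrite !inE.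
      by move=> /and4P[-> _ -> ->].
    rewrite inE Gr; apply/allP => p; rewrite mem_enum => /(subsetP Msub).
    by rewrite inE => /and4P[].
  have bnd (I : finType) (Q : {pred I}) (F : I -> {set graph n}) :
      (#|\bigcup_(i in Q) F i| <= \sum_(i in Q) #|F i|)%N.
    elim/big_rec2: _ => [|i m' U _ IH]; first by rewrite cards0.
    by apply: leq_trans (leq_card_setU _ _) _; rewrite leq_add2l.
  apply: leq_trans (bnd _ _ _) _; apply: leq_sum => S _; exact: bnd.
apply: leq_trans (leq_mul cover (leqnn _)) _.
have cK : #|Ks| = 'C(n, k) by rewrite /Ks card_draws card_ord.
rewrite big_distrl /= -cK -!mulnA -sum_nat_const.
apply: leq_sum => S; rewrite inE => /eqP Sk.
rewrite big_distrl /=.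
apply: leq_trans (_ : \sum_(M in Ms S) ((2 * D) ^ m * #|containing [::]|) <= _)%N.
  apply: leq_sum => M; rewrite inE => /andP[Msub /eqP Mm].
  rewrite -Mm cardE; apply: card_containing => //; first exact: enum_uniq.
    apply/allP => p; rewrite mem_enum => /(subsetP Msub); by rewrite inE => /and3P[].
  by rewrite -cardE Mm.
rewrite sum_nat_const leq_mul2r cards_draws leq_bin2l ?orbT //.
rewrite -Sk -cardsX; apply: subset_leq_card; apply/subsetP => p; by rewrite !inE => /and3P[_ -> ->].
Qed.

End Switching.

(** * Existence of regular graphs *)

Section Circulant.
Variables (n' D : nat).
Let n := n'.+1.
Hypotheses (Dn : (D < n)%N) (Dev : ~~ odd (D * n)).

(** Connection set of a circulant graph: the [D./2] nearest offsets on either side, and the antipode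
    when [D] is odd (then [n] is even). The graph shows that [prob_reg] has a nonzero
    denominator. *)
Definition offsets : {set 'I_n} :=
  [set i : 'I_n | [|| (0 < i <= D./2)%N, (n - D./2 <= i < n)%N | odd D && (i.*2 == n)]].

Lemma card_ord_range a b : (a <= b <= n)%N -> #|[set i : 'I_n | (a <= i < b)%N]| = (b - a)%N.
Proof.
move=> /andP[ab bn].
have inj : injective (fun j : 'I_(b - a) => inord (a + j) : 'I_n).
  move=> i j /(congr1 val) /=; rewrite !inordK; last 2 first.
  - by have := ltn_ord j; rewrite -/n; lia.
  - by have := ltn_ord i; rewrite -/n; lia.
  by move/addnI/val_inj.
rewrite -[RHS]card_ord -(card_imset _ inj); apply: eq_card => i; rewrite !inE.
apply/idP/imsetP => [/andP[ai ib]|[j _ ->]].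
  have h : (i - a < b - a)%N by lia.
  exists (Ordinal h) => //; apply/val_inj; rewrite /= inordK ?subnKC //; exact: ltn_ord.
by have := ltn_ord j => h; rewrite inordK; [lia | rewrite -/n; lia].
Qed.

Lemma card_offsets : #|offsets| = D.
Proof.
have Dh : D = (odd D + D./2.*2)%N by rewrite odd_double_half.
have evn : odd D -> ~~ odd n by move=> h; move: Dev; rewrite oddM h.
have nh : odd D -> n = n./2.*2 by move=> /evn h; rewrite -[LHS]odd_double_half (negbTE h).
have -> : offsets = [set i : 'I_n | (1 <= i < D./2.+1)%N] :|:
   ([set i : 'I_n | (n - D./2 <= i < n)%N] :|:
    [set i : 'I_n | (n./2 <= i < n./2 + odd D)%N]).
  apply/setP => i; rewrite !inE; congr [|| _, _ | _].
  case: (boolP (odd D)) => [oD|_] /=; last by rewrite addn0; lia.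
  by have hn := nh oD; apply/idP/idP; lia.
rewrite cardsU disjoint_setI0 ?cards0 ?subn0; last first.
  rewrite -setI_eq0; apply/eqP/setP => i; rewrite !inE; apply/negP.
  case: (boolP (odd D)) => [oD|oD]; first by have := nh oD; rewrite oD in Dh *; lia.
  by rewrite addn0; rewrite (negbTE oD) in Dh; lia.
rewrite cardsU disjoint_setI0 ?cards0 ?subn0; last first.
  rewrite -setI_eq0; apply/eqP/setP => i; rewrite !inE; apply/negP.
  case: (boolP (odd D)) => [oD|oD]; first by have := nh oD; rewrite oD in Dh *; lia.
  by rewrite addn0; rewrite (negbTE oD) in Dh; lia.
by rewrite !card_ord_range //; lia.
Qed.

Lemma offsetsN (i : 'I_n) : (- i \in offsets) = (i \in offsets).
Proof.
have lti := ltn_ord i.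
have E : val (- i) = (if (i == 0 :> nat) then 0 else n - i)%N.
  change (val (- i)) with ((n - i) %% n)%N.
  by case: eqP => [->|/eqP h]; [rewrite subn0 modnn | rewrite modn_small //; lia].
rewrite !inE; change (nat_of_ord (- i)) with (val (- i)); rewrite E.
by case: eqP => [->|/eqP h]; apply/idP/idP; lia.
Qed.

Definition circulant : graph n := [ffun p => p.2 - p.1 \in offsets].

Lemma circulant_regular : regularb D circulant.
Proof.
apply/andP; split; first (apply/andP; split).
- apply/forallP => u; apply/forallP => v; apply/eqP; rewrite /adj !ffunE /=.
  by rewrite -offsetsN opprB.
- apply/forallP => u; rewrite /adj ffunE /= subrr !inE /=.
  by rewrite leqNgt; lia.
apply/forallP => v; rewrite /deg.
have -> : [set w | adj circulant v w] = [set i + v | i in offsets].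
  apply/setP => w; rewrite inE /adj ffunE /=.
  apply/idP/imsetP => [h|[i h ->]]; last by rewrite addrK.
  by exists (w - v); rewrite ?subrK.
by rewrite (card_imset _ (addIr v)) card_offsets.
Qed.

End Circulant.

Lemma regular_exists n D : (D < n)%N -> ~~ odd (D * n) -> (0 < #|containing (n := n) D [::]|)%N.
Proof.
case: n => // n Dn Dev; apply/card_gt0P; exists (circulant n D).
by rewrite inE circulant_regular.
Qed.

(** * Bottlenecks *)

Section Bottleneck.
Variables (R : archiRealFieldType) (T : finType) (p : T -> R) (K : T -> T -> R).
Hypotheses (p_gt0 : forall x, 0 < p x) (p_sum1 : \sum_x p x = 1)
  (Krev : reversible p K) (Ksto : stochastic K) (K_ge0 : forall x y, 0 <= K x y).
Variables (A B : {set T}).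
Hypothesis exitB : forall x y, x \in A -> y \notin A -> y \notin B -> K x y = 0.

Lemma sum_evolve x t f : \sum_y evolve K x t y * f y = iter t (op K) f x.
Proof.
elim: t f => [|t IH] f.
  rewrite (bigD1 x) //= eqxx mul1r big1 ?addr0 // => y /negbTE ->; by rewrite mul0r.
rewrite iterSr -IH; under eq_bigr do rewrite mulr_suml.
rewrite exchange_big; apply: eq_bigr => z _.
by rewrite /op mulr_sumr; apply: eq_bigr => y _; rewrite mulrA.
Qed.

Lemma evolve_sum1 x t : \sum_y evolve K x t y = 1.
Proof.
transitivity (\sum_y evolve K x t y * (fun=> 1) y); first by apply: eq_bigr => y _; rewrite mulr1.
rewrite sum_evolve; elim: t => //= t IH.
have E y : iter t (op K) (fun=> 1) y = 1.
  elim: t y {IH} => //= t IH y.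
  by rewrite /op; under eq_bigr do rewrite IH mulr1; apply: Ksto.
by rewrite /op; under eq_bigr do rewrite E mulr1; apply: Ksto.
Qed.

(* Probability that the chain started from [x] stays in [A] up to time [t]. *)
Fixpoint stay (t : nat) (x : T) : R :=
  (x \in A)%:R * (if t is t'.+1 then \sum_y K x y * stay t' y else 1).

Lemma stay_bounds t x : 0 <= stay t x <= 1.
Proof.
elim: t x => [|t IH] x /=; first by rewrite mulr1; case: (x \in A); rewrite ?lexx ler01.
case: (x \in A); rewrite ?mul0r ?lexx ?ler01 // mul1r; apply/andP; split.
  by apply: sumr_ge0 => y _; rewrite mulr_ge0 //; have /andP[] := IH y.
rewrite -(Ksto x); apply: ler_sum => y _; rewrite ler_piMr //.
by have /andP[] := IH y.
Qed.

Lemma stay_decr t x : stay t.+1 x <= stay t x.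
Proof.
elim: t x => [|t IH] x.
  change (stay 1 x) with ((x \in A)%:R * \sum_y K x y * stay 0 y).
  change (stay 0 x) with ((x \in A)%:R * 1 : R).
  rewrite ler_wpM2l // -[leRHS](Ksto x); apply: ler_sum => y _.
  by rewrite ler_piMr //; have /andP[] := stay_bounds 0 y.
change (stay t.+2 x) with ((x \in A)%:R * \sum_y K x y * stay t.+1 y).
change (stay t.+1 x) with ((x \in A)%:R * \sum_y K x y * stay t y).
by rewrite ler_wpM2l //; apply: ler_sum => y _; rewrite ler_wpM2l.
Qed.

Lemma stay_mono t t' x : (t <= t')%N -> stay t' x <= stay t x.
Proof.
move=> /subnK <-; elim: (_ - _)%N => [|j IH] //=; exact: le_trans (stay_decr _ _) IH.
Qed.

Lemma stay_le_evolve t x : stay t x <= \sum_(y in A) evolve K x t y.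
Proof.
have -> : \sum_(y in A) evolve K x t y = \sum_y evolve K x t y * (y \in A)%:R.
  by rewrite big_mkcond; apply: eq_bigr => y _; case: (y \in A); rewrite ?mulr1 ?mulr0.
rewrite sum_evolve; elim: t x => [|t IH] x /=; first by rewrite mulr1.
apply: le_trans (_ : \sum_y K x y * stay t y <= _).
  rewrite ler_piMl //; last by case: (x \in A).
  by apply: sumr_ge0 => y _; rewrite mulr_ge0 //; have /andP[] := stay_bounds t y.
by apply: ler_sum => y _; rewrite ler_wpM2l.
Qed.

(** The chain leaves [A] only into [B], and by stationarity the mass that flows into [B] in one step
    is at most that of [B]. *)
Lemma exit_mass t :
  \sum_(x in A) p x * (1 - stay t x) <= t%:R * \sum_(x in B) p x.
Proof.
have p0 x : 0 <= p x by apply: ltW.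
have flow (C : {pred T}) y : \sum_(x in C) p x * K x y <= p y.
  have -> : \sum_(x in C) p x * K x y = p y * \sum_(x in C) K y x.
    by rewrite mulr_sumr; apply: eq_bigr => x _; rewrite Krev.
  rewrite ler_piMr // -(Ksto y) [leRHS](bigID (mem C)) /= lerDl.
  by apply: sumr_ge0.
elim: t => [|t IH].
  by rewrite mul0r big1 // => x xA; rewrite /= xA mulr1 subrr mulr0.
rewrite -natr1 mulrDl mul1r.
apply: le_trans (_ : \sum_(x in A) \sum_y p x * K x y * (1 - stay t y) <= _).
  apply: ler_sum => x xA.
  change (stay t.+1 x) with ((x \in A)%:R * \sum_y K x y * stay t y).
  rewrite xA mul1r -{1}(Ksto x) -sumrB mulr_sumr le_eqVlt; apply/orP; left; apply/eqP.
  by apply: eq_bigr => y _; ring.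
rewrite exchange_big (bigID (mem A)) /=; apply: lerD.
  apply: le_trans IH; apply: ler_sum => y _; rewrite -mulr_suml ler_wpM2r //.
  by rewrite subr_ge0; have /andP[] := stay_bounds t y.
rewrite [leRHS]big_mkcond [leLHS]big_mkcond /=; apply: ler_sum => y _.
case: ifP => yA; last by case: ifP.
rewrite -mulr_suml.
have y1 : 1 - stay t y <= 1 by rewrite gerBl; have /andP[] := stay_bounds t y.
have y2 : 0 <= 1 - stay t y by rewrite subr_ge0; have /andP[] := stay_bounds t y.
have y3 : 0 <= \sum_(x in A) p x * K x y by apply: sumr_ge0 => x _; rewrite mulr_ge0.
apply: le_trans (_ : \sum_(x in A) p x * K x y <= _); first by rewrite ler_piMr.
case: ifP => yB; first exact: flow.
by rewrite big1 // => x xA; rewrite exitB ?mulr0 // yB.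
Qed.

(** If every start in [A] left it by time [N] with probability above 1/4, the exit mass would exceed
    its bound. So some start keeps mass 3/4 on a set of stationary mass at most 1/2. *)
Lemma bottleneck (N : nat) : 0 < \sum_(x in A) p x -> \sum_(x in A) p x <= 2^-1 ->
  N%:R * (\sum_(x in B) p x) * 4 < \sum_(x in A) p x ->
  exists x, forall t, (t <= N)%N -> 4^-1 <= 2^-1 * \sum_y `|evolve K x t y - p y|.
Proof.
set a := \sum_(x in A) p x => a0 a2 hN.
have [/existsP[x hx]|no] := boolP [exists x, 3 / 4 <= stay N x]; last first.
  exfalso; have := exit_mass N; apply/negP; rewrite -ltNge.
  apply: lt_le_trans (_ : a * 4^-1 <= _); first by rewrite ltr_pdivlMr.
  rewrite mulr_suml; apply: ler_sum => x xA; rewrite ler_wpM2l ?(ltW (p_gt0 x)) //.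
  move: no; rewrite negb_exists => /forallP /(_ x); rewrite -ltNge; lra.
exists x => t tN.
have PA : 3 / 4 <= \sum_(y in A) evolve K x t y.
  by apply: le_trans hx _; apply: le_trans (stay_mono x tN) (stay_le_evolve _ _).
have AC : \sum_(y in A) evolve K x t y + \sum_(y in ~: A) evolve K x t y = 1.
  by rewrite -(evolve_sum1 x t) [RHS](bigID (mem A)) /=; congr (_ + _); apply: eq_bigl => y; rewrite inE.
have pC : a + \sum_(y in ~: A) p y = 1.
  by rewrite -p_sum1 [RHS](bigID (mem A)) /=; congr (_ + _); apply: eq_bigl => y; rewrite inE.
have : \sum_(y in A) (evolve K x t y - p y) + \sum_(y in ~: A) (p y - evolve K x t y) <=
       \sum_y `|evolve K x t y - p y|.
  rewrite [leRHS](bigID (mem A)) /=; apply: lerD.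
    by apply: ler_sum => y _; apply: ler_norm.
  rewrite [leRHS](eq_bigl (fun y => y \in ~: A)); last by move=> y; rewrite inE.
  by apply: ler_sum => y _; rewrite distrC ler_norm.
rewrite !sumrB -/a; lra.
Qed.

End Bottleneck.

(** * The bottleneck on a graph without dense sets *)

Section EdgeCounts.
Variables (n : nat) (G : graph n).
Hypothesis Gs : simpleb G.
Implicit Types (S : {set 'I_n}) (l : seq 'I_n) (u v : 'I_n).

Definition later_nbr l v : nat := #|[set u | adj G v u && (u \in l)]|.
Definition earlier_nbr S l v : nat := #|[set u | [&& adj G v u, u \notin l & u \in S]]|.

Lemma lsum_later l : uniq l -> (lsum later_nbr l <= #|inner_edges G [set x in l]|)%N.
Proof.
elim: l => //= v l IH /andP[vl ul].
pose f u := if (u < v)%N then (u, v) else (v, u).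
have finj : injective f.
  by move=> u u'; rewrite /f; case: ifP => _; case: ifP => _ []; congruence.
rewrite /later_nbr -(card_imset _ finj) addnC.
apply: leq_trans (leq_add (IH ul) (leqnn _)) _.
rewrite -cardsUI [X in (_ + X <= _)%N](_ : _ = 0%N) ?addn0; last first.
  apply/eqP; rewrite cards_eq0 -subset0; apply/subsetP => p.
  rewrite inE => /andP[]; rewrite inE => /and4P[_ _]; rewrite !inE => p1 p2 /imsetP[u _ E].
  by move: E p1 p2; rewrite /f; case: ifP => _ -> /=; rewrite (negbTE vl).
apply: subset_leq_card; apply/subsetP => p; rewrite inE => /orP[|/imsetP[u]].
  by rewrite !inE => /and4P[-> -> -> ->]; rewrite !orbT.
rewrite inE => /andP[vu ul'] ->.
have nuv : u != v by apply: contraTneq vu => ->; rewrite adj_irr.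
rewrite /f; case: ltngtP => [h|h|/val_inj h]; last by rewrite h eqxx in nuv.
  by rewrite !inE /= h adj_sym // vu ul' eqxx orbT.
by rewrite !inE /= h vu ul' eqxx orbT.
Qed.

Lemma lsum_earlier S : (lsum (earlier_nbr S) (enum S) <= #|inner_edges G S|)%N.
Proof.
(* On the graph induced by [S], all edges are monochromatic for a single colour, so [mono_listE]
   counts them. *)
pose GS : graph n := [ffun p => [&& G p, p.1 \in S & p.2 \in S]].
have adjS u v : adj GS u v = [&& adj G u v, u \in S & v \in S] by rewrite /adj ffunE.
have GSs : simpleb GS.
  apply/andP; split; last by apply/forallP => u; rewrite adjS adj_irr.
  apply/forallP => u; apply/forallP => v; rewrite !adjS adj_sym //.
  by rewrite [(u \in S) && _]andbC.
pose s0 : config n 1 := [ffun=> ord0].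
have <- : mono GS s0 = #|inner_edges G S|.
  congr #|pred_of_set _|; apply/setP => p; rewrite !inE adjS.
  by case: (p.1 < p.2)%N => //; case: adj => //=; rewrite !ffunE eqxx andbT.
rewrite (mono_listE GSs s0 (enum_uniq (mem S))); apply: leq_trans (leq_addr _ _).
have : all (fun x => x \in S) (enum S) by apply/allP => x; rewrite mem_enum.
elim: (enum S) => //= v l IH /andP[vS lS]; apply: leq_add (IH lS).
apply: subset_leq_card; apply/subsetP => u; rewrite !inE adjS vS !ffunE eqxx andbT.
by move=> /and3P[-> -> ->].
Qed.

End EdgeCounts.

Section RegularBottleneck.
Variables (R : archiRealFieldType) (n q D : nat) (G : graph n) (lam : R).
Hypotheses (Gr : regularb D G) (lam1 : 1 <= lam).
Variables (c0 c1 : 'I_q).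
Hypothesis c01 : c0 != c1.
Implicit Types (S : {set 'I_n}) (l : seq 'I_n) (u v : 'I_n) (s t : config n q).

Let Gs : simpleb G. Proof. by case/andP: Gr. Qed.
Let degD v : deg G v = D. Proof. by case/andP: Gr => _ /forallP /(_ v) /eqP. Qed.
Let degleD v : (deg G v <= D)%N. Proof. by rewrite degD. Qed.
Let lam0 : 0 < lam. Proof. exact: lt_le_trans lam1. Qed.
Let q0 : (0 < q)%N. Proof. exact: leq_ltn_trans (leq0n c0) (ltn_ord c0). Qed.

Definition others (c : 'I_q) s := [set v | s v != c].
Definition mono_state (c : 'I_q) : config n q := [ffun=> c].

(** Compared with the state all of colour [c0], the edges meeting [S] are lost, [D * #|S|] less the
    inner ones; only monochromatic inner edges come back. *)
Lemma mono_others_le s S : others c0 s = S ->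
  (mono G s + D * #|S| <= mono G (mono_state c0) + #|inner_edges G S| +
     lsum (fun l v => same_nbr G (mem S) l v s) (enum S))%N.
Proof.
move=> hS; have ue := enum_uniq (mem S).
have inS v : (v \in S) = (s v != c0) by rewrite -hS inE.
rewrite (mono_listE Gs s ue) (mono_listE Gs (mono_state c0) ue).
rewrite (mono_off_eqoff G (t := mono_state c0) (s := s)); last first.
  by apply/eqoffP => v; rewrite mem_enum inS negbK => /eqP ->; rewrite ffunE.
have hl := lsum_later Gs ue.
have -> : inner_edges G S = inner_edges G [set x in enum S].
  by apply/setP => p; rewrite !inE !mem_enum.
have : (lsum (fun l v => same_nbr G predT l v s) (enum S) + D * #|S| <=
   lsum (fun l v => same_nbr G predT l v (mono_state c0)) (enum S) +
   lsum (later_nbr G) (enum S) + lsum (fun l v => same_nbr G (mem S) l v s) (enum S))%N.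
  rewrite cardE; have : all (fun x => x \in S) (enum S) by apply/allP => x; rewrite mem_enum.
  elim: (enum S) => [_|v l IH /= /andP[vS lS]] /=; first by rewrite muln0.
  have h1 : (same_nbr G predT l v s <= same_nbr G (mem S) l v s)%N.
    apply: subset_leq_card; apply/subsetP => u; rewrite !inE => /and3P[-> -> /eqP su].
    by rewrite su eqxx /= andbT inS su -inS.
  have h2 : (D <= same_nbr G predT l v (mono_state c0) + later_nbr G l v)%N.
    rewrite -(degD v) /deg; apply: leq_trans (leq_card_setU _ _).
    apply: subset_leq_card; apply/subsetP => u; rewrite !inE => ->.
    by rewrite !ffunE eqxx /= andbT orNb.
  rewrite mulnS addnACA; apply: leq_trans (leq_add (leq_add h1 h2) (IH lS)) _.
  by apply: eq_leq; ring.
move: hl; move: (lsum _ _) (lsum _ _) (lsum _ _) (lsum _ _) (mono_off _ _ _) => a b c d e.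
move: #|S| #|inner_edges _ _| => k i h1 h2; lia.
Qed.

Variables (X Y : R).
Hypotheses (X0 : 0 <= X) (Y1 : 1 <= Y)
  (XY : forall d, (d <= D)%N -> q%:R + D%:R * lam ^+ d <= X * Y ^+ d).

(** The bound [X * Y ^+ d] is geometric in [d], so the product over [S] sees only the number of
    inner edges and not their distribution. The factor [lam] per inner edge comes from
    [mono_others_le]. *)
Lemma sum_others_le S :
  (\sum_(s | others c0 s == S) lam ^+ mono G s) * lam ^+ (D * #|S|) <=
  lam ^+ mono G (mono_state c0) * (lam * Y) ^+ #|inner_edges G S| * X ^+ #|S|.
Proof.
set e := #|inner_edges G S|.
apply: le_trans (_ : \sum_(s | eqoff (mem (enum S)) (mono_state c0) s)
  lam ^+ (mono G (mono_state c0) + e) *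
    lprod (fun l v => lam ^+ same_nbr G (mem S) l v s) (enum S) <= _).
  rewrite mulr_suml [leLHS]big_mkcond [leRHS]big_mkcond /=; apply: ler_sum => s _.
  case: ifP => [/eqP hS|_].
    have -> : eqoff (mem (enum S)) (mono_state c0) s.
      apply/eqoffP => v; rewrite mem_enum -hS inE negbK => /eqP ->; by rewrite ffunE.
    by rewrite lprod_pow -!exprD ler_weXn2l // mono_others_le.
  case: ifP => // _; rewrite mulr_ge0 ?exprn_ge0 ?(ltW lam0) // lprod_ge0 // => l v.
  by rewrite exprn_ge0 // ltW.
rewrite -mulr_sumr exprD -!mulrA; apply: ler_wpM2l; first by rewrite exprn_ge0 // ltW.
rewrite exprMn -mulrA; apply: ler_wpM2l; first by rewrite exprn_ge0 // ltW.
apply: le_trans (@sum_lprod_le _ _ _ (fun l v t => lam ^+ same_nbr G (mem S) l v t)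
   (fun l v => X * Y ^+ earlier_nbr G S l v) _ _ (enum_uniq (mem S)) _ _ _) _.
- by move=> l v t; rewrite exprn_ge0 // ltW.
- by move=> l v t t' vl tt'; rewrite (same_nbr_eqoff _ _ vl tt').
- move=> l v t; apply: le_trans (XY _); last first.
    by rewrite -(degD v); apply: subset_leq_card; apply/subsetP => u; rewrite !inE => /andP[].
  apply: (@sum_same_nbr_le _ _ _ _ _ _ lam1 degleD (mem S) l v t _ id) => // c.
  by apply: subset_leq_card; apply/subsetP => u; rewrite !inE => /and4P[-> -> ->].
have -> : lprod (fun l v => X * Y ^+ earlier_nbr G S l v) (enum S) =
   X ^+ #|S| * Y ^+ lsum (earlier_nbr G S) (enum S).
  rewrite cardE; elim: (enum S) => [|v l IH] /=; first by rewrite mulr1.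
  by rewrite IH exprS exprD; ring.
rewrite mulrC ler_wpM2r ?exprn_ge0 // ler_weXn2l //; exact: lsum_earlier.
Qed.

Lemma sum_boundary_le k m : (0 < m)%N -> G \notin dense n D k m ->
  (\sum_(s | #|others c0 s| == k) lam ^+ mono G s) * lam ^+ (D * k) <=
  'C(n, k)%:R * (lam ^+ mono G (mono_state c0) * (lam * Y) ^+ m.-1 * X ^+ k).
Proof.
move=> m0 nd.
have lY1 : 1 <= lam * Y by have := lam1; have := Y1; nra.
rewrite (partition_big (others c0) (fun S => #|S| == k)) //= mulr_suml.
have -> : 'C(n, k) = #|[set S : {set 'I_n} | #|S| == k]| by rewrite card_draws card_ord.
rewrite mulr_natl -sumr_const [leRHS](eq_bigl (fun S : {set 'I_n} => #|S| == k)); last first.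
  by move=> S; rewrite inE.
apply: ler_sum => S /eqP Sk.
rewrite (eq_bigl (fun s => others c0 s == S)); last first.
  by move=> s; case: (eqVneq (others c0 s) S) => [->|_]; rewrite ?Sk ?eqxx ?andbF.
have := sum_others_le S; rewrite Sk => /le_trans; apply.
rewrite ler_wpM2r ?exprn_ge0 // ler_wpM2l ?exprn_ge0 ?(ltW lam0) // ler_weXn2l //.
rewrite -ltnS prednK // ltnNge; move: nd; apply: contraNN => h.
by rewrite inE Gr; apply/existsP; exists S; rewrite Sk eqxx.
Qed.

Lemma mono_swap s : mono G [ffun v => tperm c0 c1 (s v)] = mono G s.
Proof.
congr #|pred_of_set _|; apply/setP => p; rewrite !inE !ffunE.
by rewrite (inj_eq perm_inj).
Qed.

(** The factor [16 ^+ k] pays for [4 ^ k] steps, and [1 < k] makes [4 * 4 ^ k < 16 ^ k] strict. The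
    well around [c0] has a disjoint mirror image around [c1], hence mass at most one half. *)
Lemma regular_bottleneck k m : (1 < k)%N -> (k.*2 <= n)%N -> (0 < m)%N ->
  G \notin dense n D k m ->
  'C(n, k)%:R * ((lam * Y) ^+ m.-1 * X ^+ k) * 16 ^+ k <= lam ^+ (D * k) ->
  exists x : config n q, forall t : nat, (t <= 4 ^ k)%N ->
    4^-1 <= 2^-1 * \sum_y `|evolve (gd G lam) x t y - gm G lam y|.
Proof.
move=> k1 kn m0 nd hB.
have n0 : (0 < n)%N by lia.
have pgt0 s : 0 < gm (q:=q) G lam s by apply: gm_gt0.
have psum1 : \sum_s gm (q:=q) G lam s = 1 by apply: gm_sum1.
pose A c := [set s : config n q | (#|others c s| < k)%N].
pose B := [set s : config n q | #|others c0 s| == k].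
have Z0 : 0 < Zr q G lam by apply: Zr_gt0.
have pA0 : gm G lam (mono_state c0) <= \sum_(s in A c0) gm (q:=q) G lam s.
  rewrite (bigD1 (mono_state c0)) /=; last first.
    rewrite inE (_ : others _ _ = set0) ?cards0 ?(ltn_trans _ k1) //.
    by apply/setP => v; rewrite !inE ffunE eqxx.
  by rewrite lerDl; apply: sumr_ge0 => s _; apply: ltW.
have pB : (\sum_(s in B) gm (q:=q) G lam s) * 16 ^+ k <= gm G lam (mono_state c0).
  rewrite /gm -mulr_suml mulrAC ler_wpM2r ?invr_ge0 ?(ltW Z0) //.
  have := sum_boundary_le m0 nd.
  have p16 : 0 < 16 ^+ k :> R by rewrite exprn_gt0.
  move/(ler_wpM2r (ltW p16)).
  have -> : \sum_(s in B) lam ^+ mono G s = \sum_(s | #|others c0 s| == k) lam ^+ mono G s.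
    by apply: eq_bigl => s; rewrite inE.
  set b := \sum_(_ | _) _; set w := lam ^+ mono _ _ => h.
  rewrite -(ler_pM2r (_ : 0 < lam ^+ (D * k))) ?exprn_gt0 //.
  apply: le_trans (_ : w * ('C(n, k)%:R * ((lam * Y) ^+ m.-1 * X ^+ k) * 16 ^+ k) <= _).
    by rewrite mulrAC; apply: le_trans h _; rewrite le_eqVlt; apply/orP; left; apply/eqP; ring.
  by rewrite ler_wpM2l // exprn_ge0 // ltW.
have pB0 : 0 < \sum_(s in B) gm (q:=q) G lam s.
  have kn' : (k <= #|'I_n|)%N by rewrite card_ord; lia.
  have /card_gt0P[S] : (0 < #|[set S : {set 'I_n} | #|S| == k]|)%N by rewrite card_draws bin_gt0.
  rewrite inE => Sk; pose s : config n q := [ffun v => if v \in S then c1 else c0].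
  have sB : s \in B.
    rewrite inE (_ : others c0 s = S) //; apply/setP => v; rewrite inE ffunE.
    by case: (v \in S); rewrite ?eqxx // eq_sym.
  rewrite (bigD1 s) //= ltr_pwDl //; apply: sumr_ge0 => s' _; exact: ltW.
apply: (@bottleneck _ _ (gm G lam) (gd G lam) pgt0 psum1 _ _ _ (A c0) B).
- exact: gd_rev.
- exact: gd_sto.
- move=> s t; rewrite /gd /avg divr_ge0 //; apply: sumr_ge0 => v _.
  by apply: hb_ge0 => //; [move=> x; apply: ltW | exact: eqoff_equiv].
(* A step changes one vertex, so the number of vertices off [c0] cannot jump over [k]. *)
- move=> s t; rewrite !inE -leqNgt => sA tA tB.
  rewrite /gd /avg big1 ?mul0r // => v _; rewrite /hbB /hb; case: ifP => // st; exfalso.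
  have : (#|others c0 t| <= (#|others c0 s|).+1)%N.
    apply: leq_trans (_ : #|v |: others c0 s| <= _)%N; last by rewrite cardsU1; case: (_ \notin _).
    apply: subset_leq_card; apply/subsetP => w; rewrite !inE => tw.
    by case: eqVneq => //= wv; rewrite (eqoffP _ _ _ st) // inE.
  by move=> h; move: tB; rewrite eqn_leq tA andbT (leq_trans h sA).
- exact: lt_le_trans pA0.
- have E : \sum_(s in A c1) gm (q:=q) G lam s = \sum_(s in A c0) gm (q:=q) G lam s.
    pose sw s : config n q := [ffun v => tperm c0 c1 (s v)].
    have swK : involutive sw by move=> s; apply/ffunP => v; rewrite !ffunE tpermK.
    rewrite (reindex_inj (inv_inj swK)) /=; apply: eq_big => s.
      rewrite !inE (_ : others c1 (sw s) = others c0 s) //; apply/setP => v.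
      by rewrite !inE ffunE -{2}[c1](tpermL c0) (inj_eq perm_inj).
    by move=> _; rewrite /gm mono_swap.
  have D01 : [disjoint A c0 & A c1].
    rewrite disjoint_subset; apply/subsetP => s; rewrite !inE -leqNgt => h0.
    have : (n <= #|others c0 s| + #|others c1 s|)%N.
      rewrite -{1}(card_ord n) -cardsT; apply: leq_trans (leq_card_setU _ _).
      apply: subset_leq_card; apply/subsetP => v _; rewrite !inE.
      by case: eqVneq => //= ->.
    by move: h0 kn; clear; lia.
  have : \sum_(s in A c0) gm (q:=q) G lam s + \sum_(s in A c1) gm (q:=q) G lam s <= 1.
    rewrite -bigU //=; have := psum1; rewrite (bigID [in [predU A c0 & A c1]]) /= => <-.
    rewrite lerDl.
    by apply: sumr_ge0 => s _; apply: ltW.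
  rewrite E; lra.
apply: lt_le_trans pA0; apply: lt_le_trans pB.
rewrite mulrAC [ltRHS]mulrC ltr_pM2r // natrX.
have -> : 16 ^+ k = 4 ^+ k * 4 ^+ k :> R by rewrite -exprMn; congr (_ ^+ _); ring.
rewrite ltr_pM2l ?exprn_gt0 // -[ltLHS]expr1 ltr_eXn2l //; lra.
Qed.

End RegularBottleneck.

Notation RR := Rdefinitions.R.

(** * Constants for rapid mixing *)

Section Bridge.
Variables (n q D : nat) (G : graph n) (lam : RR).
Hypotheses (Gs : simpleb G) (lam1 : 1 <= lam) (degD : forall v, (deg G v <= D)%N)
  (q0 : (0 < q)%N).

Lemma partZE : @partZ n q G lam = Zr q G lam.
Proof. by apply: eq_bigr => s _; rewrite /weight RpowE. Qed.

Lemma gibbsE s : @gibbs n q G lam s = gm G lam s.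
Proof. by rewrite /gibbs /weight partZE RpowE RdivE. Qed.

Lemma glauberE s t : @glauber n q G lam s t = gd G lam s t.
Proof.
rewrite (gdE Gs lam1 q0); apply: eq_bigr => v _; rewrite RdivE INRE; congr (_ / _).
case: ifP => // _; rewrite RpowE RdivE; congr (_ / _).
by apply: eq_bigr => c _; rewrite RpowE.
Qed.

Lemma distE x t y : @Defs.dist n q G lam x t y = evolve (gd G lam) x t y.
Proof.
elim: t y => [|t IH] y /=; first by case: eqP.
by apply: eq_bigr => z _; rewrite IH glauberE.
Qed.

Lemma tvE x t : tv (@Defs.dist n q G lam x t) (@gibbs n q G lam) =
  2^-1 * \sum_y `|evolve (gd G lam) x t y - gm G lam y|.
Proof.
rewrite /tv RinvE; congr (_ * _); apply: eq_bigr => y _.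
by rewrite RabsE distE gibbsE.
Qed.

End Bridge.

Section RealExponents.
Local Arguments Rpower _%_ring_scope _%_ring_scope.

Section Powers.
Variable lam : RR.
Hypothesis lam1 : 1 < lam.

Let lam0 : Rlt (IZR 0) lam. Proof. by apply/RltP; apply: lt_trans ltr01 lam1. Qed.

Lemma Rpower_gt0 (x y : RR) : 0 < Rpower x y.
Proof. by apply/RltP; apply: exp_pos. Qed.

Lemma Rpower_natE m : Rpower lam m%:R = lam ^+ m.
Proof. by rewrite -INRE Rpower_pow // RpowE. Qed.

Lemma Rpower_addE (x y : RR) : Rpower lam (x + y) = Rpower lam x * Rpower lam y.
Proof. exact: Rpower_plus. Qed.

Lemma Rpower_le (x y : RR) : x <= y -> Rpower lam x <= Rpower lam y.
Proof. by move=> xy; apply/RleP; apply: Rle_Rpower; apply/RleP => //; apply: ltW. Qed.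

Lemma Rpower_exprE (x : RR) m : Rpower lam x ^+ m = Rpower lam (x * m%:R).
Proof.
rewrite -Rpower_mult -INRE Rpower_pow ?RpowE //; exact: exp_pos.
Qed.

End Powers.

(** The right side is the chord over [[0, 1]] of the convex left side. *)
Lemma binomial_increment (R : archiRealFieldType) (x : R) S : 0 <= x <= 1 ->
  (1 + x) ^+ S <= 1 + (2 ^+ S - 1) * x.
Proof.
move=> /andP[x0 x1]; elim: S => [|S IH]; first by rewrite !expr0 subrr mul0r addr0.
rewrite !exprS; apply: le_trans (_ : (1 + x) * (1 + (2 ^+ S - 1) * x) <= _).
  by rewrite ler_wpM2l // addr_ge0.
have : 1 <= 2 ^+ S :> R by rewrite exprn_ege1 // ler1n.
move: (2 ^+ S) => E E1.
have : 0 <= (E - 1) * (x * (1 - x)) by rewrite !mulr_ge0 // subr_ge0.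
nra.
Qed.

Lemma archi_bound_nat (R : archiRealFieldType) (x : R) : exists m : nat, x <= m%:R.
Proof.
exists (Num.Def.archi_bound `|x|).
exact: le_trans (ler_norm x) (ltW (archi_boundP (normr_ge0 x))).
Qed.

Lemma pow2_ge (R : archiRealFieldType) (x : R) : exists m : nat, x <= 2 ^+ m.
Proof.
have [m hm] := archi_bound_nat x; exists m; apply: le_trans hm _.
by rewrite -natrX ler_nat ltnW // ltn_expl.
Qed.

(** With [Q = S * 2 ^ S * D], the truncated weights contribute at most [Q / c] and the monochromatic
    block at most [1 / c]. [c] is chosen so that the sum is [1 / (8 * D * S)], the largest [kap]
    allowed by [sum_dnew]. *)
Lemma near_uniform_const (R : archiRealFieldType) (D S q : nat) (lam L c : R) :
  (0 < D)%N -> (0 < S)%N -> 1 <= lam ->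
  c = 8 * D%:R * S%:R * (S%:R * 2 ^+ S * D%:R + 1) ->
  lam ^+ D.-1 <= L -> lam ^+ (D.-1 * S + 1) <= L ^+ S -> c * L <= q%:R ->
  S%:R * ((q%:R + D%:R * lam ^+ D.-1) ^+ S - q%:R ^+ S) + lam ^+ (D.-1 * S + 1)
    <= (8 * (D * S)%:R)^-1 * q%:R ^+ S.
Proof.
move=> D0 S0 lam1 cE h1 h2 h3.
have D1 : 1 <= D%:R :> R by rewrite ler1n.
have S1 : 1 <= S%:R :> R by rewrite ler1n.
have E1 : 1 <= 2 ^+ S :> R by rewrite exprn_ege1 // ler1n.
have L1 : 1 <= L by apply: le_trans h1; rewrite exprn_ege1.
set Q := S%:R * 2 ^+ S * D%:R in cE.
have DS1 : 1 <= D%:R * S%:R :> R by nra.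
have Q1 : 1 <= Q.
  have : 1 <= S%:R * 2 ^+ S :> R by nra.
  by rewrite /Q; move: (S%:R * _) => X; nra.
have cQ : c = 8 * (D%:R * S%:R) * (Q + 1) by rewrite cE; ring.
have cD : D%:R <= c.
  have : D%:R <= D%:R * S%:R :> R by nra.
  by rewrite cQ; nra.
have c1 : 1 <= c by lra.
have c0 : 0 < c by lra.
have q0 : 0 < q%:R :> R by apply: lt_le_trans h3; rewrite mulr_gt0 //; lra.
set x := D%:R * lam ^+ D.-1 / q%:R.
have lam0 : 0 <= lam ^+ D.-1 by rewrite exprn_ge0 //; lra.
have xD : x <= D%:R / c.
  rewrite ler_pdivrMr // mulrAC ler_pdivlMr // -mulrA ler_wpM2l //.
  by apply: le_trans h3; rewrite mulrC ler_wpM2l // ltW.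
have x0 : 0 <= x by rewrite !mulr_ge0 // invr_ge0 ltW.
have x1 : x <= 1 by apply: le_trans xD _; rewrite ler_pdivrMr // mul1r.
have -> : q%:R + D%:R * lam ^+ D.-1 = q%:R * (1 + x) by rewrite /x; field; rewrite gt_eqF.
have t2 : lam ^+ (D.-1 * S + 1) <= c^-1 * q%:R ^+ S.
  apply: le_trans h2 _; rewrite mulrC ler_pdivlMr //.
  apply: le_trans (_ : L ^+ S * c ^+ S <= _).
    rewrite ler_wpM2l ?exprn_ge0 //; first lra.
    by rewrite -[leLHS]expr1 ler_weXn2l.
  have cL0 : 0 <= c * L by rewrite mulr_ge0 //; lra.
  by rewrite -exprMn mulrC lerXn2r ?nnegrE.
have t1 : S%:R * ((q%:R * (1 + x)) ^+ S - q%:R ^+ S) <= (Q / c) * q%:R ^+ S.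
  rewrite exprMn -{2}[q%:R ^+ S]mulr1 -mulrBr mulrCA mulrC ler_wpM2r ?exprn_ge0 //.
  have := binomial_increment S (introT andP (conj x0 x1)) => b.
  apply: le_trans (_ : S%:R * (2 ^+ S * x) <= _).
    by rewrite ler_wpM2l //; have : 0 <= x by []; nra.
  by rewrite /Q -!mulrA ler_wpM2l // ler_wpM2l // exprn_ge0.
apply: le_trans (lerD t1 t2) _; rewrite -mulrDl ler_wpM2r ?exprn_ge0 //.
rewrite natrM le_eqVlt; apply/orP; left; apply/eqP; rewrite cQ.
by field; rewrite !gt_eqF //; lra.
Qed.

Lemma rapid_mixing (D : nat) (eta : RR) : (2 <= D)%N -> 0 < eta ->
  exists c1 : RR, 0 < c1 /\ forall (q : nat) (lam : RR), (2 <= q)%N -> 1 < lam ->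
    c1 * Rpower lam (D%:R - 1 + eta) < q%:R -> forall eps : RR, 0 < eps ->
    exists p : list RR, forall (n : nat) (G : graph n),
       simpleb G -> connectedb G -> max_degree_eq D G ->
       @mixing_time_le n q G lam eps (poly_eval p (INR n)).
Proof.
move=> D2 eta0.
have [S' hS'] := archi_bound_nat eta^-1.
pose S := S'.+1.
have hS : 1 <= eta * S%:R.
  rewrite mulrC -ler_pdivrMr // mul1r (le_trans hS') // ler_nat; exact: leqnSn.
have D0 : (0 < D)%N by apply: leq_trans D2.
have [c cE] : exists c : RR, c = 8 * D%:R * S%:R * (S%:R * 2 ^+ S * D%:R + 1) by eexists.
have cgt0 : 0 < c.
  by rewrite cE !mulr_gt0 ?ltr0n // addr_gt0 // !mulr_gt0 ?exprn_gt0 ?ltr0n.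
exists c; split=> // q lam q2 lam1 hq eps eps0.
have q0 : (0 < q)%N by apply: leq_trans q2.
set L := Rpower lam _ in hq.
have ED : D%:R - 1 = D.-1%:R :> RR by rewrite -{1}(prednK D0) -natr1 addrK.
have h1 : lam ^+ D.-1 <= L.
  by rewrite -Rpower_natE // Rpower_le // ED lerDl ltW.
(* Here [eta * S >= 1] gives [(D - 1) * S + 1 <= (D - 1 + eta) * S]. *)
have h2 : lam ^+ (D.-1 * S + 1) <= L ^+ S.
  rewrite -Rpower_natE // Rpower_exprE // Rpower_le // natrD natrM ED mulrDl lerD2l.
  exact: hS.
have near := @near_uniform_const _ D S q lam L c D0 (ltn0Sn _) (ltW lam1) cE h1 h2 (ltW hq).
have [k hk] := archi_bound_nat (2 * comparison_const q D lam S).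
have [i hi] := pow2_ge ((2 * eps) ^- 2).
have [j hj] := pow2_ge (q%:R * lam ^+ D).
(* The time of [glauber_mixing], expanded as a cubic in [n]. *)
exists [:: 0; 0; (k.+1 * i)%:R; (k.+1 * j)%:R] => n G Gs Gc /andP[/forallP dG /existsP[v _]] x.
have n0 : (0 < n)%N by apply: leq_ltn_trans (leq0n v) (ltn_ord v).
have hD : forall v, (deg G v <= D)%N by [].
exists (k.+1 * n ^ 2 * (n * j + i))%N; split.
  rewrite /= !INRE; apply/RleP; rewrite !RealsE le_eqVlt; apply/orP; left; apply/eqP.
  by rewrite !natrM !natrD !natrM; ring.
rewrite (tvE Gs (ltW lam1) q0); apply/RleP.
apply: (glauber_mixing Gs (ltW lam1) hD q0 n0 x (ltn0Sn k) eps0 hi hj) => f.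
have C0 := comparison_const_ge0 q D (ltW lam1) S.
apply: le_trans (@glauber_poincare _ _ _ _ _ _ Gs (ltW lam1) hD q0 n0 S (8 * (D * S)%:R)^-1 f
  (ltn0Sn _) D0 Gc _ _ near) _.
- by rewrite invr_ge0 mulr_ge0 ?ler0n.
- by rewrite mulrAC divff // mulf_neq0 ?pnatr_eq0 // -lt0n muln_gt0 D0.
rewrite ler_wpM2r //.
  by rewrite energy_avg ?card_ord // divr_ge0 // sumr_ge0 // => w _; apply: energy1_ge0 => //; apply: ltW.
rewrite ler_wpM2r ?exprn_ge0 // (le_trans hk) // ler_nat; exact: leqnSn.
Qed.

End RealExponents.

(** * Constants for slow mixing *)

Lemma expn_succ_le k : (0 < k)%N -> (k.+1 ^ k <= 3 * k ^ k)%N.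
Proof.
move=> k0; rewrite -(ler_nat RR) natrM !natrX.
have K0 : 0 < k%:R :> RR by rewrite ltr0n.
have h : 1 + k%:R^-1 <= exp (k%:R^-1) by apply/RleP; apply: exp_ineq1_le.
have -> : k.+1%:R = k%:R * (1 + k%:R^-1) :> RR by rewrite -natr1; field; rewrite gt_eqF.
rewrite exprMn mulrC ler_wpM2r ?exprn_ge0 //.
have h1 : (1 + k%:R^-1) ^+ k <= exp (k%:R^-1) ^+ k.
  by rewrite lerXn2r // ?nnegrE ?addr_ge0 ?invr_ge0 //; apply/RleP/Rlt_le/exp_pos.
apply: le_trans h1 _.
have -> : exp (k%:R^-1) ^+ k = exp 1.
  rewrite -RpowE -Rpower_pow; last exact: exp_pos.
  rewrite /Rpower ln_exp INRE; congr exp.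
  by rewrite RmultE divff // gt_eqF.
by have /RleP := exp_le_3; rewrite IZRposE INRE.
Qed.

Lemma expn_self_le k : (k ^ k <= 3 ^ k * k`!)%N.
Proof.
elim: k => // k IH; case: (posnP k) => [->//|k0].
rewrite factS [(3 ^ _)%N]expnS [(k.+1 ^ _)%N]expnS.
apply: leq_trans (leq_mul (leqnn _) (expn_succ_le k0)) _.
apply: leq_trans (leq_mul (leqnn _) (leq_mul (leqnn _) IH)) _.
by apply: eq_leq; ring.
Qed.

Lemma ffact_le_expn n k : (n ^_ k <= n ^ k)%N.
Proof.
elim: k => [|k IH]; first by rewrite ffactn0.
by rewrite ffactnSr expnSr leq_mul // leq_subr.
Qed.

(** The usual bound [(e n / k)^k] on a binomial coefficient, with 3 for [e] and the division
    cleared. *)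
Lemma bin_expn_le n k : ('C(n, k) * k ^ k <= (3 * n) ^ k)%N.
Proof.
apply: leq_trans (leq_mul (leqnn _) (expn_self_le k)) _.
by rewrite mulnCA bin_ffact expnMn leq_mul2l ffact_le_expn orbT.
Qed.

(** Choosing [S] and [k] of its edges costs about [(18 * D) ^ k] in all, and each of the [j] further
    edges gains a factor [6 * D * k / n]. As [k <= r * j], the bound on [n] lets these gains beat
    [(36 * D) ^ k], which leaves [2 ^ k] to spare. *)
Lemma dense_bound n D r k : (0 < D)%N -> (0 < r)%N -> (0 < k)%N ->
  (6 * D * (36 * D) ^ r * k <= n)%N ->
  (4 * (k + k %/ r + 1) + 4 * (D * D.+1) <= D * n)%N ->
  (#|dense n D k (k + k %/ r + 1)| * 2 ^ k <= #|containing (n := n) D [::]|)%N.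
Proof.
move=> D0 r0 k0 kn hm.
set j := (k %/ r + 1)%N; have -> : (k + k %/ r + 1 = k + j)%N by rewrite /j addnA.
have rj : (k <= r * j)%N.
  by rewrite /j addn1 mulnC ltnW // ltn_ceil.
have hm' : (4 * (k + j) + 4 * (D * D.+1) <= D * n)%N by rewrite /j addnA.
have j0 : (0 < j)%N by rewrite /j addn1.
clearbody j; have := card_dense k D0 hm'; move: #|dense _ _ _ _| #|containing _ _| => d N hd.
have hnj : ((36 * D) ^ k * (6 * D * k) ^ j <= n ^ j)%N.
  apply: leq_trans (_ : ((36 * D) ^ r * (6 * D * k)) ^ j <= _)%N.
    by rewrite [leqRHS]expnMn -expnM leq_mul2r leq_pexp2l ?rj ?orbT // muln_gt0 D0.
  by rewrite leq_exp2r; [apply: leq_trans kn; apply: eq_leq; ring | exact: j0].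
have n0 : (0 < n)%N.
  by apply: leq_trans kn; rewrite !muln_gt0 D0 k0 expn_gt0 muln_gt0 D0.
have c1 : ('C(k * k, k + j) * k ^ (k + j) <= (3 * (k * k)) ^ (k + j))%N.
  apply: leq_trans (bin_expn_le _ _); rewrite leq_mul2l leq_exp2r ?leq_addr ?orbT //.
  by rewrite addn_gt0 k0.
have c0 := bin_expn_le n k.
have P1 : (0 < n ^ (k + j) * k ^ k * k ^ (k + j))%N by rewrite !muln_gt0 !expn_gt0 k0 n0.
rewrite -(leq_pmul2r P1).
apply: leq_trans (_ : 2 ^ k * (('C(n, k) * k ^ k) * ('C(k * k, k + j) * k ^ (k + j)) *
   (2 * D) ^ (k + j) * N) <= _)%N.
  apply: leq_trans (_ : 2 ^ k * k ^ k * k ^ (k + j) * (d * n ^ (k + j)) <= _)%N.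
    by apply: eq_leq; ring.
  apply: leq_trans (leq_mul (leqnn _) hd) _; by apply: eq_leq; ring.
apply: leq_trans (_ : 2 ^ k * ((3 * n) ^ k * (3 * (k * k)) ^ (k + j) * (2 * D) ^ (k + j) * N) <= _)%N.
  by rewrite leq_mul2l !leq_mul ?orbT.
have -> : (2 ^ k * ((3 * n) ^ k * (3 * (k * k)) ^ (k + j) * (2 * D) ^ (k + j) * N) =
   N * n ^ k * k ^ k * k ^ (k + j) * ((36 * D) ^ k * (6 * D * k) ^ j))%N.
  rewrite !expnD !expnMn.
  have -> : (36 ^ k = 2 ^ k * 2 ^ k * (3 ^ k * 3 ^ k))%N by rewrite -!expnMn.
  have -> : (6 ^ j = 2 ^ j * 3 ^ j)%N by rewrite -!expnMn.
  ring.
apply: leq_trans (leq_mul (leqnn _) hnj) _; rewrite !expnD.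
by apply: eq_leq; ring.
Qed.

Section SlowMixing.
Local Arguments Rpower _%_ring_scope _%_ring_scope.

Lemma containing0E n D : #|containing (n := n) D [::]| = #|[set G : graph n | regularb D G]|.
Proof. by apply: eq_card => G; rewrite !inE andbT. Qed.

Lemma eps_std_lt : eps_std < 4^-1.
Proof.
have h : Rlt (IZR 2) (exp 1).
  have := exp_ineq1 1 R1_neq_R0; by rewrite -[Rplus _ _]/(IZR 2).
have {}h : 2%:R < exp 1 by move/RltP: h; rewrite IZRposE INRE.
have e0 : 0 < exp 1 by apply: lt_trans h; rewrite ltr0n.
rewrite /eps_std RinvE RmultE IZRposE INRE ltf_pV2 ?posrE ?mulr_gt0 ?ltr0n //.
by rewrite (_ : nat_of_pos 2 = 2%N) //; move: (exp 1) h => e h; lra.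
Qed.

Section Constants.
Variables (Dr eta lam : RR).
Hypotheses (D3 : 3 <= Dr) (eta0 : 0 < eta) (eta1 : eta < 1) (lam1 : 1 < lam).

Definition slow_exp := Dr - 1 - (Dr - 1)^-1 - eta.

Let A := slow_exp.
(** [A + Yexp * d] runs linearly from [A] at [d = 0] to [Dr] at [d = Dr], so it dominates both the
    exponent [A] of [q] and the exponent [d] of [lam ^+ d]. *)
Let Yexp := (Dr - A) / Dr.

Let Dr0 : 0 < Dr. Proof. by apply: lt_le_trans D3. Qed.
Let inv_le : (Dr - 1)^-1 <= 2^-1.
Proof. by have d3 := D3; rewrite lef_pV2 ?posrE; lra. Qed.
Let inv_gt0 : 0 < (Dr - 1)^-1.
Proof. by have d3 := D3; rewrite invr_gt0; lra. Qed.

Lemma slow_exp_ge0 : 0 <= slow_exp.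
Proof. by have := (D3, eta0, eta1, inv_le, inv_gt0); rewrite /slow_exp => -[[[[]]]]; lra. Qed.

Lemma slow_exp_le : slow_exp <= Dr.
Proof. by have := (D3, eta0, eta1, inv_le, inv_gt0); rewrite /slow_exp => -[[[[]]]]; lra. Qed.

(** [A + 1 + Yexp] falls short of [Dr] by [eta * (1 - 1 / Dr)], at least [2 * eta / 3]. Half of this
    goes to the constants and half to the surplus edges, as [1 + Yexp <= 2]. *)
Lemma exponent_balance : eta / 3 + A + (1 + Yexp) * (1 + eta / 6) <= Dr.
Proof.
have d3 := D3; have e0 := eta0; have e1 := eta1; have l1 := lam1.
have eA : A + (1 + Yexp) = Dr - eta * (1 - Dr^-1).
  by rewrite /Yexp /A /slow_exp; field; rewrite !gt_eqF //; lra.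
have i3 : Dr^-1 <= 3^-1 by rewrite lef_pV2 ?posrE.
have Y2 : 1 + Yexp <= 2.
  rewrite /Yexp; have : (Dr - A) / Dr <= 1; last lra.
  by rewrite ler_pdivrMr // mul1r gerBl; apply: slow_exp_ge0.
nra.
Qed.

Lemma cap_bound (q D d : nat) : Dr = D%:R -> (d <= D)%N -> q%:R <= Rpower lam A ->
  q%:R + D%:R * lam ^+ d <= (D.+1%:R * Rpower lam A) * Rpower lam Yexp ^+ d.
Proof.
have d3 := D3; have e0 := eta0; have e1 := eta1; have l1 := lam1.
move=> DE dD qA; rewrite Rpower_exprE // -mulrA -Rpower_addE.
have dr : d%:R <= Dr by rewrite DE ler_nat.
have A0 := slow_exp_ge0; have AD := slow_exp_le.
have d0 : 0 <= d%:R :> RR by rewrite ler0n.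
have Y0 : 0 <= Yexp by rewrite /Yexp divr_ge0 ?subr_ge0 // ltW.
have h1 : q%:R <= Rpower lam (A + Yexp * d%:R).
  by apply: le_trans qA _; apply: Rpower_le => //; rewrite lerDl mulr_ge0.
have h2 : lam ^+ d <= Rpower lam (A + Yexp * d%:R).
  rewrite -Rpower_natE //; apply: Rpower_le => //.
  have -> : Yexp * d%:R = d%:R - A * (d%:R / Dr) by rewrite /Yexp; field; rewrite gt_eqF.
  have : d%:R / Dr <= 1 by rewrite ler_pdivrMr // mul1r.
  move: (d%:R / Dr) => z z1; rewrite -/A in A0 *; nra.
rewrite -natr1 mulrDl mul1r addrC; apply: lerD h1.
by rewrite ler_wpM2l.
Qed.

Lemma boundary_constant (D s r n k : nat) (c2 : RR) (q : nat) :
  Dr = D%:R -> (2 <= q)%N -> c2 = Rpower (96 * s%:R * D.+1%:R) (- (3 * Dr / eta)) ->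
  (0 < s)%N -> q%:R < c2 * Rpower lam A -> 6 / eta <= r%:R -> (0 < k)%N -> (n <= 2 * s * k)%N ->
  q%:R <= Rpower lam A /\
  'C(n, k)%:R * ((lam * Rpower lam Yexp) ^+ (k + k %/ r) * (D.+1%:R * Rpower lam A) ^+ k) * 16 ^+ k
   <= lam ^+ (D * k).
Proof.
have d3 := D3; have e0 := eta0; have e1 := eta1; have l1 := lam1.
move=> DE q2 c2E s0 hq hr k0 nk.
(* The product of [6 * s] from the binomial coefficient, 16 from the bottleneck and [D.+1] from
   [cap_bound]. *)
set K0 := 96 * s%:R * D.+1%:R in c2E.
have A0 := slow_exp_ge0; have AD := slow_exp_le; rewrite -/A in A0 AD.
have s1 : 1 <= s%:R :> RR by rewrite ler1n.
have D1 : 1 <= D.+1%:R :> RR by rewrite ler1n.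
have K1 : 1 < K0.
  have : 1 <= s%:R * D.+1%:R :> RR by nra.
  by rewrite /K0 -mulrA; lra.
have q2' : 2 <= q%:R :> RR by rewrite ler_nat.
have expo0 : 0 <= 3 * Dr / eta by rewrite divr_ge0 ?mulr_ge0 ?(ltW e0) // ltW.
have c21 : c2 <= 1.
  have <- : Rpower K0 0 = 1 by rewrite -[0]/(0%:R) Rpower_natE.
  by rewrite c2E; apply: Rpower_le => //; rewrite oppr_le0.
have pA := Rpower_gt0 lam A.
have qA : q%:R <= Rpower lam A by nra.
split=> //.
have c2gt0 : 0 < c2 by rewrite c2E; apply: Rpower_gt0.
(* [q >= 2] forces [lam] to be large once [c2] is small. *)
have lamK : K0 <= Rpower lam (eta / 3).
  have h1 : Rpower K0 (3 * Dr / eta) <= Rpower lam Dr.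
    have inv : Rpower K0 (3 * Dr / eta) * c2 = 1.
      by rewrite c2E -Rpower_addE subrr -[0]/(0%:R) Rpower_natE.
    have h : 1 <= c2 * Rpower lam Dr.
      have : Rpower lam A <= Rpower lam Dr by apply: Rpower_le.
      by nra.
    by rewrite -(ler_pM2r c2gt0) inv mulrC.
  have h2 : Rpower (Rpower K0 (3 * Dr / eta)) (eta / (3 * Dr)) <= Rpower (Rpower lam Dr) (eta / (3 * Dr)).
    apply/RleP; apply: Rle_Rpower_l; first by apply/RleP; rewrite divr_ge0 ?mulr_ge0 ?(ltW e0) // ltW.
    by split; [apply/RltP; apply: Rpower_gt0 | apply/RleP].
  move: h2; rewrite !Rpower_mult !RmultE.
  have -> : 3 * Dr / eta * (eta / (3 * Dr)) = 1%:R by field; rewrite !gt_eqF.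
  have -> : Dr * (eta / (3 * Dr)) = eta / 3 by field; rewrite gt_eqF.
  by rewrite Rpower_natE // expr1.
have K00 : 0 <= K0 by lra.
have binle : ('C(n, k) <= (6 * s) ^ k)%N.
  rewrite -(leq_pmul2r (_ : 0 < k ^ k)%N) ?expn_gt0 ?k0 //.
  apply: leq_trans (bin_expn_le n k) _; rewrite -expnMn leq_exp2r //.
  by apply: leq_trans (leq_mul (leqnn 3) nk) _; apply: eq_leq; ring.
have lamY : lam * Rpower lam Yexp = Rpower lam (1 + Yexp).
  by rewrite Rpower_addE -[1]/(1%:R) Rpower_natE // expr1.
have Y0 : 0 <= Yexp by rewrite /Yexp divr_ge0 ?subr_ge0 // ltW.
(* The choice of [r] makes [k / r] at most [k * eta / 6]. *)
have W : (lam * Rpower lam Yexp) ^+ (k + k %/ r) <= Rpower lam ((1 + Yexp) * (1 + eta / 6)) ^+ k.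
  rewrite lamY !Rpower_exprE //; apply: Rpower_le => //.
  rewrite -mulrA; apply: ler_wpM2l; first lra.
  rewrite natrD mulrDl mul1r lerD2l.
  have r0 : 0 < r%:R :> RR by apply: lt_le_trans hr; rewrite divr_gt0.
  have : (k %/ r * r)%N%:R <= k%:R :> RR by rewrite ler_nat leq_divM.
  rewrite natrM => h; rewrite -(ler_pM2r r0); apply: le_trans h _.
  have : 6 <= r%:R * eta by rewrite -ler_pdivrMr.
  have : 0 <= k%:R :> RR by rewrite ler0n.
  by nra.
have B : 'C(n, k)%:R <= (6 * s%:R) ^+ k :> RR.
  by rewrite -[6]/(6%:R) -natrM -natrX ler_nat.
have p1 : 0 <= (lam * Rpower lam Yexp) ^+ (k + k %/ r).
  by rewrite exprn_ge0 // mulr_ge0 ?(ltW (Rpower_gt0 _ _)) //; lra.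
have p2 : 0 <= (D.+1%:R * Rpower lam A) ^+ k.
  by rewrite exprn_ge0 // mulr_ge0 ?(ltW pA).
apply: le_trans (_ : (6 * s%:R) ^+ k * (Rpower lam ((1 + Yexp) * (1 + eta / 6)) ^+ k *
   (D.+1%:R * Rpower lam A) ^+ k) * 16 ^+ k <= _).
  rewrite ler_wpM2r ?exprn_ge0 //; apply: ler_pM => //; first exact: mulr_ge0.
  by rewrite ler_wpM2r.
rewrite -!exprMn exprM lerXn2r // ?nnegrE.
- by rewrite !mulr_ge0 ?(ltW (Rpower_gt0 _ _)).
- by rewrite exprn_ge0 //; lra.
apply: le_trans (_ : K0 * Rpower lam (A + (1 + Yexp) * (1 + eta / 6)) <= _).
  by rewrite Rpower_addE le_eqVlt; apply/orP; left; apply/eqP; rewrite /K0; ring.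
apply: le_trans (ler_wpM2r (ltW (Rpower_gt0 _ _)) lamK) _.
rewrite -Rpower_addE -Rpower_natE // -DE; apply: Rpower_le => //.
by rewrite addrA; apply: exponent_balance.
Qed.

End Constants.
End SlowMixing.

Lemma aas_of_dense (D r s : nat) (P : forall n, graph n -> Prop) (n0 : nat) :
  (0 < D)%N -> (0 < r)%N -> s = (6 * D * (36 * D) ^ r)%N ->
  (forall n (G : graph n), (n0 <= n)%N -> regularb D G ->
     G \notin dense n D (n %/ s)%N (n %/ s + n %/ s %/ r + 1)%N -> P n G) ->
  aas D P.
Proof.
move=> D0 r0 sE hP e /RltP e0.
have s0 : (0 < s)%N by rewrite sE !muln_gt0 expn_gt0 muln_gt0 D0.
have [k0 hk0] := pow2_ge (2 * e^-1).
(* [s * k0.+1] forces [k > k0], so that a dense set has probability below [e]; [48 * (D + 1)] gives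
   the size condition of [dense_bound] and [D < n]. *)
exists (n0 + s * k0.+1 + 48 * (D + 1))%N => n hn Dn.
set k := (n %/ s)%N; have kk0 : (k0 < k)%N.
  by rewrite leq_divRL //; apply: leq_trans hn; rewrite mulnC -addnA addnCA leq_addr.
have hs : (6 * D * 36 <= s)%N.
  rewrite sE leq_mul2l; apply/orP; right.
  apply: leq_trans (_ : (36 * D) ^ 1 <= _)%N; first by rewrite expn1 leq_pmulr.
  by rewrite leq_pexp2l // muln_gt0 D0.
have ks : (k * s <= n)%N by apply: leq_divM.
have db : (#|dense n D k (k + k %/ r + 1)| * 2 ^ k <= #|[set G : graph n | regularb D G]|)%N.
  rewrite -containing0E; apply: dense_bound => //; first exact: leq_ltn_trans kk0.
    by rewrite -sE mulnC.
  have krk : (k %/ r <= k)%N by apply: leq_div.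
  have k1 : (0 < k)%N by apply: leq_ltn_trans kk0.
  have n48 : (48 * (D + 1) <= n)%N by apply: leq_trans hn; apply: leq_addl.
  have h1 : (k * (6 * D * 36) <= n)%N by apply: leq_trans ks; rewrite leq_mul2l hs orbT.
  have h2 : (12 * k * 18 <= n)%N.
    apply: leq_trans h1; have : (k <= k * D)%N by rewrite leq_pmulr.
    by clear; lia.
  have h3 : (D * (48 * (D + 1)) <= D * n)%N by rewrite leq_mul2l n48 orbT.
  have h4 : (n <= D * n)%N by rewrite leq_pmull.
  move: krk k1 h2 h3 h4; clear; set z := (k %/ r)%N; set y := (D * n)%N.
  move=> krk k1 h2 h3 h4; nia.
set N := #|[set G : graph n | regularb D G]|.
have N0 : (0 < N)%N.
  rewrite /N -containing0E regular_exists //.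
  by apply: leq_trans hn; move: D0; clear; lia.
set M := #|[set G : graph n | regularb D G && Defs.decP (P n G)]|.
have NM : (N <= M + #|dense n D k (k + k %/ r + 1)|)%N.
  apply: leq_trans (leq_card_setU _ _); apply: subset_leq_card; apply/subsetP => G.
  rewrite inE => Gr; rewrite inE; case: (boolP (G \in dense n D k (k + k %/ r + 1))) => Gd.
    by rewrite orbT.
  rewrite orbF inE Gr /= /Defs.decP; case: excluded_middle_informative => // nP; case: nP.
  by apply: hP => //; apply: leq_trans hn; rewrite -addnA leq_addr.
have MN : (M <= N)%N by apply: subset_leq_card; apply/subsetP => G; rewrite !inE => /andP[].
have Nr : 0 < N%:R :> RR by rewrite ltr0n.
apply/RltP; rewrite /prob_reg -/M -/N RabsE RminusE RdivE !INRE.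
have -> : M%:R / N%:R - IZR 1 = - ((N%:R - M%:R) / N%:R) by rewrite R1E; field; rewrite gt_eqF.
rewrite normrN ger0_norm ?divr_ge0 ?subr_ge0 ?ler_nat // ltr_pdivrMr //.
set d := #|dense _ _ _ _| in db NM.
have h1 : N%:R - M%:R <= d%:R :> RR by rewrite lerBlDr addrC -natrD ler_nat.
have h2 : d%:R * 2 ^+ k <= N%:R :> RR by rewrite -natrX -natrM ler_nat.
have h3 : 2 * e^-1 <= 2 ^+ k.
  by apply: le_trans hk0 _; rewrite ler_weXn2l ?ler1n // ltnW.
apply: le_lt_trans h1 _.
have h4 : d%:R * (2 * e^-1) <= N%:R.
  by apply: le_trans h2; rewrite ler_wpM2l.
have d0 : 0 <= d%:R :> RR by rewrite ler0n.
have h5 : d%:R * 2 <= e * N%:R.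
  have -> : d%:R * 2 = e * (d%:R * (2 * e^-1)) by field; rewrite gt_eqF.
  by rewrite ler_wpM2l // ltW.
have : 0 < e * N%:R by rewrite mulr_gt0.
lra.
Qed.

Section SlowMixing.
Local Arguments Rpower _%_ring_scope _%_ring_scope.

Lemma slow_mixing (D : nat) (eta : RR) : (3 <= D)%N -> 0 < eta -> eta < 1 ->
  exists c2 : RR, 0 < c2 /\ forall (q : nat) (lam : RR), (2 <= q)%N -> 1 < lam ->
    q%:R < c2 * Rpower lam (slow_exp D%:R eta) ->
    exists b : RR, 0 < b /\
      aas D (fun n G => @mixing_time_ge n q G lam eps_std (Rpower 2%:R (b * INR n))).
Proof.
move=> D3 e0 e1.
have D0 : (0 < D)%N by apply: leq_trans D3.
have D3r : 3 <= D%:R :> RR by rewrite ler_nat.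
have [r' hr'] := archi_bound_nat (6 / eta); pose r := r'.+1.
have hr : 6 / eta <= r%:R by apply: le_trans hr' _; rewrite ler_nat leqnSn.
pose s := (6 * D * (36 * D) ^ r)%N.
have s0 : (0 < s)%N by rewrite !muln_gt0 expn_gt0 muln_gt0 D0.
have [c2 c2E] : exists c2 : RR, c2 = Rpower (96 * s%:R * D.+1%:R) (- (3 * D%:R / eta)) by eexists.
exists c2; split; first by rewrite c2E; apply: Rpower_gt0.
move=> q lam q2 lam1 hq.
(* As [n <= 2 * s * k], the time [2 ^ (n / s)] is at most [4 ^ k]. *)
exists (s%:R^-1); split; first by rewrite invr_gt0 ltr0n.
apply: (@aas_of_dense D r s _ (s * 2)%N D0 (ltn0Sn _) erefl) => n G hn Gr nd.
set k := (n %/ s)%N in nd.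
have k2 : (1 < k)%N by rewrite leq_divRL // mulnC.
have k0 : (0 < k)%N by apply: ltnW.
have nk : (n <= 2 * s * k)%N.
  apply: leq_trans (ltnW (ltn_ceil n s0)) _; rewrite -/k mulSn.
  by rewrite [(2 * s)%N]mulnC -mulnA [(k * s)%N]mulnC -mulnS leq_mul2l; apply/orP; right; lia.
have kn : (k.*2 <= n)%N.
  apply: leq_trans (leq_divM n s); rewrite -/k -muln2 leq_mul2l /s; apply/orP; right.
  by apply: leq_trans (_ : 6 * D <= _)%N; [lia | rewrite leq_pmulr // expn_gt0 muln_gt0 D0].
have [qA hB] := boundary_constant D3r e0 e1 lam1 erefl q2 c2E s0 hq hr k0 nk.
have Y1 : 1 <= Rpower lam ((D%:R - slow_exp D%:R eta) / D%:R).
  have E : Rpower lam 0 = 1 by rewrite -[0]/(0%:R) Rpower_natE.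
  rewrite -{1}E; apply: Rpower_le => //.
  by rewrite divr_ge0 ?subr_ge0 ?slow_exp_le.
have c01 : Ordinal (ltnW q2) != Ordinal q2 by [].
have m0 : (0 < k + k %/ r + 1)%N by rewrite addn1.
have hB' := hB; rewrite -[(k + k %/ r)%N]/((k + k %/ r).+1.-1) -addn1 in hB'.
have [|x hx] := regular_bottleneck Gr (ltW lam1) c01 _ Y1
  (fun d dD => cap_bound D3r e0 e1 lam1 erefl dD qA) k2 kn m0 nd hB'.
  by rewrite mulr_ge0 ?ler0n // ltW ?Rpower_gt0.
have Gs : simpleb G by case/andP: Gr.
have q0 : (0 < q)%N by apply: ltnW.
exists x => t /RltP ht; apply/RltP; rewrite (tvE Gs (ltW lam1) q0).
apply: lt_le_trans eps_std_lt _; apply: hx.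
rewrite -(ler_nat RR) -INRE; apply: le_trans (ltW ht) _.
have -> : (4 ^ k)%:R = Rpower 2%:R (k.*2%:R).
  by rewrite Rpower_natE ?ltr1n // -muln2 mulnC exprM -natrX natrX.
apply: Rpower_le; first by rewrite ltr1n.
rewrite INRE mulrC ler_pdivrMr ?ltr0n // -natrM ler_nat.
by apply: leq_trans nk _; apply: eq_leq; rewrite -muln2; ring.
Qed.

End SlowMixing.

Open Scope R_scope.

Theorem theorem2 (D : nat) (HD : (2 <= D)%N) :
  forall eta : R, 0 < eta < 1 ->
  exists c1 c2 : R, 0 < c1 /\ 0 < c2 /\
  forall (q : nat) (lam : R), (2 <= q)%N -> 1 < lam ->
    (c1 * Rpower lam (INR D - 1 + eta) < INR q ->
       forall eps : R, 0 < eps ->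
       exists p : list R, forall (n : nat) (G : graph n),
         simpleb G -> connectedb G -> max_degree_eq D G ->
         @mixing_time_le n q G lam eps (poly_eval p (INR n)))
    /\
    ((3 <= D)%N ->
       INR q < c2 * Rpower lam (INR D - 1 - / (INR D - 1) - eta) ->
       exists b : R, 0 < b /\
         aas D (fun n G => @mixing_time_ge n q G lam eps_std (Rpower 2 (b * INR n)))).
Proof.
move=> eta [/RltP eta0 /RltP eta1].
have [c1 [c10 fast]] := rapid_mixing HD eta0.
have [c2 [c20 slow]] : exists c2 : R, 0 < c2 /\ forall (q : nat) (lam : R),
    (2 <= q)%N -> 1 < lam -> (3 <= D)%N ->
    INR q < c2 * Rpower lam (INR D - 1 - / (INR D - 1) - eta) ->
    exists b : R, 0 < b /\
      aas D (fun n G => @mixing_time_ge n q G lam eps_std (Rpower 2 (b * INR n))).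
  (* For [D = 2] the second claim is vacuous and any positive [c2] serves. *)
  have [D3|D3] := leqP 3 D; last by exists 1; split=> //; exact: Rlt_0_1.
  have [c2 [/RltP c20 slow]] := slow_mixing D3 eta0 eta1.
  exists c2; split=> // q lam q2 /RltP lam1 _ /RltP; rewrite !INRE => h.
  have [b [/RltP b0 hb]] := slow q lam q2 lam1 h.
  by exists b.
exists c1, c2; split; first exact/RltP.
split=> // q lam q2 lam1; split=> [|D3 h]; last exact: slow.
move=> /RltP; rewrite !INRE => h eps /RltP eps0.
by move/RltP: lam1 => lam1; apply: fast h eps eps0.
Qed.
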